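(* Let $A$ be a $\mathrm{GE}_2$-ring with $\mu_2(A)=\{\pm1\}$ such that the inclusion $T(A)\hookrightarrow B(A)$ induces isomorphisms $H_i(T(A),\mathbb{Z})\simeq H_i(B(A),\mathbb{Z})$ for $i\leq 3$. Then: (i) $H_2(\mathrm{SL}_2(A), \mathrm{SM}_2(A); \mathbb{Z}) \simeq W(A)$. (ii) $H_3(\mathrm{SL}_2(A), \mathrm{SM}_2(A); \mathbb{Z}) \simeq \mathbb{E}_{2,1}^2$, where $\mathbb{E}^2_{2,1}=H_1(\mathrm{SL}_2(A),\mathrm{SM}_2(A);Z_1(A^2),\hat Z_1(A^2))$. In particular, there is an exact sequence $$\mathcal{G}_A \xrightarrow{\ \alpha\ } E_{2,1}^2 \to H_3(\mathrm{SL}_2(A), \mathrm{SM}_2(A); \mathbb{Z}) \to 0.$$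
   Context: Rings are commutative with $1$. $A^\times$ is the unit group, $\mu_2(A)=\{a\in A^\times: a^2=1\}$, $\mathcal{G}_A=A^\times/(A^\times)^2$, $\langle a\rangle$ is the class of $a\in A^\times$. $A$ is a $\mathrm{GE}_2$-ring if $\mathrm{SL}_2(A)$ is generated by elementary matrices. $T(A)\simeq A^\times$ is the group of diagonal matrices in $\mathrm{SL}_2(A)$, $B(A)$ the group of upper triangular matrices in $\mathrm{SL}_2(A)$, and $\mathrm{SM}_2(A)$ the group of monomial matrices in $\mathrm{SL}_2(A)$, i.e. the matrices $\begin{pmatrix} a&0\\0&a^{-1}\end{pmatrix}$ and $\begin{pmatrix}0&a\\-a^{-1}&0\end{pmatrix}$, $a\in A^\times$. Relative homology: for a subgroup $G'\le G$, a $G$-module $M$ and a $G'$-submodule $M'\subseteq M$, $H_n(G,G';M,M')$ is the $n$-th homology of $(C_\bullet(G)\otimes_GM)/(C_\bullet(G')\otimes_{G'}M')$, where $C_\bullet$ denotes the standard resolution of $\mathbb{Z}$; $H_n(G,G';\mathbb{Z})=H_n(G,G';\mathbb{Z},\mathbb{Z})$. A column vector $u\in A^2$ is unimodular if it is the first column of some matrix in $\mathrm{GL}_2(A)$; $\langle u\rangle=uA$. $X_n(A^2)$ is the free abelian group on all $(n+1)$-tuples $(\langle v_0\rangle,\dots,\langle v_n\rangle)$ with every $v_i$ unimodular and the matrix $(v_i,v_j)$ invertible for $i\neq j$; $\mathrm{GL}_2(A)$ acts by left multiplication; $\partial_n:X_n(A^2)\to X_{n-1}(A^2)$ is the alternating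 sum of the maps omitting the $i$-th entry; $Z_1(A^2)=\ker\partial_1$. Put $\pmb\infty=\langle e_1\rangle$, $\pmb 0=\langle e_2\rangle$. $\hat Z_1(A^2)=\mathbb{Z}\cdot Y\subseteq Z_1(A^2)$ with $Y=(\pmb\infty,\pmb0)+(\pmb0,\pmb\infty)$; it is a trivial $\mathrm{SM}_2(A)$-module. $\mathrm{GW}(A)=H_0(\mathrm{SL}_2(A),Z_1(A^2))$, and $W(A)=\mathrm{GW}(A)/\langle\langle-1\rangle+1\rangle$ is its quotient by the subgroup generated by the class of $Y$, which is the element denoted $\langle-1\rangle+1$ of $\mathrm{GW}(A)$. $E^2_{2,1}=\ker\big(H_1(\mathrm{SL}_2(A),Z_1(A^2))\to H_1(\mathrm{SL}_2(A),X_1(A^2))\simeq H_1(T(A),\mathbb{Z})\big)$, the map being induced by inclusion. The map $\alpha$ sends $\langle a\rangle$ to the image in $H_1(\mathrm{SL}_2(A),Z_1(A^2))$ of the class $[\mathrm{diag}(a,a^{-1})]\otimes Y\in H_1(\mathrm{SM}_2(A),\hat Z_1(A^2))$ (bar notation). *)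

(* Defs.v *)
From HB Require Import structures.
From mathcomp Require Import all_boot all_order all_algebra.
From mathcomp Require Import freeg.
From mathcomp Require Import boolp classical_sets zify.

Set Implicit Arguments.
Unset Strict Implicit.
Unset Printing Implicit Defensive.

Import GRing.Theory.
Local Open Scope ring_scope.
Local Open Scope quotient_scope.
Local Open Scope classical_set_scope.

Section Subgroups.
Variable V : zmodType.

Definition zsub (P : zmodClosed V) := {x : V | x \in P}.

HB.instance Definition _ P := SubChoice.on (zsub P).
HB.instance Definition _ P := [SubChoice_isSubZmodule of zsub P by <:].

Definition zspan (S : set V) : {pred V} := fun x =>
  `[< forall H : set V, H 0 -> (forall u v, H u -> H v -> H (u - v)) ->
      S `<=` H -> H x >].

Lemma zspan_closed S : zmod_closed (zspan S).
Proof.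
split=> [|u v /asboolP hu /asboolP hv]; apply/asboolP => H H0 HB SH //.
by apply: (HB); [apply: hu|apply: hv].
Qed.

HB.instance Definition _ S := GRing.isZmodClosed.Build V (zspan S) (zspan_closed S).

Lemma mem_zspan (S : set V) x : S x -> x \in zspan S.
Proof. by move=> Sx; apply/asboolP => H _ _; apply. Qed.

Definition zquot (S : set V) : zmodType := Quotient.quot (zspan S).

Definition zproj (S : set V) : {additive V -> zquot S} := \pi_(Quotient.quot (zspan S)).

Lemma zproj_eq0 S x : (zproj S x == 0) = (x \in zspan S).
Proof.
have := Quotient.idealrBE (zspan S) x 0.
by rewrite subr0 => ->; rewrite -[in LHS](raddf0 (zproj S)).
Qed.

Lemma zprojK S (q : zquot S) : zproj S (repr q) = q.
Proof. exact: reprK. Qed.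

End Subgroups.

Section UniversalProperty.
Variables (V W : zmodType) (S : set V) (f : {additive V -> W}).
Hypothesis fS : forall x, S x -> f x = 0.

Lemma zspan_ker x : x \in zspan S -> f x = 0.
Proof.
move/asboolP/(_ [set y | f y = 0]); apply=> //=; first exact: raddf0.
by move=> u v fu fv; rewrite raddfB fu fv subr0.
Qed.

Definition zlift_fun (q : zquot S) : W := f (repr q).

Lemma zlift_funE x : zlift_fun (zproj S x) = f x.
Proof.
apply/eqP; rewrite -subr_eq0 -raddfB; apply/eqP/zspan_ker.
by rewrite -zproj_eq0 raddfB zprojK subrr.
Qed.

Lemma zlift_zmod_morphism : zmod_morphism zlift_fun.
Proof.
by move=> p q; rewrite -[p]zprojK -[q]zprojK -raddfB !zlift_funE raddfB.
Qed.

HB.instance Definition _ :=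
  GRing.isZmodMorphism.Build (zquot S) W zlift_fun zlift_zmod_morphism.

Definition zlift : {additive zquot S -> W} := zlift_fun.

Lemma zliftE x : zlift (zproj S x) = f x. Proof. exact: zlift_funE. Qed.

End UniversalProperty.

Section Restriction.
Variables (V W : zmodType) (P : zmodClosed V) (Q : zmodClosed W).
Variables (f : {additive V -> W}) (fP : forall x, x \in P -> f x \in Q).

Definition zsub_map_fun (x : zsub P) : zsub Q := Sub (f (val x)) (fP (valP x)).

Lemma zsub_map_zmod_morphism : zmod_morphism zsub_map_fun.
Proof. by move=> x y; apply: val_inj; exact: raddfB. Qed.

HB.instance Definition _ :=
  GRing.isZmodMorphism.Build (zsub P) (zsub Q) zsub_map_fun zsub_map_zmod_morphism.

Definition zsub_map : {additive zsub P -> zsub Q} := zsub_map_fun.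

End Restriction.

Section Kernel.
Variables (V W : zmodType) (f : {additive V -> W}).

Definition zker : {pred V} := fun x => f x == 0.

Lemma zker_closed : zmod_closed zker.
Proof.
split=> [|u v]; rewrite !unfold_in ?raddf0 // => /eqP fu /eqP fv.
by rewrite raddfB fu fv subrr.
Qed.

HB.instance Definition _ := GRing.isZmodClosed.Build V zker zker_closed.

End Kernel.

Definition ziso (V W : zmodType) := exists f : {additive V -> W}, bijective f.

Section Free.
Variables (K : choiceType) (V : zmodType) (f : K -> V).

Definition fg_ext_fun (x : {freeg K}) : V := fglift (f : K -> zmodule V) x.

Lemma fg_ext_zmod_morphism : zmod_morphism fg_ext_fun.
Proof. move=> x y; apply: (@lift_is_additive int K (zmodule V) f). Qed.

HB.instance Definition _ :=
  GRing.isZmodMorphism.Build {freeg K} V fg_ext_fun fg_ext_zmod_morphism.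

Definition fg_ext : {additive {freeg K} -> V} := fg_ext_fun.

Lemma fg_extE k : fg_ext << k >> = f k.
Proof. by rewrite /= /fg_ext_fun liftU scale1r. Qed.

End Free.

Lemma fg_eq (K : choiceType) (V : zmodType) (f g : {additive {freeg K} -> V}) :
  (forall k, f << k >> = g << k >>) -> f =1 g.
Proof.
move=> fg x; rewrite -(freeg_sumE x) !raddf_sum; apply: eq_bigr => k _.
have -> : << coeff k x *g k >> = << k >> *~ coeff k x :> {freeg K}.
  by rewrite freegU_mulz intz.
by rewrite !raddfMz fg.
Qed.

Record gmodule (G : groupType) := GModule {
  gmod :> zmodType;
  gact : G -> {additive gmod -> gmod};
  gact1 : forall m, gact 1%g m = m;
  gactM : forall g h m, gact (g * h)%g m = gact g (gact h m) }.

Arguments gact {G g0} g : rename.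

Section Modules.
Variable G : groupType.

Definition trivial_module (V : zmodType) : gmodule G :=
  @GModule G V (fun=> idfun) (fun=> erefl) (fun _ _ _ => erefl).

Section FreeModule.
Variables (K : choiceType) (act : G -> K -> K).
Hypotheses (act1 : forall k, act 1%g k = k)
           (actM : forall g h k, act (g * h)%g k = act g (act h k)).

Definition fg_act (g : G) : {additive {freeg K} -> {freeg K}} :=
  fg_ext (fun k => << act g k >>).

Lemma fg_act1 m : fg_act 1%g m = m.
Proof.
have : fg_act 1%g =1 idfun by apply: fg_eq => k; rewrite fg_extE act1.
exact.
Qed.

Lemma fg_actM g h m : fg_act (g * h)%g m = fg_act g (fg_act h m).
Proof.
have : fg_act (g * h)%g =1 fg_act g \o fg_act h.
  by apply: fg_eq => k; rewrite /= !fg_extE actM.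
exact.
Qed.

Definition free_module : gmodule G := GModule fg_act1 fg_actM.
End FreeModule.

Section Submodule.
Variables (M : gmodule G) (P : zmodClosed M).
Hypothesis MP : forall g m, m \in P -> gact g m \in P.

Definition sub_act (g : G) : {additive zsub P -> zsub P} := zsub_map (MP g).

Lemma sub_act1 m : sub_act 1%g m = m.
Proof. by apply: val_inj; rewrite /= gact1. Qed.

Lemma sub_actM g h m : sub_act (g * h)%g m = sub_act g (sub_act h m).
Proof. by apply: val_inj; rewrite /= gactM. Qed.

Definition submodule : gmodule G := GModule sub_act1 sub_actM.
End Submodule.

(* The left module C is regarded as the right module with c.g := g^-1 c, so
   that C (x)_G M is C (x)_Z M modulo (g c) (x) (g m) = c (x) m. *)
Section Tensor.
Variables C M : gmodule G.

Definition tensor_rel : set {freeg (C * M)} := [set r |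
  [\/ exists c c' m, r = << (c + c', m) >> - << (c, m) >> - << (c', m) >>,
      exists c m m', r = << (c, m + m') >> - << (c, m) >> - << (c, m') >>
    | exists g c m, r = << (gact g c, gact g m) >> - << (c, m) >>]].

Definition tensor : zmodType := zquot tensor_rel.

Definition tens (c : C) (m : M) : tensor := zproj tensor_rel << (c, m) >>.

Lemma tensDl c c' m : tens (c + c') m = tens c m + tens c' m.
Proof.
apply/eqP; rewrite -subr_eq0 opprD addrA /tens -!raddfB zproj_eq0.
by apply: mem_zspan; apply: Or31; exists c, c', m.
Qed.

Lemma tensDr c m m' : tens c (m + m') = tens c m + tens c m'.
Proof.
apply/eqP; rewrite -subr_eq0 opprD addrA /tens -!raddfB zproj_eq0.
by apply: mem_zspan; apply: Or32; exists c, m, m'.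
Qed.

Lemma tensG g c m : tens (gact g c) (gact g m) = tens c m.
Proof.
apply/eqP; rewrite -subr_eq0 /tens -!raddfB zproj_eq0.
by apply: mem_zspan; apply: Or33; exists g, c, m.
Qed.

Section Lift.
Variables (V : zmodType) (b : C -> M -> V).
Hypotheses (bDl : forall c c' m, b (c + c') m = b c m + b c' m)
           (bDr : forall c m m', b c (m + m') = b c m + b c m')
           (bG : forall g c m, b (gact g c) (gact g m) = b c m).

Lemma tens_lift_subproof x : tensor_rel x -> fg_ext (fun p => b p.1 p.2) x = 0.
Proof.
case=> [[c [c' [m ->]]]|[c [m [m' ->]]]|[g [c [m ->]]]].
- by rewrite !raddfB !fg_extE /= bDl addrAC addrK subrr.
- by rewrite !raddfB !fg_extE /= bDr addrAC addrK subrr.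
- by rewrite !raddfB !fg_extE /= bG subrr.
Qed.

Definition tens_lift : {additive tensor -> V} := zlift tens_lift_subproof.

Lemma tens_liftE c m : tens_lift (tens c m) = b c m.
Proof. by rewrite /tens_lift zliftE fg_extE. Qed.
End Lift.

Lemma tens_eq (V : zmodType) (f g : {additive tensor -> V}) :
  (forall c m, f (tens c m) = g (tens c m)) -> f =1 g.
Proof.
move=> fg x; rewrite -[x]zprojK; move: (repr x) => {}x.
have : f \o zproj tensor_rel =1 g \o zproj tensor_rel.
  by apply: fg_eq => -[c m]; exact: fg.
exact.
Qed.
End Tensor.
End Modules.

Arguments trivial_module : clear implicits.

Record complex := Complex {
  cx :> nat -> zmodType;
  cxd : forall n, {additive cx n.+1 -> cx n};
  cxdd : forall n x, cxd n (cxd n.+1 x) = 0 }.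

Arguments cxd : clear implicits.

Section Homology.
Variable C : complex.

Definition cycle n : {pred C n} :=
  match n return {pred C n} with
  | 0 => fun=> true
  | m.+1 => zker (cxd C m)
  end.

Lemma cycle_closed n : zmod_closed (@cycle n).
Proof. by case: n => [|n]; [split | exact: zker_closed]. Qed.

HB.instance Definition _ n := GRing.isZmodClosed.Build (C n) (@cycle n) (cycle_closed n).

Definition boundary n : set (zsub (@cycle n)) :=
  [set z | exists y, cxd C n y = val z].

Definition homology n : zmodType := zquot (@boundary n).

Definition hclass n (x : C n) (cx : x \in @cycle n) : homology n :=
  zproj (@boundary n) (Sub x cx).
End Homology.

Record cmap (C D : complex) := CMap {
  cmapf :> forall n, {additive C n -> D n};
  cmapd : forall n x, cmapf n (cxd C n x) = cxd D n (cmapf n.+1 x) }.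

Section HomologyMap.
Variables (C D : complex) (f : cmap C D).

Lemma cmap_cycle n x : x \in @cycle C n -> f n x \in @cycle D n.
Proof.
case: n x => // n x; rewrite !unfold_in => /eqP dx.
by rewrite -cmapd dx raddf0.
Qed.

Lemma cmap_boundary n x :
  boundary x -> (zproj (@boundary D n) \o zsub_map (@cmap_cycle n)) x = 0.
Proof.
case=> y dy; apply/eqP; rewrite zproj_eq0; apply: mem_zspan.
by exists (f n.+1 y); rewrite -cmapd dy.
Qed.

Definition homology_map n : {additive homology C n -> homology D n} :=
  zlift (@cmap_boundary n).

Definition coker n : zmodType := zquot (range (f n)).

Lemma coker_d_subproof n x :
  range (f n.+1) x -> (zproj (range (f n)) \o cxd D n) x = 0.
Proof.
case=> y _ <-; apply/eqP; rewrite /= zproj_eq0 -cmapd.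
by apply: mem_zspan; exists (cxd C n y).
Qed.

Definition coker_d n : {additive coker n.+1 -> coker n} :=
  zlift (@coker_d_subproof n).

Lemma coker_dd n x : coker_d n (coker_d n.+1 x) = 0.
Proof.
rewrite -[x]zprojK /coker_d [X in zlift _ X]zliftE.
by rewrite [LHS]zliftE /= cxdd raddf0.
Qed.

Definition coker_complex : complex := Complex coker_dd.
End HomologyMap.

Section Faces.
Variable T : Type.

Definition face n (i : 'I_n.+2) (t : n.+2.-tuple T) : n.+1.-tuple T :=
  [tuple tnth t (fintype.lift i j) | j < n.+1].

Lemma faceC n (t : n.+3.-tuple T) (i j : 'I_n.+2) : (i <= j)%N ->
  face i (face (fintype.lift ord0 j) t) = face j (face (widen_ord (leqnSn _) i) t).
Proof.
move=> le_ij; apply: eq_from_tnth => k; rewrite !tnth_mktuple; congr tnth.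
apply: val_inj => /=; rewrite /bump /=; move: le_ij; case: (leqP j k); case: (leqP i k) => /=; lia.
Qed.
End Faces.

Definition alt_sum (K K' : choiceType) n (d : 'I_n -> K -> K') :
  {additive {freeg K} -> {freeg K'}} :=
  fg_ext (fun k => \sum_(i < n) << (-1) ^+ i *g d i k >>).

Lemma alt_sum0 n (K K' K'' : choiceType) (d : 'I_n.+2 -> K -> K')
    (e : 'I_n.+1 -> K' -> K'') :
  (forall (i j : 'I_n.+1) k, (i <= j)%N ->
    e i (d (fintype.lift ord0 j) k) = e j (d (widen_ord (leqnSn _) i) k)) ->
  forall x, alt_sum e (alt_sum d x) = 0.
Proof.
move=> de x.
pose z : {additive {freeg K} -> {freeg K''}} := fg_ext (fun=> 0).
have <- : z x = 0.
  by rewrite -(freeg_sumE x) raddf_sum big1 // => k _; rewrite /= /fg_ext_fun liftU scaler0.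
have E : alt_sum e \o alt_sum d =1 z.
  apply: fg_eq => k; rewrite /= -/(alt_sum d << k >>) -/(alt_sum e _) [RHS]fg_extE.
  rewrite [alt_sum d _]fg_extE raddf_sum /=.
  have fU c k' : << c *g k' >> = << k' >> *~ c :> {freeg K'}.
    by rewrite freegU_mulz intz.
  have fU' c k' : << c *g k' >> = << k' >> *~ c :> {freeg K''}.
    by rewrite freegU_mulz intz.
  pose F (j : 'I_n.+2) (i : 'I_n.+1) : {freeg K''} :=
    << e i (d j k) >> *~ ((-1) ^+ i * (-1) ^+ j).
  rewrite (eq_bigr (fun j => \sum_(i < n.+1) F j i)); last first.
    move=> j _; rewrite fU raddfMz -/(alt_sum e _) [alt_sum e _]fg_extE mulrz_suml.
    by apply: eq_bigr => i _; rewrite fU' /F mulrzA.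
  rewrite (eq_bigr (fun j : 'I_n.+2 => \sum_(i < n.+1 | (i < j)%N) F j i
                         + \sum_(i < n.+1 | (j <= i)%N) F j i)); last first.
    move=> j _; rewrite (bigID (fun i : 'I_n.+1 => (i < j)%N)) /=; congr (_ + _).
    by apply: eq_bigl => i; rewrite -leqNgt.
  rewrite big_split /= big_ord_recl big_pred0 ?add0r; last by move=> i; rewrite ltn0.
  rewrite [X in _ + X]big_ord_recr /= [X in _ + (_ + X)]big_pred0 ?addr0; last first.
    by move=> i; rewrite leqNgt ltn_ord.
  rewrite [X in X + _](exchange_big_dep predT) //=.
  rewrite -[LHS]big_split big1 //= => i _.
  rewrite (eq_bigl (fun j : 'I_n.+1 => (i <= j)%N)) // -[LHS]big_split /= big1 // => j le_ij.
  by rewrite /F de // /bump /= exprS mulN1r mulrN mulrC mulrNz addNr.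
exact: E.
Qed.

Definition fg_map (K K' : choiceType) (h : K -> K') : {additive {freeg K} -> {freeg K'}} :=
  fg_ext (fun k => << h k >>).

Lemma alt_sum_map n (K K' L L' : choiceType) (d : 'I_n -> K -> K')
    (e : 'I_n -> L -> L') (h : K -> L) (h' : K' -> L') :
  (forall i k, e i (h k) = h' (d i k)) ->
  forall x, alt_sum e (fg_map h x) = fg_map h' (alt_sum d x).
Proof.
move=> eh x.
have E : alt_sum e \o fg_map h =1 fg_map h' \o alt_sum d.
  apply: fg_eq => k.
  change (alt_sum e (fg_map h << k >>) = fg_map h' (alt_sum d << k >>)).
  rewrite /fg_map /alt_sum !fg_extE.
  rewrite raddf_sum; apply: eq_bigr => i _.
  have -> : << (-1) ^+ i *g d i k >> = << d i k >> *~ (-1) ^+ i :> {freeg K'}.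
    by rewrite freegU_mulz intz.
  by rewrite raddfMz fg_extE eh freegU_mulz intz.
exact: E.
Qed.

Section StandardResolution.
Variable G : groupType.

Section Degree.
Variable n : nat.

Definition diag_act (g : G) (t : n.+1.-tuple G) : n.+1.-tuple G :=
  [tuple of map (fun x => g * x)%g t].

Lemma diag_act1 t : diag_act 1%g t = t.
Proof. by apply: eq_from_tnth => i; rewrite tnth_map mul1g. Qed.

Lemma diag_actM g h t : diag_act (g * h)%g t = diag_act g (diag_act h t).
Proof. by apply: eq_from_tnth => i; rewrite !tnth_map mulgA. Qed.

Definition std_res : gmodule G := free_module diag_act1 diag_actM.
End Degree.

Definition std_d n : {additive std_res n.+1 -> std_res n} := alt_sum (@face G n).

Lemma std_dd n x : std_d n (std_d n.+1 x) = 0.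
Proof. by apply: alt_sum0 => i j t; exact: faceC. Qed.

Lemma std_d_act n g x : std_d n (gact g x) = gact g (std_d n x).
Proof.
apply: alt_sum_map => i t; apply: eq_from_tnth => j.
by rewrite !(tnth_map, tnth_mktuple).
Qed.

Variable M : gmodule G.

Definition gchain_d n : {additive tensor (std_res n.+1) M -> tensor (std_res n) M}.
Proof.
apply: (@tens_lift _ _ _ _ (fun c m => tens (std_d n c) m)).
- by move=> c c' m; rewrite raddfD tensDl.
- by move=> c m m'; rewrite tensDr.
- by move=> g c m; rewrite std_d_act tensG.
Defined.

Lemma gchain_dd n x : gchain_d n (gchain_d n.+1 x) = 0.
Proof.
pose z : {additive tensor (std_res n.+2) M -> tensor (std_res n) M} := \0.
have E : gchain_d n \o gchain_d n.+1 =1 z.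
  apply: tens_eq => c m.
  change (gchain_d n (gchain_d n.+1 (tens c m)) = 0).
  rewrite /gchain_d !tens_liftE std_dd.
  by apply: (@addrI _ (tens 0 m)); rewrite -tensDl !addr0.
exact: E.
Qed.

Definition gchain : complex := Complex gchain_dd.
End StandardResolution.

Definition group_homology (G : groupType) n (M : gmodule G) := homology (gchain M) n.

Record pair_hom (G' G : groupType) (M' : gmodule G') (M : gmodule G) := PairHom {
  pgrp : {multiplicative G' -> G};
  pmod : {additive M' -> M};
  pmodE : forall g m, pmod (gact g m) = gact (pgrp g) (pmod m) }.

Definition trivial_pair_hom (G' G : groupType) (f : {multiplicative G' -> G})
    (V : zmodType) : pair_hom (trivial_module G' V) (trivial_module G V) :=
  @PairHom G' G (trivial_module G' V) (trivial_module G V) f idfun (fun _ _ => erefl).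

Section Functoriality.
Variables (G' G : groupType) (M' : gmodule G') (M : gmodule G).
Variable f : pair_hom M' M.

Definition std_map n : {additive std_res G' n -> std_res G n} :=
  fg_map (fun t : n.+1.-tuple G' => [tuple of map (pgrp f) t]).

Lemma std_map_d n x : std_map n (std_d G' n x) = std_d G n (std_map n.+1 x).
Proof.
apply/esym; apply: alt_sum_map => i t; apply: eq_from_tnth => j.
by rewrite !(tnth_map, tnth_mktuple).
Qed.

Lemma std_map_act n g x : std_map n (gact g x) = gact (pgrp f g) (std_map n x).
Proof.
have E : std_map n \o gact g =1 gact (pgrp f g) \o std_map n.
  apply: fg_eq => t.
  change (std_map n (fg_act (@diag_act G' n) g << t >>)
          = fg_act (@diag_act G n) (pgrp f g) (std_map n << t >>)).
  rewrite /std_map /fg_map /fg_act !fg_extE.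
  congr << _ >>; apply: eq_from_tnth => j; rewrite !tnth_map.
  exact: gmulfM.
exact: E.
Qed.

Definition gchain_map_fun n : {additive gchain M' n -> gchain M n}.
Proof.
apply: (@tens_lift _ _ _ _ (fun c m => tens (std_map n c) (pmod f m))).
- by move=> c c' m; rewrite raddfD tensDl.
- by move=> c m m'; rewrite raddfD tensDr.
- by move=> g c m; rewrite std_map_act pmodE tensG.
Defined.

Lemma gchain_map_d n x :
  gchain_map_fun n (cxd (gchain M') n x) = cxd (gchain M) n (gchain_map_fun n.+1 x).
Proof.
have E : gchain_map_fun n \o cxd (gchain M') n
          =1 cxd (gchain M) n \o gchain_map_fun n.+1.
  apply: tens_eq => c m.
  change (gchain_map_fun n (gchain_d M' n (tens c m))
          = gchain_d M n (gchain_map_fun n.+1 (tens c m))).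
  rewrite /gchain_d /gchain_map_fun.
  by rewrite !tens_liftE std_map_d.
exact: E.
Qed.

Definition gchain_map : cmap (gchain M') (gchain M) := CMap gchain_map_d.

Definition group_homology_map n :
  {additive group_homology n M' -> group_homology n M} := homology_map gchain_map n.

(* H_n(G, G'; M, M') when f is the inclusion of a subgroup G' in G and of a
   G'-submodule M' in M: the quotient complex has in degree n the cokernel of
   C_n(G') (x)_G' M' -> C_n(G) (x)_G M. *)
Definition relative_homology n := homology (coker_complex gchain_map) n.
End Functoriality.

(* Under H_0(G, M) = M_G this is the class of m. *)
Definition class0 (G : groupType) (M : gmodule G) (m : M) : group_homology 0 M :=
  @hclass (gchain M) 0 (tens (<< [tuple 1%g] >> : std_res G 0) m) erefl.

(* [g] (x) m in bar notation: [g] is the tuple (1, g) of the homogeneous standard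
   resolution. *)
Definition bar1 (G : groupType) (M : gmodule G) (g : G) (m : M) : gchain M 1 :=
  tens (<< [tuple 1%g; g] >> : std_res G 1) m.

Lemma bar1_cycle (G : groupType) (M : gmodule G) (g : G) (m : M) :
  gact g m = m -> bar1 g m \in @cycle (gchain M) 1.
Proof.
move=> gm; rewrite unfold_in /zker.
have -> : cxd (gchain M) 0 (bar1 g m) = gchain_d M 0 (bar1 g m) by [].
rewrite /bar1 /gchain_d tens_liftE /std_d /alt_sum fg_extE.
rewrite big_ord_recl big_ord1 /= expr0 expr1.
set t0 := face _ _; set t1 := face _ _.
have -> : t0 = diag_act g [tuple 1%g].
  apply: eq_from_tnth => i; rewrite /t0 tnth_mktuple tnth_map ord1.
  by rewrite !(tnth_nth 1%g) /= mulg1.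
have -> : t1 = [tuple 1%g].
  by apply: eq_from_tnth => i; rewrite /t1 tnth_mktuple (ord1 i) !(tnth_nth 1%g).
have -> : << -1 *g [tuple 1%g] >> = - << [tuple 1%g] >> :> {freeg 1.-tuple G}.
  by rewrite freegUN.
have gE : << diag_act g [tuple 1%g] >> = gact g (<< [tuple 1%g] >> : std_res G 0).
  by rewrite /= /fg_act fg_extE.
have := tensG g (<< [tuple 1%g] >> : std_res G 0) m.
rewrite -gE gm => tE; rewrite -subr_eq0; apply/eqP.
apply: (@addIr _ (tens (<< [tuple 1%g] >> : std_res G 0) m)).
by rewrite subr0 -tensDl subrK add0r.
Qed.

Section Subgroup.
Variables (G : groupType) (P : {pred G}) (cP : group_closed P).

Definition gsub of group_closed P := {g : G | g \in P}.

HB.instance Definition _ := SubChoice.on (gsub cP).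

Fact gsub_closed : group_closed [pred g | g \in P].
Proof. exact: cP. Qed.

HB.instance Definition _ := SubChoice_isSubGroup.Build G _ (gsub cP) gsub_closed.

Definition gsub_val : {multiplicative gsub cP -> G} := val.
End Subgroup.

Section SubgroupInclusion.
Variables (G : groupType) (P Q : {pred G}) (cP : group_closed P) (cQ : group_closed Q).
Hypothesis PQ : {subset P <= Q}.

Definition gsub_incl_fun (x : gsub cP) : gsub cQ := Sub (val x) (PQ (valP x)).

Lemma gsub_incl_gmulfM : {morph gsub_incl_fun : x y / (x * y)%g >-> (x * y)%g}.
Proof. by move=> x y; apply: val_inj. Qed.

HB.instance Definition _ :=
  isMultiplicative.Build (gsub cP) (gsub cQ) gsub_incl_fun gsub_incl_gmulfM.

Definition gsub_incl : {multiplicative gsub cP -> gsub cQ} := gsub_incl_fun.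
End SubgroupInclusion.

Definition gspan (G : groupType) (S : set G) : set G := [set x |
  forall H : set G, H 1%g -> (forall u v, H u -> H v -> H (u / v)%g) ->
    S `<=` H -> H x].

Section RestrictedModule.
Variables (G' G : groupType) (f : {multiplicative G' -> G}) (M : gmodule G).

Definition res_act (g : G') : {additive M -> M} := gact (f g).

Lemma res_act1 m : res_act 1%g m = m.
Proof.
have f1 : f 1%g = 1%g by apply: (@mulgI _ (f 1%g)); rewrite -gmulfM !mulg1.
by rewrite /res_act f1 gact1.
Qed.

Lemma res_actM g h m : res_act (g * h)%g m = res_act g (res_act h m).
Proof. by rewrite /res_act gmulfM gactM. Qed.

Definition res_module : gmodule G' := GModule res_act1 res_actM.
End RestrictedModule.

(* A comUnitRingType satisfies 1 != 0, so that the zero ring is excluded; its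
   unit predicate is that of all invertible elements. *)
Section Matrices.
Variable A : comUnitRingType.

Definition mx2 (a b c d : A) : 'M[A]_2 :=
  \matrix_(i, j) if i == 0 then (if j == 0 then a else b)
                 else (if j == 0 then c else d).

Lemma mx2E a b c d : (mx2 a b c d 0 0 = a) * (mx2 a b c d 0 1 = b) *
  (mx2 a b c d 1 0 = c) * (mx2 a b c d 1 1 = d).
Proof. by rewrite !mxE. Qed.

Lemma mx2P (M : 'M[A]_2) : M = mx2 (M 0 0) (M 0 1) (M 1 0) (M 1 1).
Proof.
apply/matrixP => i j; rewrite mxE.
have o2 (k : 'I_2) : k = 0 \/ k = 1.
  by case: k => -[|[|//]] lt_k; [left|right]; apply: val_inj.
by case: (o2 i) => ->; case: (o2 j) => ->.
Qed.

Lemma mx2M a b c d a' b' c' d' : mx2 a b c d *m mx2 a' b' c' d' =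
  mx2 (a * a' + b * c') (a * b' + b * d') (c * a' + d * c') (c * b' + d * d').
Proof.
by rewrite [LHS]mx2P; congr mx2; rewrite !mxE !big_ord_recl big_ord0 !mxE addr0.
Qed.

Lemma mx2_1 : mx2 1 0 0 1 = 1%:M.
Proof. by rewrite [RHS]mx2P !mxE. Qed.

Lemma det_mx2 a b c d : \det (mx2 a b c d) = a * d - b * c.
Proof.
rewrite (expand_det_row _ 0) !big_ord_recl big_ord0 /cofactor !det_mx11 !mxE /=.
by rewrite expr0 expr1 mul1r mulN1r mulrN addr0.
Qed.

Definition SL2 := {M : 'M[A]_2 | \det M == 1}.

HB.instance Definition _ := SubChoice.on SL2.

Implicit Types g h : SL2.

Lemma SL2_det g : \det (val g) = 1. Proof. exact/eqP/(valP g). Qed.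

Lemma SL2_unitmx g : val g \in unitmx.
Proof. by rewrite unitmxE SL2_det unitr1. Qed.

Fact SL2_mul_subproof g h : \det (val g *m val h) == 1.
Proof. by rewrite det_mulmx !SL2_det mulr1. Qed.
Definition SL2_mul g h : SL2 := exist _ (val g *m val h) (SL2_mul_subproof g h).

Fact SL2_one_subproof : \det (1%:M : 'M[A]_2) == 1.
Proof. by rewrite det1. Qed.
Definition SL2_one : SL2 := exist _ 1%:M SL2_one_subproof.

Fact SL2_inv_subproof g : \det (invmx (val g)) == 1.
Proof. by rewrite det_inv SL2_det invr1. Qed.
Definition SL2_inv g : SL2 := exist _ (invmx (val g)) (SL2_inv_subproof g).

Fact SL2_mulA : associative SL2_mul.
Proof. by move=> g h k; apply: val_inj; rewrite /= mulmxA. Qed.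
Fact SL2_mul1 : left_id SL2_one SL2_mul.
Proof. by move=> g; apply: val_inj; rewrite /= mul1mx. Qed.
Fact SL2_mulr1 : right_id SL2_one SL2_mul.
Proof. by move=> g; apply: val_inj; rewrite /= mulmx1. Qed.
Fact SL2_mulV : left_inverse SL2_one SL2_inv SL2_mul.
Proof. by move=> g; apply: val_inj; rewrite /= mulVmx // SL2_unitmx. Qed.
Fact SL2_mulrV : right_inverse SL2_one SL2_inv SL2_mul.
Proof. by move=> g; apply: val_inj; rewrite /= mulmxV // SL2_unitmx. Qed.

HB.instance Definition _ :=
  isGroup.Build SL2 SL2_mulA SL2_mul1 SL2_mulr1 SL2_mulV SL2_mulrV.

Lemma SL2_invE a b c d g : val g = mx2 a b c d -> val (g^-1)%g = mx2 d (- b) (- c) a.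
Proof.
move=> gE; have := SL2_det g; rewrite gE det_mx2 => det1E.
have /= := congr1 val (mulVg g); rewrite gE.
move/(congr1 (mulmx^~ (mx2 d (- b) (- c) a))); rewrite mul1mx -mulmxA mx2M => <-.
rewrite !mulrN [d * c]mulrC [c * b]mulrC [a * b]mulrC addNr [- _ + _]addrC.
rewrite [d * a]mulrC det1E [c * d]mulrC subrr.
by rewrite mx2_1 mulmx1.
Qed.

Definition T2 : {pred SL2} := fun g => is_diag_mx (val g).

Definition B2 : {pred SL2} := fun g => val g 1 0 == 0.

Definition SM2 : {pred SL2} := fun g => `[< exists2 a : A, a \is a GRing.unit &
  val g = mx2 a 0 0 a^-1 \/ val g = mx2 0 a (- a^-1) 0 >].

Lemma is_diag_mx2 (M : 'M[A]_2) : is_diag_mx M = (M 0 1 == 0) && (M 1 0 == 0).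
Proof.
apply/is_diag_mxP/andP => [dM|[/eqP M01 /eqP M10] i j]; first by split; apply/eqP/dM.
by rewrite [M]mx2P M01 M10 mxE; case: i j => -[|[|//]] ? [[|[|//]] ?].
Qed.

Lemma SL2_mulE g h : val (g * h)%g = val g *m val h. Proof. by []. Qed.

Lemma B2_closed : group_closed B2.
Proof.
split=> [|g h]; first by rewrite unfold_in /B2 /= mxE.
rewrite !unfold_in /B2 => /eqP g10 /eqP h10.
rewrite SL2_mulE (SL2_invE (mx2P (val h))) [val g]mx2P g10 h10 mx2M mx2E.
by rewrite mul0r oppr0 mulr0 addr0.
Qed.

Lemma T2_closed : group_closed T2.
Proof.
split=> [|g h]; first by rewrite unfold_in /T2 /= is_diag_mx2 !mxE eqxx.
rewrite !unfold_in /T2 !is_diag_mx2 => /andP[/eqP g01 /eqP g10] /andP[/eqP h01 /eqP h10].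
rewrite SL2_mulE (SL2_invE (mx2P (val h))) [val g]mx2P g01 g10 h01 h10 mx2M !mx2E.
by rewrite !mul0r oppr0 !mulr0 !addr0 eqxx.
Qed.

Lemma SM2_closed : group_closed SM2.
Proof.
split=> [|g h].
  apply/asboolP; exists 1; first exact: unitr1.
  by left; rewrite invr1 mx2_1.
move=> /asboolP[a ua ga] /asboolP[b ub hb]; apply/asboolP.
have bE : b * b^-1 = 1 by rewrite mulrV.
case: ga => ga; case: hb => hb; rewrite SL2_mulE (SL2_invE hb) ga mx2M;
  rewrite !(mul0r, mulr0, add0r, addr0, oppr0, mulrN, mulNr, opprK).
- exists (a * b^-1); first by rewrite unitrM ua unitrV.
  by left; rewrite invrM ?unitrV // invrK mulrC [b * _]mulrC.
- exists (- (a * b)); first by rewrite unitrN unitrM ua.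
  by right; rewrite invrN opprK invrM // [b^-1 * _]mulrC.
- exists (a * b); first by rewrite unitrM ua.
  by right; rewrite invrM // [b^-1 * _]mulrC.
- exists (a * b^-1); first by rewrite unitrM ua unitrV.
  by left; rewrite invrM ?unitrV // invrK mulrC [b * _]mulrC.
Qed.

Definition T2_group : groupType := gsub T2_closed.
Definition B2_group : groupType := gsub B2_closed.
Definition SM2_group : groupType := gsub SM2_closed.

Lemma T2_sub_B2 : {subset T2 <= B2}.
Proof. by move=> g; rewrite !unfold_in /T2 is_diag_mx2 => /andP[]. Qed.

Definition elementary : set SL2 := [set g |
  exists x, val g = mx2 1 x 0 1 \/ val g = mx2 1 0 x 1].

Definition GE2_ring := gspan elementary = setT.

Definition mu2 : set A := [set a | a \is a GRing.unit /\ a ^+ 2 = 1].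

End Matrices.

Arguments mu2 A : clear implicits.

Section Lines.
Variable A : comUnitRingType.
Implicit Types (u v : 'cV[A]_2) (g h : SL2 A).

Definition unimodular u := exists2 M : 'M[A]_2, M \in unitmx & u = col 0 M.

Definition span1 u : set 'cV[A]_2 := [set v | exists a : A, v = a *: u].

Definition is_line (L : set 'cV[A]_2) := exists2 u, unimodular u & L = span1 u.

Definition line := {L : set 'cV[A]_2 | `[< is_line L >]}.

HB.instance Definition _ := SubChoice.on line.

Definition transverse (K L : line) := exists u v,
  [/\ unimodular u, unimodular v, val K = span1 u, val L = span1 v &
      (row_mx u v : 'M[A]_2) \in unitmx].

Lemma unimodular_mul (M : 'M[A]_2) u :
  M \in unitmx -> unimodular u -> unimodular (M *m u).
Proof.
move=> uM [N uN ->]; exists (M *m N); first by rewrite unitmx_mul uM.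
by rewrite !colE mulmxA.
Qed.

Lemma image_span1 (M : 'M[A]_2) u : mulmx M @` span1 u = span1 (M *m u).
Proof.
apply/seteqP; split=> [_ [_ [a ->] <-]|_ [a ->]].
  by exists a; rewrite scalemxAr.
by exists (a *: u); [exists a | rewrite scalemxAr].
Qed.

Fact line_act_subproof g (L : line) : `[< is_line (mulmx (val g) @` val L) >].
Proof.
case: L => L /= /asboolP[u uu ->]; apply/asboolP; exists (val g *m u).
  by apply: unimodular_mul => //; exact: SL2_unitmx.
exact: image_span1.
Qed.

Definition line_act g (L : line) : line :=
  exist (fun L => `[< is_line L >]) (mulmx (val g) @` val L) (line_act_subproof g L).

Lemma line_act1 L : line_act 1%g L = L.
Proof.
apply: val_inj => /=; rewrite -[RHS]image_id; congr (_ @` _).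
by apply/funext => v; exact: mul1mx.
Qed.

Lemma line_actM g h L : line_act (g * h)%g L = line_act g (line_act h L).
Proof.
apply: val_inj => /=; rewrite image_comp; congr (_ @` _).
by apply/funext => v; rewrite /= mulmxA.
Qed.

Lemma transverse_act g K L : transverse K L -> transverse (line_act g K) (line_act g L).
Proof.
move=> [u [v [uu uv Ku Lv uvM]]]; exists (val g *m u), (val g *m v).
split; rewrite /= ?Ku ?Lv ?image_span1 //; try exact/unimodular_mul/uu/SL2_unitmx.
  exact/unimodular_mul/uv/SL2_unitmx.
by rewrite -mul_mx_row unitmx_mul SL2_unitmx.
Qed.

Section Degree.
Variable n : nat.

Definition generic (t : n.+1.-tuple line) :=
  `[< forall i j, i != j -> transverse (tnth t i) (tnth t j) >].

Definition frame := {t : n.+1.-tuple line | generic t}.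

HB.instance Definition _ := SubChoice.on frame.

Fact frame_act_subproof g (t : frame) : generic [tuple of map (line_act g) (val t)].
Proof.
apply/asboolP => i j ij; rewrite !tnth_map.
by apply: transverse_act; move: (valP t) => /asboolP; apply.
Qed.

Definition frame_act g (t : frame) : frame :=
  exist generic [tuple of map (line_act g) (val t)] (frame_act_subproof g t).

Lemma frame_act1 t : frame_act 1%g t = t.
Proof. by apply/val_inj/eq_from_tnth => i; rewrite tnth_map line_act1. Qed.

Lemma frame_actM g h t : frame_act (g * h)%g t = frame_act g (frame_act h t).
Proof. by apply/val_inj/eq_from_tnth => i; rewrite !tnth_map line_actM. Qed.

(* Only the restriction to SL_2(A) of the action of GL_2(A) is used. *)
Definition X : gmodule (SL2 A) := free_module frame_act1 frame_actM.
End Degree.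

Fact frame_face_subproof n (i : 'I_n.+2) (t : frame n.+1) : generic (face i (val t)).
Proof.
apply/asboolP => j k jk; rewrite !tnth_mktuple.
move: (valP t) => /asboolP; apply; apply: contra jk => /eqP.
by move/lift_inj => ->.
Qed.

Definition frame_face n (i : 'I_n.+2) (t : frame n.+1) : frame n :=
  exist (@generic n) (face i (val t)) (frame_face_subproof i t).

(* X_d n is the differential of degree n+1, so that Z_1(A^2) is the kernel of X_d 0. *)
Definition X_d n : {additive X n.+1 -> X n} := alt_sum (@frame_face n).

Lemma X_d_act n g x : X_d n (gact g x) = gact g (X_d n x).
Proof.
apply: alt_sum_map => i t; apply/val_inj/eq_from_tnth => j.
by rewrite !(tnth_map, tnth_mktuple).
Qed.

Lemma X_ker_act n g x : x \in zker (X_d n) -> gact g x \in zker (X_d n).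
Proof.
rewrite !unfold_in /zker => /eqP dx.
by rewrite X_d_act dx raddf0.
Qed.

Definition Z1 : gmodule (SL2 A) := submodule (@X_ker_act 0).

Definition e1 : 'cV[A]_2 := delta_mx 0 0.
Definition e2 : 'cV[A]_2 := delta_mx 1 0.

Lemma row_mx2 u v : (row_mx u v : 'M[A]_2) = mx2 (u 0 0) (v 0 0) (u 1 0) (v 1 0).
Proof.
have rowl i : (row_mx u v : 'M[A]_2) i 0 = u i 0.
  by rewrite -(row_mxEl u v); congr (row_mx u v i _); apply: val_inj.
have rowr i : (row_mx u v : 'M[A]_2) i 1 = v i 0.
  by rewrite -(row_mxEr u v); congr (row_mx u v i _); apply: val_inj.
by rewrite [LHS]mx2P !rowl !rowr.
Qed.

Lemma unit_e12 : (row_mx e1 e2 : 'M[A]_2) \in unitmx.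
Proof. by rewrite row_mx2 !mxE mx2_1 unitmx1. Qed.

Lemma unit_e21 : (row_mx e2 e1 : 'M[A]_2) \in unitmx.
Proof. by rewrite row_mx2 !mxE unitmxE det_mx2 mul0r mulr1 sub0r unitrN1. Qed.

Lemma unimodular_row u v : (row_mx u v : 'M[A]_2) \in unitmx -> unimodular u.
Proof.
move=> uvM; exists (row_mx u v) => //; apply/matrixP => i j.
by rewrite mxE (ord1 j) -(row_mxEl u v); congr (row_mx u v i _); apply: val_inj.
Qed.

Lemma unimodular_e1 : unimodular e1. Proof. exact: unimodular_row unit_e12. Qed.
Lemma unimodular_e2 : unimodular e2. Proof. exact: unimodular_row unit_e21. Qed.

Fact line_infty_subproof : `[< is_line (span1 e1) >].
Proof. by apply/asboolP; exists e1 => //; exact: unimodular_e1. Qed.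
Definition line_infty : line :=
  exist (fun L => `[< is_line L >]) (span1 e1) line_infty_subproof.

Fact line_zero_subproof : `[< is_line (span1 e2) >].
Proof. by apply/asboolP; exists e2 => //; exact: unimodular_e2. Qed.
Definition line_zero : line :=
  exist (fun L => `[< is_line L >]) (span1 e2) line_zero_subproof.

Fact infty_zero_subproof : @generic 1 [tuple line_infty; line_zero].
Proof.
apply/asboolP => -[[|[|//]] ?] [[|[|//]] ?] //= _; rewrite !(tnth_nth line_zero) /=.
  by exists e1, e2; split=> //; [exact: unimodular_e1|exact: unimodular_e2|exact: unit_e12].
by exists e2, e1; split=> //; [exact: unimodular_e2|exact: unimodular_e1|exact: unit_e21].
Qed.
Definition infty_zero : frame 1 :=
  exist (@generic 1) [tuple line_infty; line_zero] infty_zero_subproof.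

Fact zero_infty_subproof : @generic 1 [tuple line_zero; line_infty].
Proof.
apply/asboolP => -[[|[|//]] ?] [[|[|//]] ?] //= _; rewrite !(tnth_nth line_zero) /=.
  by exists e2, e1; split=> //; [exact: unimodular_e2|exact: unimodular_e1|exact: unit_e21].
by exists e1, e2; split=> //; [exact: unimodular_e1|exact: unimodular_e2|exact: unit_e12].
Qed.
Definition zero_infty : frame 1 :=
  exist (@generic 1) [tuple line_zero; line_infty] zero_infty_subproof.

Fact Y_subproof : << infty_zero >> + << zero_infty >> \in zker (X_d 0).
Proof.
rewrite unfold_in /zker raddfD /X_d /alt_sum !fg_extE.
rewrite !big_ord_recl !big_ord0 !addr0 /= !expr0.
have <- : frame_face ord0 infty_zero = frame_face (fintype.lift ord0 ord0) zero_infty.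
  by apply/val_inj/eq_from_tnth => i; rewrite !tnth_mktuple (ord1 i) !(tnth_nth line_zero).
have <- : frame_face ord0 zero_infty = frame_face (fintype.lift ord0 ord0) infty_zero.
  by apply/val_inj/eq_from_tnth => i; rewrite !tnth_mktuple (ord1 i) !(tnth_nth line_zero).
rewrite /bump /= expr1 -!freegUN.
by rewrite addrA subrK subrr.
Qed.
Definition Y : Z1 := Sub (<< infty_zero >> + << zero_infty >>) Y_subproof.

Lemma span1_unit (a : A) u : a \is a GRing.unit -> span1 (a *: u) = span1 u.
Proof.
move=> ua; apply/seteqP; split=> _ [b ->]; first by exists (b * a); rewrite scalerA.
by exists (b * a^-1); rewrite scalerA divrK.
Qed.

Lemma mx2_e1 (a b c d : A) : mx2 a b c d *m e1 = a *: e1 + c *: e2.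
Proof.
apply/matrixP => i j; rewrite !mxE !big_ord_recl big_ord0 !mxE (ord1 j) /=.
by case: i => -[|[|//]] ?; rewrite /= !(mulr0, mulr1, addr0, add0r).
Qed.

Lemma mx2_e2 (a b c d : A) : mx2 a b c d *m e2 = b *: e1 + d *: e2.
Proof.
apply/matrixP => i j; rewrite !mxE !big_ord_recl big_ord0 !mxE (ord1 j) /=.
by case: i => -[|[|//]] ?; rewrite /= !(mulr0, mulr1, addr0, add0r).
Qed.

Lemma SM2_lines (g : SL2 A) : g \in @SM2 A ->
  line_act g line_infty = line_infty /\ line_act g line_zero = line_zero \/
  line_act g line_infty = line_zero /\ line_act g line_zero = line_infty.
Proof.
move=> /asboolP[a ua [] gE]; [left|right]; split; apply: val_inj;
  rewrite /= gE image_span1 ?mx2_e1 ?mx2_e2 !scale0r ?add0r ?addr0 span1_unit //;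
  by rewrite ?unitrN unitrV.
Qed.

Lemma SM2_Y (g : SL2 A) : g \in @SM2 A -> gact g Y = Y.
Proof.
move=> gS; apply: val_inj; rewrite [LHS]/=.
change (fg_act (@frame_act 1) g (<< infty_zero >> + << zero_infty >>)
        = << infty_zero >> + << zero_infty >>).
rewrite raddfD /fg_act !fg_extE.
have frE (K L : line) (s t : frame 1) : val s = [tuple K; L] :> 2.-tuple line ->
    val t = [tuple line_act g K; line_act g L] :> 2.-tuple line -> frame_act g s = t.
  move=> sE tE; apply: val_inj; rewrite /= tE; apply: val_inj => /=.
  by rewrite sE.
case: (SM2_lines gS) => -[gi gz].
  rewrite (@frE _ _ infty_zero infty_zero erefl) ?gi ?gz //.
  by rewrite (@frE _ _ zero_infty zero_infty erefl) ?gi ?gz.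
rewrite (@frE _ _ infty_zero zero_infty erefl) ?gi ?gz // addrC.
by rewrite (@frE _ _ zero_infty infty_zero erefl) ?gi ?gz.
Qed.
End Lines.

Section Objects.
Variable A : comUnitRingType.

Lemma SM2_spanY (g : SM2_group A) (m : res_module (gsub_val (@SM2_closed A)) (Z1 A)) :
  m \in zspan [set Y A] -> gact g m \in zspan [set Y A].
Proof.
move=> /asboolP mY; apply/asboolP => H H0 HB HY.
have := mY [set z : Z1 A | H (gact (val g) z)]; apply.
- by rewrite /= raddf0.
- by move=> u v Hu Hv; rewrite /= raddfB; exact: HB.
- move=> _ ->; rewrite /= SM2_Y; [exact: HY|exact: (valP g)].
Qed.

Definition Zhat1 : gmodule (SM2_group A) := submodule SM2_spanY.

Lemma Zhat1_trivial g (m : Zhat1) : gact g m = m.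
Proof.
apply: val_inj; rewrite [LHS]/=; have /asboolP := valP m.
move/(_ [set z : Z1 A | gact (val g) z = z]); apply.
- exact: (raddf0 (gact (val g))).
- by move=> u v gu gv; rewrite /mkset (raddfB (gact (val g))) gu gv.
- by move=> _ ->; apply: SM2_Y; exact: (valP g).
Qed.

Definition Yhat : Zhat1 := Sub (Y A) (mem_zspan erefl).

Definition T2_B2 : pair_hom (trivial_module (T2_group A) int)
                            (trivial_module (B2_group A) int) :=
  trivial_pair_hom (gsub_incl (@T2_closed A) (@B2_closed A) (@T2_sub_B2 A)) int.

Definition SM2_SL2 : pair_hom (trivial_module (SM2_group A) int)
                              (trivial_module (SL2 A) int) :=
  trivial_pair_hom (gsub_val (@SM2_closed A)) int.

Definition SM2_SL2_Z1 : pair_hom Zhat1 (Z1 A) :=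
  @PairHom (SM2_group A) (SL2 A) Zhat1 (Z1 A) (gsub_val (@SM2_closed A)) val
    (fun _ _ => erefl).

Definition Z1_X1 : pair_hom (Z1 A) (X A 1) :=
  @PairHom (SL2 A) (SL2 A) (Z1 A) (X A 1) idfun val (fun _ _ => erefl).

Definition GW : zmodType := group_homology 0 (Z1 A).

Definition W : zmodType := @zquot GW [set class0 (Y A)].

Definition E221 : zmodType := zsub (zker (group_homology_map Z1_X1 1)).

(* The multiplicative group of A as a zmodType: its addition is the product of A. *)
Definition units := {a : A | a \is a GRing.unit}.

HB.instance Definition _ := SubChoice.on units.

Fact units_mul_subproof (a b : units) : val a * val b \is a GRing.unit.
Proof. by rewrite unitrM !(valP a, valP b). Qed.
Definition units_mul (a b : units) : units :=
  exist _ (val a * val b) (units_mul_subproof a b).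

Fact units_inv_subproof (a : units) : (val a)^-1 \is a GRing.unit.
Proof. by rewrite unitrV (valP a). Qed.
Definition units_inv (a : units) : units :=
  exist _ ((val a)^-1) (units_inv_subproof a).

Definition units_one : units := exist _ 1 (unitr1 A).

Fact units_mulA : associative units_mul.
Proof. by move=> a b c; apply: val_inj; rewrite /= mulrA. Qed.
Fact units_mulC : commutative units_mul.
Proof. by move=> a b; apply: val_inj; rewrite /= mulrC. Qed.
Fact units_mul1 : left_id units_one units_mul.
Proof. by move=> a; apply: val_inj; rewrite /= mul1r. Qed.
Fact units_mulV : left_inverse units_one units_inv units_mul.
Proof. by move=> a; apply: val_inj; rewrite /= mulVr // (valP a). Qed.

HB.instance Definition _ :=
  GRing.isZmodule.Build units units_mulA units_mulC units_mul1 units_mulV.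

Definition squares : set units := [set a | exists b : units, val a = val b ^+ 2].

Definition sqclasses : zmodType := zquot squares.

Definition sqclass (a : units) : sqclasses := zproj squares a.

Fact diag_det_subproof (a : units) : \det (mx2 (val a) 0 0 (val a)^-1) == 1.
Proof. by rewrite det_mx2 mul0r subr0 mulrV // (valP a). Qed.

Fact diag_SM2_subproof (a : units) :
  (exist _ (mx2 (val a) 0 0 (val a)^-1) (diag_det_subproof a) : SL2 A) \in @SM2 A.
Proof. by apply/asboolP; exists (val a); [exact: (valP a)|left]. Qed.

Definition diag_SM2 (a : units) : SM2_group A :=
  exist _ (exist _ (mx2 (val a) 0 0 (val a)^-1) (diag_det_subproof a))
          (diag_SM2_subproof a).

Definition alpha_class (a : units) : group_homology 1 (Z1 A) :=
  group_homology_map SM2_SL2_Z1 1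
    (hclass (bar1_cycle (Zhat1_trivial (diag_SM2 a) Yhat))).

End Objects.

(* Main.v *)
Require Import Defs.
From mathcomp Require Import all_boot all_order all_algebra.
From mathcomp Require Import boolp classical_sets.
From HB Require Import structures.
From mathcomp Require Import freeg.

Set Implicit Arguments.
Unset Strict Implicit.
Unset Printing Implicit Defensive.

Import GRing.Theory.
Local Open Scope ring_scope.
Local Open Scope classical_set_scope.

(* The sequence 0 -> Z_1 -> X_1 -> X_0 -> Z -> 0 is exact (at X_0 because A is a
   GE_2-ring), and so is its analogue for SM_2 on the two lines infty and 0. By
   Shapiro's lemma the relative homology with coefficients in X_1 vanishes, and
   the hypothesis on T and B makes the one with coefficients in X_0 vanish in
   degrees 1 to 3, so two dimension shifts identify H_(n+2)(SL_2, SM_2; Z) with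
   H_n(SL_2, SM_2; Z_1, Zhat_1) for n = 0, 1.

   For the exact sequence, H_0(SM_2, Zhat_1) = Z embeds in H_0(SL_2, X_1) by
   Y |-> 2, so that H_1(SL_2, Z_1) maps onto the relative group. A class of
   H_1(SL_2, Z_1) goes to some [D] (x) (infty, 0) in H_1(SL_2, X_1) = H_1(T), and
   vanishing in H_1(SL_2, X_0) = H_1(B) forces D^2 = 1, that is D = 1 or D = -1;
   the second value is that of [w] (x) Y for w = (0 1; -1 0). Correcting by [w] (x) Y
   thus moves every class into E^2_{2,1}. An element [g] (x) Y of E^2_{2,1} with g
   antidiagonal can only exist if 2 = 0, and then [w] (x) Y = 0 because Y = z + w z
   for some z in Z_1. *)

(* The unqualified name is taken by [path.cycle]. *)
Local Notation cycle := Defs.cycle.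

(* Simplification would otherwise unfold the additive maps of the definitions
   to lifts of representatives, which no rewrite rule recognizes. *)
Arguments fg_ext : simpl never.
Arguments tens_lift : simpl never.
Arguments zlift : simpl never.
Arguments zproj : simpl never.
Arguments gchain_map : simpl never.
Arguments homology_map : simpl never.

(** * Complexes *)

(** SM_2 acts on the lines infty and 0, and likewise on the pairs (infty, 0) and (0, infty), as on a
    two-point set with stabilizer T. In SL_2 the stabilizer of (infty, 0) is again T, whereas that
    of infty is B; this is why the hypothesis on T and B is felt through X_0 alone. The shifts for n
    use X_0 in degrees n+1 and n+2, and vanishing in degree k is deduced from surjectivity on H_k
    and injectivity on H_(k-1); n = 1 thus reaches H_3, the bound in the hypothesis.

    The obstacle is that relative chains are a cokernel: a short exact sequence of coefficients
    yields one of relative complexes once the chains of the subgroup inject into those of the group.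
    Coordinates on chains ([coord]) give this injectivity, and also the exactness of chains in the
    coefficients. Since a connecting map depends on lifts, isomorphisms are built from additive
    relations, total on both sides and with trivial kernels. *)

Lemma ziso_rel (U V : zmodType) (R : U -> V -> Prop) :
  (forall u v u' v', R u v -> R u' v' -> R (u - u') (v - v')) ->
  (forall u, exists v, R u v) -> (forall v, exists u, R u v) ->
  (forall u, R u 0 -> u = 0) -> (forall v, R 0 v -> v = 0) -> ziso U V.
Proof.
move=> RB Rl Rr Ru Rv; have [f fP] := choice Rl; have [g gP] := choice Rr.
have Rfun u v v' : R u v -> R u v' -> v = v'.
  move=> Ruv Ruv'; apply/eqP; rewrite -subr_eq0; apply/eqP/Rv.
  by rewrite -(subrr u); exact: RB.
have Rinj u u' v : R u v -> R u' v -> u = u'.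
  move=> Ruv Ruv'; apply/eqP; rewrite -subr_eq0; apply/eqP/Ru.
  by rewrite -(subrr v); exact: RB.
have fB : zmod_morphism f by move=> x y; apply: Rfun (fP _) _; exact: RB.
pose F := GRing.isZmodMorphism.Build U V f fB.
pose f' : {additive U -> V} := HB.pack f F.
exists f'; exists g => x /=; first exact: Rinj (gP _) (fP _).
exact: Rfun (fP _) (gP _).
Qed.

Lemma ziso_trans (U V W : zmodType) : ziso U V -> ziso V W -> ziso U W.
Proof. by move=> [f fb] [g gb]; exists (g \o f); exact: bij_comp. Qed.

Lemma ziso_sym (U V : zmodType) : ziso U V -> ziso V U.
Proof.
move=> [f fb]; apply: (@ziso_rel _ _ (fun v u => f u = v)) => //.
- by move=> u v u' v' <- <-; rewrite raddfB.
- by case: fb => g _ gK v; exists (g v).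
- by move=> u; exists (f u).
- by move=> u <-; rewrite raddf0.
- by move=> v fv; apply: (bij_inj fb); rewrite fv raddf0.
Qed.

Definition cohom (C : complex) n (x y : C n) := exists e, cxd C n e = x - y.

Section Cohom.
Variables (C : complex) (n : nat).
Implicit Types x y z : C n.

Lemma cohomxx x : cohom x x. Proof. by exists 0; rewrite subrr raddf0. Qed.

Lemma cohom_sym x y : cohom x y -> cohom y x.
Proof. by move=> [e de]; exists (- e); rewrite raddfN de opprB. Qed.

Lemma cohom_trans y x z : cohom x y -> cohom y z -> cohom x z.
Proof. by move=> [e de] [f df]; exists (e + f); rewrite raddfD de df addrA subrK. Qed.

Lemma cohomB x y x' y' : cohom x y -> cohom x' y' -> cohom (x - x') (y - y').
Proof. by move=> [e de] [f df]; exists (e - f); rewrite raddfB de df !opprD !opprK addrACA. Qed.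

Lemma cohomN x y : cohom x y -> cohom (- x) (- y).
Proof. by move=> [e de]; exists (- e); rewrite raddfN de opprD. Qed.

Lemma cohomD x y x' y' : cohom x y -> cohom x' y' -> cohom (x + x') (y + y').
Proof. by move=> h /cohomN /(cohomB h); rewrite !opprK. Qed.

Lemma hclass_eq x y (cx : x \in @cycle C n) (cy : y \in @cycle C n) :
  hclass cx = hclass cy <-> cohom x y.
Proof.
have -> : (hclass cx = hclass cy) <-> (hclass cx - hclass cy = 0).
  by split=> [->|/eqP]; rewrite ?subrr // subr_eq0 => /eqP.
rewrite /hclass -raddfB; split=> [/eqP|[e de]].
  rewrite zproj_eq0 => /asboolP/(_ (@boundary C n)); apply=> //.
    by exists 0; rewrite !raddf0.
  by move=> u v [e de] [f df]; exists (e - f); rewrite !raddfB de df.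
by apply/eqP; rewrite zproj_eq0; apply: mem_zspan; exists e; rewrite de.
Qed.

Lemma hclass0 (c0 : 0 \in @cycle C n) : hclass c0 = 0.
Proof. by rewrite -[RHS](raddf0 (zproj (@boundary C n))) /hclass; congr (zproj _ _); apply: val_inj. Qed.

Lemma hclass_eq0 x (cx : x \in @cycle C n) : hclass cx = 0 <-> exists e, cxd C n e = x.
Proof.
have c0 : 0 \in @cycle C n by exact: rpred0.
by rewrite -(hclass0 c0) hclass_eq /cohom subr0.
Qed.

Lemma hclassB x y (cx : x \in @cycle C n) (cy : y \in @cycle C n)
  (cxy : x - y \in @cycle C n) : hclass cxy = hclass cx - hclass cy.
Proof. by rewrite /hclass -raddfB; congr (zproj _ _); apply: val_inj. Qed.

Lemma homologyP (h : homology C n) : exists x (cx : x \in @cycle C n), h = hclass cx.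
Proof. by rewrite -[h]zprojK; case: (repr h) => x cx; exists x, cx. Qed.
End Cohom.

Lemma hmapE (C D : complex) (f : cmap C D) n x (cx : x \in @cycle C n)
  (cfx : f n x \in @cycle D n) : homology_map f n (hclass cx) = hclass cfx.
Proof. by rewrite /homology_map zliftE /=; congr (zproj _ _); apply: val_inj. Qed.

Lemma cmap_cohom (C D : complex) (f : cmap C D) n x y :
  cohom x y -> cohom (f n x) (f n y).
Proof. by move=> [e de]; exists (f n.+1 e); rewrite -cmapd de raddfB. Qed.

Lemma cycleS (C : complex) n (x : C n.+1) : (x \in @cycle C n.+1) = (cxd C n x == 0).
Proof. by []. Qed.

Definition homology_inj C D (f : cmap C D) n :=
  forall x, x \in @cycle C n -> cohom (f n x) 0 -> cohom x 0.

Definition homology_surj C D (f : cmap C D) n :=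
  forall y, y \in @cycle D n -> exists2 x, x \in @cycle C n & cohom y (f n x).

Definition acyclic (C : complex) n := forall x, x \in @cycle C n -> cohom x 0.

Lemma hmap_injP C D (f : cmap C D) n :
  injective (homology_map f n) -> homology_inj f n.
Proof.
move=> fI x cx fx; have := @cmap_cycle _ _ f n _ cx => cfx.
have c0 : 0 \in @cycle C n by exact: rpred0.
apply/(hclass_eq cx c0)/fI; rewrite hclass0 raddf0 (hmapE cx cfx).
have d0 : 0 \in @cycle D n by exact: rpred0.
by rewrite -(hclass0 d0) hclass_eq.
Qed.

Lemma hmap_surjP C D (f : cmap C D) n :
  (forall y, exists x, homology_map f n x = y) -> homology_surj f n.
Proof.
move=> fS y cy; have [h] := fS (hclass cy); have [x [cx ->]] := homologyP h.
rewrite (hmapE cx (@cmap_cycle _ _ f n _ cx)) => /hclass_eq fxy.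
by exists x => //; exact: cohom_sym.
Qed.

Section TwoOfThree.
Variables (C D E : complex) (f : cmap C D) (g : cmap D E) (h : cmap C E) (n : nat).
Hypothesis gf : forall x, g n (f n x) = h n x.

(** In the applications [f] and [h] are the comparison maps from the chains of T given by Shapiro's
    lemma, and [g] goes from the chains of SM_2 to those of SL_2. *)
Lemma homology_inj_2of3 :
  homology_surj f n -> homology_inj h n -> homology_inj g n.
Proof.
move=> fS hI y cy gy; have [x cx yx] := fS y cy.
apply: (cohom_trans yx); rewrite -(raddf0 (f n)); apply: cmap_cohom.
apply: hI => //; rewrite -gf; apply: cohom_trans _ gy.
by apply: cmap_cohom; exact: cohom_sym.
Qed.

Lemma homology_surj_2of3 : homology_surj h n -> homology_surj g n.
Proof.
move=> hS z cz; have [x cx zx] := hS z cz.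
by exists (f n x); [exact: cmap_cycle | rewrite gf].
Qed.

Lemma homology_inj_comp : homology_inj f n -> homology_inj g n -> homology_inj h n.
Proof.
by move=> fI gI x cx; rewrite -gf => /(gI _ (@cmap_cycle _ _ f n _ cx)); exact: fI.
Qed.

Lemma homology_surj_comp : homology_surj f n -> homology_surj g n -> homology_surj h n.
Proof.
move=> fS gS z cz; have [y cy zy] := gS z cz; have [x cx yx] := fS y cy.
by exists x => //; rewrite -gf; apply: cohom_trans zy _; exact: cmap_cohom.
Qed.
End TwoOfThree.

Section Cokernel.
Variables (C D : complex) (f : cmap C D).
Local Notation Q := (coker_complex f).
Local Notation pi n := (zproj (range (f n)) : D n -> Q n).

Lemma cokerP n (q : Q n) : exists y : D n, q = pi n y.
Proof. by exists (repr q); rewrite zprojK. Qed.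

Lemma coker_dE n (y : D n.+1) : cxd Q n (pi n.+1 y) = pi n (cxd D n y).
Proof. by rewrite [LHS]zliftE. Qed.

Lemma coker_eq0 n (y : D n) : pi n y = 0 <-> exists x, y = f n x.
Proof.
split=> [/eqP|[x ->]].
  rewrite zproj_eq0 => /asboolP/(_ [set y | exists x, y = f n x]); apply=> /=.
  - by exists 0; rewrite raddf0.
  - by move=> _ _ [x ->] [x' ->]; exists (x - x'); rewrite raddfB.
  - by move=> _ [x _ <-]; exists x.
by apply/eqP; rewrite zproj_eq0; apply: mem_zspan; exists x.
Qed.

Lemma coker_eq n (y y' : D n) : pi n y = pi n y' <-> exists x, y = y' + f n x.
Proof.
have -> : (pi n y = pi n y') <-> (pi n (y - y') = 0).
  rewrite raddfB; split=> [->|/eqP]; first by rewrite subrr.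
  by rewrite subr_eq0 => /eqP.
rewrite coker_eq0; split=> -[x yx]; exists x; first by rewrite -yx addrC subrK.
by rewrite yx addrC addKr.
Qed.

Lemma coker_acyclic0 : homology_surj f 0 -> acyclic Q 0.
Proof.
move=> fS q _; have [y ->] := cokerP q; have [x _ [e de]] := fS y erefl.
exists (pi 1 e); rewrite coker_dE de raddfB subr0 -[RHS]subr0; congr (_ - _).
by apply/coker_eq0; exists x.
Qed.

(** A relative cycle lifts to some [y] with [d y = f x], and [x] is a cycle because [f] is
    injective. Injectivity on homology gives [x = d e]; then [y - f e] is an absolute cycle,
    homologous to a cycle coming from [C] and hence a boundary in the cokernel. *)
Lemma coker_acyclicS n : (forall k, injective (f k)) ->
  homology_inj f n -> homology_surj f n.+1 -> acyclic Q n.+1.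
Proof.
move=> fI hI hS q; have [y ->] := cokerP q; rewrite cycleS coker_dE => /eqP /coker_eq0 [x dy].
have cx : x \in @cycle C n.
  case: n x {hI hS q} y dy => // m x y dy; rewrite cycleS; apply/eqP/fI.
  by rewrite cmapd -dy cxdd raddf0.
have [] := hI x cx; first by exists y; rewrite dy subr0.
move=> e; rewrite subr0 => de.
have [|z cz [a da]] := hS (y - f n.+1 e).
  by rewrite cycleS raddfB dy -cmapd de subrr.
exists (pi n.+2 a); rewrite coker_dE da subr0 -addrA -opprD -raddfD raddfB -[RHS]subr0.
by congr (_ - _); apply/coker_eq0; eexists.
Qed.
End Cokernel.

Section ConnectingMap.
Variables (A B C : complex) (i : cmap A B) (p : cmap B C).
Hypotheses (iI : forall n, injective (i n)) (pS : forall n c, exists b, p n b = c)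
  (pi0 : forall n a, p n (i n a) = 0)
  (ker_p : forall n b, p n b = 0 -> exists a, b = i n a).

(** The relation is the zigzag [p b <- b -> d b = i a] of the snake lemma. Acyclicity of [B] in
    degree [n] provides a [b] for every [a], and in degree [n.+1] it makes the kernel trivial. *)
Lemma connecting_ziso n : acyclic B n.+1 -> acyclic B n ->
  ziso (homology C n.+1) (homology A n).
Proof.
move=> Bn1 Bn; apply: (@ziso_rel _ _ (fun x y => exists b (hb : p n.+1 b \in @cycle C n.+1)
  a (ha : a \in @cycle A n), [/\ x = hclass hb, y = hclass ha & cxd B n b = i n a])).
- move=> _ _ _ _ [b [hb [a [ha [-> -> dE]]]]] [b' [hb' [a' [ha' [-> -> dE']]]]].
  have hbb : p n.+1 (b - b') \in @cycle C n.+1 by rewrite raddfB rpredB.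
  have haa : a - a' \in @cycle A n by rewrite rpredB.
  exists (b - b'), hbb, (a - a'), haa; split; last by rewrite !raddfB dE dE'.
    rewrite -hclassB; first by rewrite -raddfB.
    by move=> ?; apply/hclass_eq; rewrite raddfB; exact: cohomxx.
  by rewrite -hclassB.
- move=> x; have [c [hc xE]] := homologyP x; have [b bc] := pS c; subst c; rewrite {}xE.
  have [|a da] := @ker_p n (cxd B n b).
    by apply/eqP; move: hc; rewrite cycleS cmapd.
  have ha : a \in @cycle A n.
    case: n {Bn1 Bn x} b a hc da => // m b a hc da; rewrite cycleS; apply/eqP/iI.
    by rewrite cmapd -da cxdd raddf0.
  by exists (hclass ha), b, hc, a, ha.
- move=> y; have [a [ha ->]] := homologyP y.
  have [b] := Bn _ (@cmap_cycle _ _ i n _ ha); rewrite subr0 => db.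
  have hb : p n.+1 b \in @cycle C n.+1 by rewrite cycleS -cmapd db pi0.
  by exists (hclass hb), b, hb, a, ha.
- move=> x [b [hb [a [ha [-> /esym/hclass_eq0 [a' da'] db]]]]].
  apply/hclass_eq0; have [|b' db'] := Bn1 (b - i n.+1 a').
    by rewrite cycleS raddfB db -cmapd da' subrr.
  by exists (p n.+2 b'); rewrite -cmapd db' subr0 raddfB pi0 subr0.
- move=> y [b [hb [a [ha [/esym/hclass_eq0 [c dc] -> db]]]]].
  apply/hclass_eq0; have [b' bc] := pS c; have [|a' aE] := @ker_p n.+1 (b - cxd B n.+1 b').
    by rewrite raddfB cmapd bc dc subrr.
  by exists a'; apply: iI; rewrite cmapd -aE raddfB cxdd subr0.
Qed.
End ConnectingMap.

(** * Chains of a group with coefficients *)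

Lemma zmod_closed_sum (V : zmodType) (P : V -> Prop) (I : Type) (r : seq I) (F : I -> V) :
  P 0 -> (forall x y, P x -> P y -> P (x - y)) -> (forall i, P (F i)) ->
  P (\sum_(i <- r) F i).
Proof.
move=> P0 PB PF; apply: big_ind => // x y Px Py; rewrite -[y]opprK; apply: (PB) => //.
by rewrite -sub0r; apply: PB.
Qed.

Lemma zmod_closed_mulz (V : zmodType) (P : V -> Prop) (x : V) (k : int) :
  P 0 -> (forall x y, P x -> P y -> P (x - y)) -> P x -> P (x *~ k).
Proof.
move=> P0 PB Px; have PN y : P y -> P (- y) by rewrite -sub0r; exact: PB.
have Pn n : P (x *+ n).
  elim: n => [|n IH]; first by rewrite mulr0n.
  by rewrite mulrS -[x *+ n]opprK; apply: PB => //; exact: PN.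
by case: k => n; [exact: Pn | rewrite NegzE mulrNz; apply/PN/Pn].
Qed.

Lemma freeg_ind (K : choiceType) (P : {freeg K} -> Prop) :
  P 0 -> (forall x y, P x -> P y -> P (x - y)) -> (forall k, P << k >>) ->
  forall x, P x.
Proof.
move=> P0 PB PU x; rewrite -(freeg_sumE x); apply: zmod_closed_sum => // k.
have -> : << coeff k x *g k >> = << k >> *~ coeff k x :> {freeg K}.
  by rewrite freegU_mulz intz.
exact: zmod_closed_mulz.
Qed.

Section TensorTheory.
Variables (G : groupType) (C M : gmodule G).

Fact tensl_zmod_morphism (m : M) : zmod_morphism (fun c : C => tens c m).
Proof. by move=> x y; apply/eqP; rewrite eq_sym subr_eq -tensDl subrK. Qed.
Definition tensl m : {additive C -> tensor C M} :=
  HB.pack (fun c : C => tens c m)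
    (GRing.isZmodMorphism.Build C (tensor C M) _ (tensl_zmod_morphism m)).

Fact tensr_zmod_morphism (c : C) : zmod_morphism (fun m : M => tens c m).
Proof. by move=> x y; apply/eqP; rewrite eq_sym subr_eq -tensDr subrK. Qed.
Definition tensr c : {additive M -> tensor C M} :=
  HB.pack (fun m : M => tens c m)
    (GRing.isZmodMorphism.Build M (tensor C M) _ (tensr_zmod_morphism c)).

Lemma tensBl (c c' : C) (m : M) : tens (c - c') m = tens c m - tens c' m.
Proof. exact: (raddfB (tensl m)). Qed.

Lemma tens0l (m : M) : tens (0 : C) m = 0.
Proof. exact: (raddf0 (tensl m)). Qed.
Lemma tensBr (c : C) (m m' : M) : tens c (m - m') = tens c m - tens c m'.
Proof. exact: (raddfB (tensr c)). Qed.
Lemma tens0r (c : C) : tens c (0 : M) = 0.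
Proof. exact: (raddf0 (tensr c)). Qed.
Lemma tensMzr (c : C) (m : M) k : tens c (m *~ k) = tens c m *~ k.
Proof. exact: (raddfMz (tensr c)). Qed.

Lemma tensor_ind (P : tensor C M -> Prop) :
  (forall x y, P x -> P y -> P (x - y)) -> (forall c m, P (tens c m)) -> forall x, P x.
Proof.
move=> PB PT x; rewrite -[x]zprojK; move: (repr x) => {}x.
have P0 : P 0 by rewrite -(subrr (tens 0 0)); exact: PB.
elim/freeg_ind: x => [|x y Px Py|[c m]]; rewrite ?raddf0 ?raddfB //; first exact: PB.
exact: PT.
Qed.
End TensorTheory.

Section ChainTheory.
Variables (G : groupType) (M : gmodule G) (n : nat).

Definition btens (t : n.+1.-tuple G) (m : M) : gchain M n :=
  tens (<< t >> : std_res G n) m.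

Lemma btensG g t m : btens (diag_act g t) (gact g m) = btens t m.
Proof. by rewrite /btens -[RHS](tensG g) /= /fg_act fg_extE. Qed.

Lemma btensMz t m k : btens t (m *~ k) = btens t m *~ k.
Proof. exact: tensMzr. Qed.

Lemma gchain_ind (P : gchain M n -> Prop) :
  (forall x y, P x -> P y -> P (x - y)) -> (forall t m, P (btens t m)) -> forall x, P x.
Proof.
move=> PB PT; apply: tensor_ind => // c m.
have P0 : P 0 by rewrite -(subrr (btens [tuple of nseq n.+1 1%g] 0)); exact: PB.
elim/freeg_ind: c => [|x y Px Py|t]; rewrite ?tens0l ?tensBl //; first exact: PB.
exact: PT.
Qed.

Section Lift.
Variables (V : zmodType) (b : n.+1.-tuple G -> M -> V).
Hypotheses (bD : forall t, {morph b t : m m' / m + m'})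
           (bG : forall g t m, b (diag_act g t) (gact g m) = b t m).

Let bc (c : std_res G n) (m : M) : V := fg_ext (b^~ m) c.

Fact gchain_lift_Dl c c' m : bc (c + c') m = bc c m + bc c' m.
Proof. by rewrite /bc raddfD. Qed.

Fact gchain_lift_Dr c m m' : bc c (m + m') = bc c m + bc c m'.
Proof.
rewrite /bc; elim/freeg_ind: c => [|x y xE yE|t]; first by rewrite !raddf0 addr0.
  by rewrite !raddfB xE yE opprD addrACA.
by rewrite !fg_extE bD.
Qed.

Fact gchain_lift_G g c m : bc (gact g c) (gact g m) = bc c m.
Proof.
rewrite /bc; elim/freeg_ind: c => [|x y xE yE|t]; first by rewrite !raddf0.
  by rewrite !raddfB xE yE.
by rewrite /= /fg_act !fg_extE bG.
Qed.

Definition gchain_lift : {additive gchain M n -> V} :=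
  tens_lift gchain_lift_Dl gchain_lift_Dr gchain_lift_G.

Lemma gchain_liftE t m : gchain_lift (btens t m) = b t m.
Proof. by rewrite [LHS]tens_liftE /bc fg_extE. Qed.
End Lift.

Definition norm_tuple (t : n.+1.-tuple G) := diag_act (thead t)^-1%g t.

Lemma thead_diag g (t : n.+1.-tuple G) : thead (diag_act g t) = (g * thead t)%g.
Proof. by rewrite /thead tnth_map. Qed.

Lemma norm_diag g t : norm_tuple (diag_act g t) = norm_tuple t.
Proof. by rewrite /norm_tuple thead_diag -diag_actM invgM -mulgA mulVg mulg1. Qed.

Lemma btens_norm t m : btens (norm_tuple t) (gact (thead t)^-1%g m) = btens t m.
Proof. exact: btensG. Qed.

(* The tuples with head 1 represent the G-orbits, so that C_n(G) (x)_G M is a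
   direct sum of copies of M indexed by them; [coord s] is the projection. *)
Section Coord.
Variable s : n.+1.-tuple G.
Let b (t : n.+1.-tuple G) (m : M) : M :=
  if norm_tuple t == s then gact (thead t)^-1%g m else 0.
Fact coord_D t : {morph b t : m m' / m + m'}.
Proof. by move=> m m'; rewrite /b; case: ifP; rewrite ?addr0 // raddfD. Qed.
Fact coord_G g t m : b (diag_act g t) (gact g m) = b t m.
Proof. by rewrite /b norm_diag thead_diag invgM -!gactM -mulgA mulVg mulg1. Qed.
Definition coord : {additive gchain M n -> M} := gchain_lift coord_D coord_G.
Arguments coord : simpl never.
Lemma coordE t m :
  coord (btens t m) = if norm_tuple t == s then gact (thead t)^-1%g m else 0.
Proof. exact: gchain_liftE. Qed.
End Coord.

Arguments coord : simpl never.

Lemma coord_sum x : exists s : seq (n.+1.-tuple G),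
  x = \sum_(t <- s) btens t (coord t x).
Proof.
(* The claim is strengthened to all duplicate-free lists containing [r], so that in the inductive
   step a single list serves both chains of a difference. *)
have [r rP] : exists r : seq (n.+1.-tuple G), forall s, uniq s -> {subset r <= s} ->
    x = \sum_(t <- s) btens t (coord t x).
  elim/gchain_ind: x => [x y [r rP] [r' rP']|t m].
    exists (r ++ r') => s us rs.
    rewrite [in LHS](rP s) // => [|i ir]; last by apply: rs; rewrite mem_cat ir.
    rewrite [in X in _ - X](rP' s) // => [|i ir]; last by apply: rs; rewrite mem_cat ir orbT.
    by rewrite -sumrB; apply: eq_bigr => i _; rewrite raddfB [RHS]tensBr.
  exists [:: norm_tuple t] => s us ts; have {}ts := ts _ (mem_head _ _).
  under eq_bigr do rewrite coordE.
  rewrite (bigD1_seq (norm_tuple t)) //= eqxx btens_norm big1 ?addr0 // => i ti.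
  by rewrite eq_sym (negPf ti) /btens tens0r.
by exists (undup r); apply: rP (undup_uniq _) _ => i; rewrite mem_undup.
Qed.
End ChainTheory.

Arguments coord {G M n} s : simpl never.
Arguments gchain_lift : simpl never.

Lemma gchain_dE (G : groupType) (M : gmodule G) n (c : std_res G n.+1) (m : M) :
  cxd (gchain M) n (tens c m) = tens (std_d G n c) m.
Proof. exact: tens_liftE. Qed.

Section GroupMorphism.
Variables (G' G : groupType) (f : {multiplicative G' -> G}).

Lemma multiplicative1 : f 1%g = 1%g.
Proof. by apply: (@mulgI _ (f 1%g)); rewrite -gmulfM !mulg1. Qed.

Lemma multiplicativeV x : f x^-1%g = (f x)^-1%g.
Proof. by apply: (@mulgI _ (f x)); rewrite -gmulfM !mulgV multiplicative1. Qed.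
End GroupMorphism.

Section ChainMaps.
Variables (G' G : groupType) (M' : gmodule G') (M : gmodule G) (f : pair_hom M' M).

Lemma gchain_mapE n (c : std_res G' n) m :
  gchain_map f n (tens c m) = tens (std_map f n c) (pmod f m).
Proof. exact: tens_liftE. Qed.

Lemma gchain_map_btens n (t : n.+1.-tuple G') m :
  gchain_map f n (btens t m) = btens [tuple of map (pgrp f) t] (pmod f m).
Proof. by rewrite [LHS]gchain_mapE /std_map /fg_map fg_extE. Qed.

Hypothesis (fG : injective (pgrp f)) (fM : injective (pmod f)).

Lemma map_tuple_inj n (T U : eqType) (g : T -> U) : injective g ->
  injective (fun t : n.-tuple T => [tuple of map g t]).
Proof. by move=> gI t u /(congr1 val) /= /(inj_map gI) /val_inj. Qed.

(** Normalization commutes with group morphisms, and an injective one keeps distinct normalized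
    tuples distinct, so no two coordinates are merged. *)
Lemma coord_map n (s : n.+1.-tuple G') (x : gchain M' n) :
  coord [tuple of map (pgrp f) s] (gchain_map f n x) = pmod f (coord s x).
Proof.
elim/gchain_ind: x => [x y xE yE|t m]; first by rewrite !raddfB xE yE.
rewrite gchain_map_btens !coordE.
have -> : norm_tuple [tuple of map (pgrp f) t] = [tuple of map (pgrp f) (norm_tuple t)].
  by apply: eq_from_tnth => i; rewrite !tnth_map gmulfM multiplicativeV /thead tnth_map.
rewrite (inj_eq (map_tuple_inj fG)); case: eqP => _; last by rewrite raddf0.
by rewrite pmodE /thead tnth_map multiplicativeV.
Qed.

(** By [coord_sum] a chain with zero coordinates is zero, and [coord_map] reads the coordinates of a
    chain from those of its image. *)
Lemma gchain_map_inj n : injective (gchain_map f n).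
Proof.
move=> x y /eqP; rewrite -subr_eq0 -raddfB => /eqP fxy.
apply/eqP; rewrite -subr_eq0; apply/eqP; move: (x - y) fxy => {x y} x fx.
have [s ->] := coord_sum x; rewrite big1 // => t _.
have -> : coord t x = 0; last by rewrite /btens tens0r.
by apply: fM; rewrite -coord_map fx !raddf0.
Qed.
End ChainMaps.

Section CoefficientSequence.
Variables (G : groupType) (M M' M'' : gmodule G) (i : {additive M' -> M}) (p : {additive M -> M''}).
Hypotheses (iG : forall g m, i (gact g m) = gact g (i m))
  (pG : forall g m, p (gact g m) = gact g (p m)).

Definition coef_hom (N N' : gmodule G) (f : {additive N -> N'})
  (fG : forall g m, f (gact g m) = gact g (f m)) : pair_hom N N' :=
  @PairHom G G N N' idfun f fG.

Lemma coef_hom_btens (N N' : gmodule G) (f : {additive N -> N'}) fG n (t : n.+1.-tuple G) m :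
  gchain_map (@coef_hom N N' f fG) n (btens t m) = btens t (f m).
Proof.
rewrite gchain_map_btens; congr btens.
by apply: eq_from_tnth => j; rewrite tnth_map.
Qed.

Lemma gchain_coef_surj n : (forall m'', exists m, p m = m'') ->
  forall z, exists y, gchain_map (coef_hom pG) n y = z.
Proof.
move=> pS z; elim/gchain_ind: z => [x y [x' <-] [y' <-]|t m].
  by exists (x' - y'); rewrite raddfB.
by have [m' <-] := pS m; exists (btens t m'); rewrite coef_hom_btens.
Qed.

(** Exactness is checked one coordinate at a time: each coordinate of [y] is killed by [p], hence
    lifts along [i]. *)
Lemma gchain_coef_ker n : (forall m, p m = 0 -> exists m', m = i m') ->
  forall y, gchain_map (coef_hom pG) n y = 0 ->
  exists x, y = gchain_map (coef_hom iG) n x.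
Proof.
move=> ker_p y py; have [s ->] := coord_sum y; elim: s => [|t s [x IH]].
  by exists 0; rewrite big_nil raddf0.
rewrite big_cons IH; have [|m' ->] := ker_p (coord t y).
  have E := @coord_map _ _ _ _ (coef_hom pG) (fun _ _ => id) n t y.
  by rewrite -[LHS]E py raddf0.
by exists (btens t m' + x); rewrite raddfD coef_hom_btens.
Qed.

Lemma gchain_coef_zero n : (forall m', p (i m') = 0) ->
  forall x, gchain_map (coef_hom pG) n (gchain_map (coef_hom iG) n x) = 0.
Proof.
move=> pi0 x; elim/gchain_ind: x => [x y xE yE|t m]; first by rewrite !raddfB xE yE subrr.
by rewrite !coef_hom_btens pi0 /btens tens0r.
Qed.
End CoefficientSequence.

(** * Relative chains *)

Section CokerMap.
Variables (A' A B' B : complex) (a : cmap A' A) (b : cmap B' B).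
Variables (i' : cmap A' B') (i : cmap A B).
Hypothesis sq : forall n x, b n (i' n x) = i n (a n x).

Fact coker_map_subproof n x :
  range (a n) x -> (zproj (range (b n)) \o i n) x = 0.
Proof. by case=> y _ <-; apply/coker_eq0; exists (i' n y); rewrite sq. Qed.

Definition coker_map_fun n : {additive coker_complex a n -> coker_complex b n} :=
  zlift (@coker_map_subproof n).

Lemma coker_map_funE n x :
  coker_map_fun n (zproj (range (a n)) x) = zproj (range (b n)) (i n x).
Proof. exact: zliftE. Qed.

Fact coker_map_d n x : coker_map_fun n (cxd (coker_complex a) n x) =
  cxd (coker_complex b) n (coker_map_fun n.+1 x).
Proof.
by have [y ->] := cokerP x; rewrite coker_map_funE !coker_dE coker_map_funE cmapd.
Qed.

Definition coker_map : cmap (coker_complex a) (coker_complex b) := CMap coker_map_d.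

Lemma coker_mapE n x :
  coker_map n (zproj (range (a n)) x) = zproj (range (b n)) (i n x).
Proof. exact: zliftE. Qed.
End CokerMap.

Section CokerSequence.
Variables (A' A B' B C' C : complex) (a : cmap A' A) (b : cmap B' B) (c : cmap C' C).
Variables (i' : cmap A' B') (i : cmap A B) (p' : cmap B' C') (p : cmap B C).
Hypotheses (bi : forall n x, b n (i' n x) = i n (a n x))
  (cp : forall n x, c n (p' n x) = p n (b n x)).
Hypotheses (cI : forall n, injective (c n)).
Hypotheses (iI : forall n, injective (i n)) (pS : forall n z, exists y, p n y = z)
  (pi0 : forall n x, p n (i n x) = 0)
  (ker_p : forall n y, p n y = 0 -> exists x, y = i n x).
Hypotheses (p'S : forall n z, exists y, p' n y = z)
  (ker_p' : forall n y, p' n y = 0 -> exists x, y = i' n x).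

(** The cokernels form a short exact sequence by a diagram chase. For injectivity on the left, if
    [i z = b y] then [c (p' y) = p (i z) = 0], so [p' y = 0] because [c] is injective; thus [y]
    comes from [A'], and so does [z]. *)
Lemma coker_connecting_ziso n :
  acyclic (coker_complex b) n.+1 -> acyclic (coker_complex b) n ->
  ziso (homology (coker_complex c) n.+1) (homology (coker_complex a) n).
Proof.
apply: (@connecting_ziso _ _ _ (coker_map bi) (coker_map cp)) => {}n.
- suff iI0 x : coker_map bi n x = 0 -> x = 0.
    by move=> x y xy; apply/eqP; rewrite -subr_eq0; apply/eqP/iI0; rewrite raddfB xy subrr.
  have [z ->] := cokerP x; rewrite coker_mapE => /coker_eq0 [y iz].
  have [|x' yE] := @ker_p' n y; first by apply: cI; rewrite cp -iz pi0 raddf0.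
  by apply/coker_eq0; exists x'; apply: iI; rewrite iz yE bi.
- move=> z; have [y ->] := cokerP z; have [x <-] := pS y.
  by exists (zproj (range (b n)) x); rewrite coker_mapE.
- by move=> x; have [y ->] := cokerP x; rewrite !coker_mapE pi0 raddf0.
- move=> y; have [x ->] := cokerP y; rewrite coker_mapE => /coker_eq0 [z pz].
  have [y' yz] := p'S z; have [|t tE] := @ker_p n (x - b n y').
    by rewrite raddfB pz -yz cp subrr.
  exists (zproj (range (a n)) t); rewrite coker_mapE -tE.
  by apply/coker_eq; exists y'; rewrite subrK.
Qed.
End CokerSequence.

Lemma gchain_map_square (G1 G2 G3 G4 : groupType) (M1 : gmodule G1) (M2 : gmodule G2)
  (M3 : gmodule G3) (M4 : gmodule G4) (f : pair_hom M1 M2) (g : pair_hom M2 M4)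
  (f' : pair_hom M1 M3) (g' : pair_hom M3 M4) :
  (forall x, pgrp g (pgrp f x) = pgrp g' (pgrp f' x)) ->
  (forall x, pmod g (pmod f x) = pmod g' (pmod f' x)) ->
  forall n x, gchain_map g n (gchain_map f n x) = gchain_map g' n (gchain_map f' n x).
Proof.
move=> EG EM n x; elim/gchain_ind: x => [x y xE yE|t m]; first by rewrite !raddfB xE yE.
rewrite !gchain_map_btens EM; congr btens.
by apply: eq_from_tnth => j; rewrite !tnth_map EG.
Qed.

Lemma gchain_map_comp (G1 G2 G3 : groupType) (M1 : gmodule G1) (M2 : gmodule G2)
  (M3 : gmodule G3) (f : pair_hom M1 M2) (g : pair_hom M2 M3) (h : pair_hom M1 M3) :
  (forall x, pgrp g (pgrp f x) = pgrp h x) ->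
  (forall x, pmod g (pmod f x) = pmod h x) ->
  forall n x, gchain_map g n (gchain_map f n x) = gchain_map h n x.
Proof.
move=> EG EM n x; elim/gchain_ind: x => [x y xE yE|t m]; first by rewrite !raddfB xE yE.
rewrite !gchain_map_btens EM; congr btens.
by apply: eq_from_tnth => j; rewrite !tnth_map EG.
Qed.

Section RelativeSequence.
Variables (G' G : groupType) (h : {multiplicative G' -> G}).
Variables (A' B' C' : gmodule G') (A B C : gmodule G).
Variables (a : {additive A' -> A}) (b : {additive B' -> B}) (c : {additive C' -> C}).
Hypotheses (aE : forall g m, a (gact g m) = gact (h g) (a m))
  (bE : forall g m, b (gact g m) = gact (h g) (b m))
  (cE : forall g m, c (gact g m) = gact (h g) (c m)).
Variables (i' : {additive A' -> B'}) (p' : {additive B' -> C'}).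
Variables (i : {additive A -> B}) (p : {additive B -> C}).
Hypotheses (i'E : forall g m, i' (gact g m) = gact g (i' m))
  (p'E : forall g m, p' (gact g m) = gact g (p' m))
  (iE : forall g m, i (gact g m) = gact g (i m))
  (pE : forall g m, p (gact g m) = gact g (p m)).
Hypotheses (bi : forall m, b (i' m) = i (a m)) (cp : forall m, c (p' m) = p (b m)).
Hypotheses (hI : injective h) (cI : injective c).
Hypotheses (iI : injective i) (pS : forall z, exists y, p y = z)
  (pi0 : forall x, p (i x) = 0) (ker_p : forall y, p y = 0 -> exists x, y = i x).
Hypotheses (p'S : forall z, exists y, p' y = z)
  (ker_p' : forall y, p' y = 0 -> exists x, y = i' x).

Lemma relative_connecting_ziso n :
  acyclic (coker_complex (gchain_map (PairHom bE))) n.+1 ->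
  acyclic (coker_complex (gchain_map (PairHom bE))) n ->
  ziso (relative_homology (PairHom cE) n.+1) (relative_homology (PairHom aE) n).
Proof.
apply: (@coker_connecting_ziso _ _ _ _ _ _ _ _ _ (gchain_map (coef_hom i'E))
  (gchain_map (coef_hom iE)) (gchain_map (coef_hom p'E)) (gchain_map (coef_hom pE))).
- exact: gchain_map_square.
- exact: gchain_map_square.
- by move=> k; exact: gchain_map_inj.
- by move=> k; apply: gchain_map_inj => //= x y.
- by move=> k; exact: gchain_coef_surj.
- by move=> k; exact: gchain_coef_zero.
- by move=> k; exact: gchain_coef_ker.
- by move=> k; exact: gchain_coef_surj.
- by move=> k; exact: gchain_coef_ker.
Qed.
End RelativeSequence.

(** * Shapiro's lemma *)

Lemma freegUE (K : choiceType) (c : int) (k : K) : << c *g k >> = << k >> *~ c :> {freeg K}.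
Proof. by rewrite freegU_mulz intz. Qed.

Lemma fg_mapE (K K' : choiceType) (h : K -> K') k : fg_map h << k >> = << h k >>.
Proof. exact: fg_extE. Qed.

(** * Cone and prism operators on the standard resolution *)

Section Prism.
Variable G : groupType.
Implicit Types (phi : G -> G) (g : G).

Definition cone g n : {additive std_res G n -> std_res G n.+1} :=
  fg_map (fun t : n.+1.-tuple G => [tuple of g :: t]).

Lemma coneE g n t : cone g n << t >> = << [tuple of g :: t] >>.
Proof. exact: fg_extE. Qed.

Lemma face_cons0 n g (t : n.+1.-tuple G) : face ord0 [tuple of g :: t] = t.
Proof. by apply: eq_from_tnth => j; rewrite tnth_mktuple tnthS. Qed.

Lemma face_consS n g (i : 'I_n.+2) (t : n.+2.-tuple G) :
  face (fintype.lift ord0 i) [tuple of g :: t] = [tuple of g :: face i t].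
Proof.
apply: eq_from_tnth => j; rewrite tnth_mktuple.
case: (unliftP ord0 j) => [k|] ->.
  have -> : fintype.lift (fintype.lift ord0 i) (fintype.lift ord0 k) =
            fintype.lift ord0 (fintype.lift i k).
    by apply: val_inj; rewrite /= /bump /= !add1n ltnS addnS.
  by rewrite !tnthS tnth_mktuple.
have -> : fintype.lift (fintype.lift ord0 i) ord0 = ord0 by apply: val_inj.
by rewrite !tnth0.
Qed.

(** Omitting the head gives back [c]; the other faces have their index shifted by one, whence the
    sign. *)
Lemma std_d_cone g n (c : std_res G n.+1) :
  std_d G n.+1 (cone g n.+1 c) = c - cone g n (std_d G n c).
Proof.
pose f : {additive std_res G n.+1 -> std_res G n.+1} := idfun \- (cone g n \o std_d G n).
have E : std_d G n.+1 \o cone g n.+1 =1 f; last exact: E.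
apply: fg_eq => t.
change (std_d G n.+1 (cone g n.+1 << t >>) = << t >> - cone g n (std_d G n << t >>)).
rewrite coneE /std_d /alt_sum !fg_extE big_ord_recl face_cons0 expr0 raddf_sum -sumrN.
congr (_ + _); apply: eq_bigr => i _; rewrite face_consS exprS mulN1r.
by rewrite (freegUE ((-1) ^+ i)) (freegUE (- (-1) ^+ i)) raddfMz coneE mulrNz.
Qed.

Lemma std_d0 (t : 2.-tuple G) :
  std_d G 0 << t >> = << [tuple of behead t] >> - << [tuple thead t] >>.
Proof.
rewrite /std_d /alt_sum fg_extE big_ord_recl big_ord1 expr0 expr1 freegUN.
have -> : face ord0 t = [tuple of behead t].
  by apply: eq_from_tnth => j; rewrite tnth_mktuple !(tnth_nth 1%g) /= nth_behead.
have -> // : face (fintype.lift ord0 ord0) t = [tuple thead t].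
apply: eq_from_tnth => j; rewrite tnth_mktuple (ord1 j) tnth0 /thead.
by congr (tnth _ _); apply: val_inj.
Qed.

(* The prism operator, sum of the (-1)^i (g_0, ..., g_i, phi g_i, ..., phi g_n),
   written as a recursion on the tuple. *)
Fixpoint prism phi n : n.+1.-tuple G -> std_res G n.+1 :=
  match n return n.+1.-tuple G -> std_res G n.+1 with
  | 0 => fun t => << [tuple of thead t :: map phi t] >>
  | m.+1 => fun t => << [tuple of thead t :: map phi t] >>
                     - cone (thead t) m.+1 (prism phi [tuple of behead t])
  end.

Definition prism_map phi n : {additive std_res G n -> std_res G n.+1} :=
  fg_ext (@prism phi n).

Lemma prism_mapE phi n (t : n.+1.-tuple G) : prism_map phi n << t >> = prism phi t.
Proof. exact: fg_extE. Qed.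

Lemma prism0 phi (t : 1.-tuple G) :
  std_d G 0 (prism phi t) = << [tuple of map phi t] >> - << t >>.
Proof.
rewrite [LHS]std_d0; have -> : [tuple of behead [tuple of thead t :: map phi t]] = [tuple of map phi t].
  exact: val_inj.
have -> // : [tuple thead [tuple of thead t :: map phi t]] = t.
by apply: eq_from_tnth => j; rewrite (ord1 j) !tnth0 theadE.
Qed.

Lemma std_d_cons g n (t : n.+2.-tuple G) :
  std_d G n.+1 << [tuple of g :: t] >> = << t >> - cone g n (std_d G n << t >>).
Proof. by rewrite -coneE std_d_cone. Qed.

Lemma prism_cons phi n g (t : n.+1.-tuple G) :
  prism phi [tuple of g :: t] =
  << [tuple of g :: phi g :: map phi t] >> - cone g n.+1 (prism phi t).
Proof.
rewrite /= theadE; congr (_ - cone _ _ (prism _ _)); last exact: val_inj.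
by have -> // : [tuple of g :: map phi [tuple of g :: t]] = [tuple of g :: phi g :: map phi t];
  exact: val_inj.
Qed.

Lemma prism_map_cone phi g n (c : std_res G n) :
  prism_map phi n.+1 (cone g n c) =
  cone g n.+1 (cone (phi g) n (fg_map (fun t : n.+1.-tuple G => [tuple of map phi t]) c))
  - cone g n.+1 (prism_map phi n c).
Proof.
pose f1 : {additive std_res G n -> std_res G n.+2} := prism_map phi n.+1 \o cone g n.
pose h := fg_map (fun t : n.+1.-tuple G => [tuple of map phi t]).
pose f2 : {additive std_res G n -> std_res G n.+2} :=
  (cone g n.+1 \o (cone (phi g) n \o h)) \- (cone g n.+1 \o prism_map phi n).
have E : f1 =1 f2; last exact: E.
apply: fg_eq => t.
change (prism_map phi n.+1 (cone g n << t >>) =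
  cone g n.+1 (cone (phi g) n (h << t >>)) - cone g n.+1 (prism_map phi n << t >>)).
rewrite coneE /h fg_mapE !coneE !prism_mapE prism_cons; congr (_ - _).
Qed.

Lemma std_d_map phi n (t : n.+2.-tuple G) :
  fg_map (fun t : n.+1.-tuple G => [tuple of map phi t]) (std_d G n << t >>) =
  std_d G n << [tuple of map phi t] >>.
Proof.
rewrite -(fg_mapE (fun t : n.+2.-tuple G => [tuple of map phi t])).
apply/esym/alt_sum_map => i u; apply: eq_from_tnth => j.
by rewrite !(tnth_map, tnth_mktuple).
Qed.

(** The homotopy formula dP + Pd = phi - id, for any self-map [phi] of the underlying set of G.
    Induction on the tuple: the cone formula differentiates both terms of [prism_cons],
    [prism_map_cone] does the same for Pd, and the terms under the cone at [g] cancel by the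
    induction hypothesis. *)
Lemma prismS phi n (t : n.+2.-tuple G) :
  std_d G n.+1 (prism phi t) + prism_map phi n (std_d G n << t >>) =
  << [tuple of map phi t] >> - << t >>.
Proof.
elim: n t => [|n IH] t; case/tupleP: t => g t; rewrite prism_cons.
  (* Degree 1 is computed separately: [std_d_cone] concerns cones over chains of positive degree,
     and below that [std_d0] takes over. *)
  have -> : [tuple of g :: phi g :: map phi t] = [tuple of g :: [tuple of phi g :: [tuple of map phi t]]].
    exact: val_inj.
  rewrite (raddfB (std_d G 1)) std_d_cons std_d_cone prism0 !std_d0.
  have bE h (u : 1.-tuple G) : [tuple of behead [tuple of h :: u]] = u by apply: val_inj.
  have hE h (u : 1.-tuple G) : thead [tuple of h :: u] = h by exact: theadE.
  rewrite !bE !hE (raddfB (prism_map phi 0)) !prism_mapE.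
  have -> : prism phi [tuple g] = cone g 0 << [tuple phi g] >> .
    by rewrite coneE; apply: (congr1 (fun u : 2.-tuple G => << u >> : std_res G 1)); exact: val_inj.
  have -> : [tuple of map phi [tuple of g :: t]] = [tuple of phi g :: [tuple of map phi t]].
    exact: val_inj.
  rewrite !(raddfB (cone g 0)) (coneE g t).
  by rewrite !opprB !addrA !subrK addrAC addrK.
have -> : [tuple of g :: phi g :: map phi t] = [tuple of g :: [tuple of phi g :: [tuple of map phi t]]].
  exact: val_inj.
have -> : [tuple of map phi [tuple of g :: t]] = [tuple of phi g :: [tuple of map phi t]].
  exact: val_inj.
have IHt : std_d G n.+1 (prism phi t) =
    << [tuple of map phi t] >> - << t >> - prism_map phi n (std_d G n << t >>).
  by rewrite -IH addrK.
have pE := prism_mapE phi t; move: (prism phi t) IHt pE => p IHt pE.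
rewrite (raddfB (std_d G n.+2)) !std_d_cons std_d_cone IHt.
rewrite (raddfB (prism_map phi n.+1)) prism_map_cone std_d_map pE.
rewrite !(raddfB (cone g n.+1)) (coneE g t).
by rewrite !opprB !addrA !subrK addrAC addrK.
Qed.

Lemma gact_std g n (t : n.+1.-tuple G) :
  gact g (<< t >> : std_res G n) = << diag_act g t >>.
Proof. by rewrite /= /fg_act fg_extE. Qed.

Lemma cone_act g h n (c : std_res G n) : cone (h * g)%g n (gact h c) = gact h (cone g n c).
Proof.
pose f1 : {additive std_res G n -> std_res G n.+1} := cone (h * g)%g n \o gact h.
pose f2 : {additive std_res G n -> std_res G n.+1} := gact h \o cone g n.
have E : f1 =1 f2; last exact: E.
apply: fg_eq => t.
change (cone (h * g)%g n (gact h (<< t >> : std_res G n)) = gact h (cone g n << t >>)).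
rewrite gact_std !coneE gact_std.
by have -> // : [tuple of (h * g)%g :: diag_act h t] = diag_act h [tuple of g :: t]; exact: val_inj.
Qed.

(** Two maps appear because the prism is applied to the family [shap_phi s], in which translation by
    [g] carries the member at [s] to the member at [act g s]. *)
Lemma prism_act phi phi' g n (t : n.+1.-tuple G) :
  (forall x, phi' (g * x)%g = (g * phi x)%g) ->
  prism phi' (diag_act g t) = gact g (prism phi t).
Proof.
move=> phiE; elim: n t => [|n IH] t.
  rewrite [RHS]gact_std [LHS]/=.
  have -> // : [tuple of thead (diag_act g t) :: map phi' (diag_act g t)] =
      diag_act g [tuple of thead t :: map phi t].
  apply: val_inj; rewrite /= thead_diag; congr (_ :: _).
  by rewrite -!map_comp; apply: eq_map => x /=; rewrite phiE.
case/tupleP: t => h t.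
have -> : diag_act g [tuple of h :: t] = [tuple of (g * h)%g :: diag_act g t] by apply: val_inj.
rewrite !prism_cons IH cone_act (raddfB (gact g)) gact_std; congr (_ - _).
have -> // : [tuple of (g * h)%g :: phi' (g * h)%g :: map phi' (diag_act g t)] =
    diag_act g [tuple of h :: phi h :: map phi t].
apply: val_inj; rewrite /= phiE; congr [:: _, _ & _].
by rewrite -!map_comp; apply: eq_map => x /=; rewrite phiE.
Qed.
End Prism.

Section FreeChains.
Variables (G : groupType) (S : choiceType) (act : G -> S -> S).
Hypotheses (act1 : forall s, act 1%g s = s)
  (actM : forall g h s, act (g * h)%g s = act g (act h s)).
Local Notation ZS := (free_module act1 actM).

Lemma gact_free g s : gact g (<< s >> : ZS) = << act g s >>.
Proof. by rewrite /= /fg_act fg_extE. Qed.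

Lemma free_gchain_ind n (P : gchain ZS n -> Prop) :
  P 0 -> (forall x y, P x -> P y -> P (x - y)) ->
  (forall t s, P (btens t (<< s >> : ZS))) -> forall x, P x.
Proof.
move=> P0 PB PU; apply: gchain_ind => // t m.
elim/freeg_ind: m => [|x y Px Py|s]; last exact: PU.
  by rewrite /btens tens0r.
by rewrite /btens tensBr; exact: PB.
Qed.

Section FreeLift.
Variables (n : nat) (V : zmodType) (b : n.+1.-tuple G -> S -> V).
Hypothesis bG : forall g t s, b (diag_act g t) (act g s) = b t s.

Let bm (t : n.+1.-tuple G) (m : ZS) : V := fg_ext (b t) m.

Fact free_lift_D t : {morph bm t : m m' / m + m'}.
Proof. exact: raddfD. Qed.

Fact free_lift_G g t m : bm (diag_act g t) (gact g m) = bm t m.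
Proof.
rewrite /bm; elim/freeg_ind: m => [|x y xE yE|s]; first by rewrite !raddf0.
  by rewrite !raddfB xE yE.
by rewrite gact_free !fg_extE bG.
Qed.

Definition free_lift : {additive gchain ZS n -> V} := gchain_lift free_lift_D free_lift_G.

Lemma free_liftE t s : free_lift (btens t (<< s >> : ZS)) = b t s.
Proof. by rewrite [LHS]gchain_liftE /bm fg_extE. Qed.

Lemma free_lift_tens (c : std_res G n) s : free_lift (tens c (<< s >> : ZS)) = fg_ext (b^~ s) c.
Proof.
elim/freeg_ind: c => [|x y xE yE|t]; last by rewrite [LHS]free_liftE fg_extE.
  by rewrite tens0l !raddf0.
by rewrite tensBl !raddfB xE yE.
Qed.
End FreeLift.
End FreeChains.

Section Shapiro.
Variables (G H : groupType) (gam : {multiplicative H -> G}).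
Variables (S : choiceType) (act : G -> S -> S) (s0 : S).
Hypotheses (act1 : forall s, act 1%g s = s)
  (actM : forall g h s, act (g * h)%g s = act g (act h s)).
Hypotheses (gamI : injective gam) (gam_s0 : forall h, act (gam h) s0 = s0)
  (stab : forall g, act g s0 = s0 -> exists h, gam h = g)
  (trans : forall s, exists g, act g s0 = s).
Local Notation ZS := (free_module act1 actM).

Fact point_zmod_morphism : zmod_morphism (fun k : int => << s0 >> *~ k : ZS).
Proof. by move=> k l; rewrite mulrzBr. Qed.
Definition point_mod : {additive int -> ZS} :=
  HB.pack (fun k : int => << s0 >> *~ k : ZS)
    (GRing.isZmodMorphism.Build int ZS _ point_zmod_morphism).

Fact point_modE (h : H) (m : trivial_module H int) :
  point_mod (gact h m) = gact (gam h) (point_mod m).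
Proof. by rewrite [RHS](raddfMz (gact (gam h))) gact_free gam_s0. Qed.

Definition point_hom : pair_hom (trivial_module H int) ZS :=
  @PairHom H G (trivial_module H int) ZS gam point_mod point_modE.

(** The normalization [sigma s0 = 1] makes the retraction an exact left inverse on chains
    ([shap_rhoK]), rather than one up to homotopy. *)
Lemma shapiro_section : exists sigma : S -> G,
  (forall s, act (sigma s) s0 = s) /\ sigma s0 = 1%g.
Proof.
have [f fP] := choice trans; exists (fun s => if s == s0 then 1%g else f s).
by split=> [s|]; rewrite ?eqxx //; case: eqP => [->|]; rewrite ?act1.
Qed.

Section Retraction.
Variable sigma : S -> G.
Hypotheses (sigmaE : forall s, act (sigma s) s0 = s) (sigma1 : sigma s0 = 1%g).

(* [shap_phi s] is equivariant in (s, x) and takes values in [sigma s * stab(s0)];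
   dividing by [sigma s] retracts the chains of G with coefficients in Z[S] onto
   those of the stabilizer, and the prism of [shap_phi s] is the homotopy. *)
Definition shap_phi (s : S) (x : G) : G := (x * sigma (act x^-1%g s))%g.

Lemma shap_phi_act g s x : shap_phi (act g s) (g * x)%g = (g * shap_phi s x)%g.
Proof. by rewrite /shap_phi invgM actM -(actM g^-1%g) mulVg act1 mulgA. Qed.

Lemma shap_phi_s0 s x : act (shap_phi s x) s0 = s.
Proof. by rewrite /shap_phi actM sigmaE -actM mulgV act1. Qed.

Lemma shap_q_ex s x : exists h, gam h = ((sigma s)^-1 * shap_phi s x)%g.
Proof. by apply: stab; rewrite actM shap_phi_s0 -[X in act _ X]sigmaE -actM mulVg act1. Qed.

Definition shap_q (s : S) (x : G) : H := projT1 (cid (shap_q_ex s x)).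

Lemma shap_qE s x : gam (shap_q s x) = ((sigma s)^-1 * shap_phi s x)%g.
Proof. exact: (projT2 (cid (shap_q_ex s x))). Qed.

(** Dividing by [sigma s] destroys equivariance, but only by the factor sigma(g s)^-1 g sigma(s) of
    the stabilizer. It does not depend on [x], so the diagonal action of H on chains absorbs it. *)
Lemma shap_q_act g s : exists h, forall x,
  shap_q (act g s) (g * x)%g = (h * shap_q s x)%g.
Proof.
have [|h hE] := @stab ((sigma (act g s))^-1 * (g * sigma s))%g.
  by rewrite !actM sigmaE -[X in act _^-1%g X]sigmaE -actM mulVg act1.
exists h => x; apply: gamI; rewrite gmulfM !shap_qE shap_phi_act hE.
by rewrite -!mulgA (mulgA (sigma s)) mulgV mul1g.
Qed.

Lemma shap_q_gam h : shap_q s0 (gam h) = h.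
Proof.
apply: gamI; rewrite shap_qE sigma1 invg1 mul1g /shap_phi -multiplicativeV gam_s0.
by rewrite sigma1 mulg1.
Qed.

Section Degree.
Variable n : nat.
Let rho_b (t : n.+1.-tuple G) (s : S) : gchain (trivial_module H int) n :=
  @btens _ (trivial_module H int) n [tuple of map (shap_q s) t] 1.

Fact shap_rho_G g t s : rho_b (diag_act g t) (act g s) = rho_b t s.
Proof.
have [h hE] := shap_q_act g s.
rewrite /rho_b -[RHS](btensG h); congr btens.
by apply: eq_from_tnth => i; rewrite !tnth_map hE.
Qed.

Definition shap_rho_fun : {additive gchain ZS n -> gchain (trivial_module H int) n} :=
  free_lift act1 actM shap_rho_G.

Lemma shap_rho_tens (c : std_res G n) s : shap_rho_fun (tens c (<< s >> : ZS)) =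
  @tens _ _ (trivial_module H int)
    (fg_map (fun t : n.+1.-tuple G => [tuple of map (shap_q s) t]) c : std_res H n) 1.
Proof.
rewrite [LHS]free_lift_tens; elim/freeg_ind: c => [|x y xE yE|t].
- by rewrite !raddf0 tens0l.
- by rewrite !raddfB xE yE [RHS]tensBl.
- by rewrite fg_mapE fg_extE.
Qed.

Let prism_b (t : n.+1.-tuple G) (s : S) : gchain ZS n.+1 :=
  tens (prism (shap_phi s) t) (<< s >> : ZS).

Fact shap_prism_G g t s : prism_b (diag_act g t) (act g s) = prism_b t s.
Proof.
rewrite /prism_b (@prism_act _ (shap_phi s) _ g); last by move=> x; exact: shap_phi_act.
by rewrite -gact_free tensG.
Qed.

Definition shap_prism : {additive gchain ZS n -> gchain ZS n.+1} := free_lift act1 actM shap_prism_G.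

Lemma shap_prism_tens (c : std_res G n) s : shap_prism (tens c (<< s >> : ZS)) =
  tens (prism_map (shap_phi s) n c) (<< s >> : ZS).
Proof.
rewrite [LHS]free_lift_tens; elim/freeg_ind: c => [|x y xE yE|t].
- by rewrite !raddf0 tens0l.
- by rewrite !raddfB xE yE [RHS]tensBl.
- by rewrite prism_mapE fg_extE.
Qed.
End Degree.

Fact shap_rho_d n x : shap_rho_fun n (cxd (gchain ZS) n x) =
  cxd (gchain (trivial_module H int)) n (shap_rho_fun n.+1 x).
Proof.
elim/free_gchain_ind: x => [|x y xE yE|t s]; rewrite ?raddf0 // ?raddfB ?xE ?yE //.
rewrite gchain_dE !shap_rho_tens gchain_dE; congr tens.
apply/esym/alt_sum_map => i u; apply: eq_from_tnth => j.
by rewrite !(tnth_map, tnth_mktuple).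
Qed.

Definition shap_rho : cmap (gchain ZS) (gchain (trivial_module H int)) := CMap shap_rho_d.

Lemma shap_rhoK n x : shap_rho n (gchain_map point_hom n x) = x.
Proof.
elim/gchain_ind: x => [x y xE yE|t m]; first by rewrite !raddfB xE yE.
rewrite gchain_map_btens.
have -> : btens t m = btens t (1 : trivial_module H int) *~ m.
  by rewrite -btensMz; congr btens; rewrite -[LHS]intz.
change (shap_rho_fun n (btens [tuple of map gam t] ((<< s0 >> : ZS) *~ m)) =
  btens t (1 : trivial_module H int) *~ m).
rewrite btensMz raddfMz [X in X *~ _]shap_rho_tens fg_mapE; congr (btens _ _ *~ _).
by apply: eq_from_tnth => i; rewrite !tnth_map shap_q_gam.
Qed.

(** The diagonal action of [sigma s] moves [s0] back to [s] and turns the values of [shap_q s] into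
    those of [shap_phi s]; the prism of [shap_phi s] then connects the result with the identity. *)
Lemma shap_rho_homotopic n t s :
  gchain_map point_hom n (shap_rho n (btens t (<< s >> : ZS))) =
  btens [tuple of map (shap_phi s) t] (<< s >> : ZS).
Proof.
rewrite [X in gchain_map _ _ X]shap_rho_tens fg_mapE [LHS]gchain_map_btens.
rewrite -[LHS](btensG (sigma s)) /= mulr1z gact_free sigmaE.
set u := diag_act _ _; have -> // : u = [tuple of map (shap_phi s) t].
by apply: eq_from_tnth => i; rewrite !tnth_map shap_qE mulgA mulgV mul1g.
Qed.

Lemma shap_homotopy0 x : cxd (gchain ZS) 0 (shap_prism 0 x) =
  gchain_map point_hom 0 (shap_rho 0 x) - x.
Proof.
elim/free_gchain_ind: x => [|x y xE yE|t s].
- by rewrite !raddf0 addr0.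
- by rewrite !(raddfB (shap_prism 0)) !raddfB xE yE !opprD !opprK addrACA.
rewrite shap_rho_homotopic shap_prism_tens gchain_dE prism_mapE prism0.
by rewrite tensBl.
Qed.

Lemma shap_homotopyS n x : cxd (gchain ZS) n.+1 (shap_prism n.+1 x) +
  shap_prism n (cxd (gchain ZS) n x) =
  gchain_map point_hom n.+1 (shap_rho n.+1 x) - x.
Proof.
elim/free_gchain_ind: x => [|x y xE yE|t s].
- by rewrite !raddf0 !addr0.
- rewrite (raddfB (shap_prism n.+1)) (raddfB (cxd _ n.+1)) (raddfB (cxd _ n)).
  rewrite (raddfB (shap_prism n)) (raddfB (shap_rho n.+1)) (raddfB (gchain_map point_hom n.+1)).
  by rewrite addrACA -opprD xE yE !opprD !opprK addrACA.
rewrite shap_rho_homotopic shap_prism_tens !gchain_dE prism_mapE shap_prism_tens.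
by rewrite -tensDl prismS tensBl.
Qed.
End Retraction.

Lemma shapiro_inj n : homology_inj (gchain_map point_hom) n.
Proof.
have [sigma [sE s1]] := shapiro_section.
move=> x cx /(cmap_cohom (shap_rho sE)).
by rewrite raddf0 shap_rhoK.
Qed.

Lemma shapiro_surj n : homology_surj (gchain_map point_hom) n.
Proof.
have [sigma [sE s1]] := shapiro_section.
move=> y cy; exists (shap_rho sE n y); first exact: cmap_cycle.
apply: cohom_sym; case: n y cy => [|n] y cy.
  by exists (shap_prism sigma 0 y); rewrite shap_homotopy0.
exists (shap_prism sigma n.+1 y); rewrite -shap_homotopyS.
by move: cy; rewrite cycleS => /eqP ->; rewrite raddf0 addr0.
Qed.
End Shapiro.

(** * One-dimensional classes *)

Section BarChains.
Variables (G : groupType) (M : gmodule G).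
Implicit Types (g h k : G) (m : M).

Lemma btens_bar1 (t : 2.-tuple G) m :
  btens t m = bar1 ((thead t)^-1 * tnth t (fintype.lift ord0 ord0))%g (gact (thead t)^-1%g m).
Proof.
rewrite -btens_norm -[RHS]/(btens [tuple 1%g; _] _); congr (btens _ _); apply: val_inj.
case/tupleP: t => x t; case/tupleP: t => y t; rewrite (tuple0 t) /= !theadE mulVg.
by rewrite tnthS tnth0.
Qed.

Lemma bar1Mz g m (j : int) : bar1 g (m *~ j) = bar1 g m *~ j.
Proof. exact: tensMzr. Qed.

Lemma bar1D g m m' : bar1 g (m + m') = bar1 g m + bar1 g m'.
Proof. exact: tensDr. Qed.

Lemma bar1_mul g h m : cohom (bar1 (g * h)%g m) (bar1 h (gact g^-1%g m) + bar1 g m).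
Proof.
apply: cohom_sym.
(* The face (g, gh) of the simplex (1, g, gh) is g(1, h), which is how [g^-1] comes to act on the
   coefficient. *)
exists (btens [tuple of 1%g :: [tuple g; (g * h)%g]] m).
rewrite gchain_dE std_d_cons std_d0 (raddfB (cone 1%g 0)) tensBl tensBl.
have -> : tens (<< [tuple g; (g * h)%g] >> : std_res G 1) m = bar1 h (gact g^-1%g m).
  by rewrite [LHS]btens_bar1 /= theadE tnthS tnth0 mulKg.
have E x : tens (cone 1%g 0 << [tuple x] >> : std_res G 1) m = bar1 x m by rewrite coneE.
have -> : [tuple of behead [tuple g; (g * h)%g]] = [tuple (g * h)%g] by exact: val_inj.
by rewrite theadE !E opprB addrA.
Qed.

Lemma bar1_1 m : cohom (bar1 1%g m) 0.
Proof.
have := bar1_mul 1%g 1%g m; rewrite mulg1 invg1 gact1.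
move/(cohomB (cohomxx (bar1 1%g m)))/cohom_sym.
by rewrite subrr opprD addNKr => /cohomN; rewrite opprK oppr0.
Qed.

Lemma bar1_mul_fix g h m : gact g m = m ->
  cohom (bar1 (g * h)%g m) (bar1 g m + bar1 h m).
Proof.
move=> gm; have := bar1_mul g h m.
by rewrite -{2}gm -gactM mulVg gact1 addrC.
Qed.

Lemma bar1V g m : gact g m = m -> cohom (bar1 g^-1%g m) (- bar1 g m).
Proof.
move=> gm; have := bar1_mul_fix (g^-1)%g gm; rewrite mulgV => E.
have := cohom_trans (cohom_sym E) (bar1_1 m).
move/cohomB/(_ (cohomxx (bar1 g m))); rewrite sub0r.
by rewrite addrC addKr.
Qed.

(** The product kg is expanded by [bar1_mul] both as k times g and as kgk^-1 times k; the term of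
    [k] is common to both. *)
Lemma bar1_conj k g m : gact g m = m ->
  cohom (bar1 (k * g * k^-1)%g (gact k m)) (bar1 g m).
Proof.
move=> gm; have := bar1_mul k g (gact k m); rewrite -gactM mulVg gact1 => E1.
have := bar1_mul (k * g * k^-1)%g k (gact k m).
have -> : gact (k * g * k^-1)^-1%g (gact k m) = gact k m.
  rewrite -[in LHS]gm -!gactM; congr (gact _ _).
  by rewrite !invgM invgK -!mulgA mulKg mulVg mulg1.
rewrite mulgVK.
move=> E2; have := cohom_trans (cohom_sym E2) E1.
move/cohomB/(_ (cohomxx (bar1 k (gact k m)))).
by rewrite addrK addrAC subrr add0r.
Qed.

(** For cyclic trivial coefficients, sums and inverses of bar classes are again bar classes, so the
    chains homologous to a single symbol form a subgroup containing the generators. This is H_1(G)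
    as a quotient of G. *)
Lemma chain1_cyclic (v : M) (x : gchain M 1) :
  (forall g, gact g v = v) -> (forall m, exists j : int, m = v *~ j) ->
  exists g, cohom x (bar1 g v).
Proof.
move=> vG vM.
have PB (z y : gchain M 1) : (exists g, cohom z (bar1 g v)) -> (exists g, cohom y (bar1 g v)) ->
    exists g, cohom (z - y) (bar1 g v).
  move=> [g xg] [h yh]; exists (g * h^-1)%g.
  apply: cohom_trans (cohomB xg yh) _; apply: cohom_sym.
  apply: cohom_trans (bar1_mul_fix _ (vG g)) _.
  by apply: cohomD (cohomxx _) _; exact: bar1V.
elim/gchain_ind: x => // t m; rewrite btens_bar1.
have [k ->] := vM (gact (thead t)^-1%g m); rewrite bar1Mz.
apply: (@zmod_closed_mulz _ (fun x : gchain M 1 => exists g, cohom x (bar1 g v))) => //.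
  by exists 1%g; apply: cohom_sym; exact: bar1_1.
by eexists; exact: cohomxx.
Qed.
End BarChains.

Section Characters.
Variables (G : groupType) (V : zmodType) (chi : G -> V).
Hypothesis chiM : forall g h, chi (g * h)%g = chi g + chi h.
Local Notation Z := (trivial_module G int).

(** The homogeneous cocycle of the homomorphism [chi]; it vanishes on boundaries and so detects bar
    classes in H_1(G). *)
Let b (t : 2.-tuple G) (m : Z) : V := chi ((thead t)^-1 * tnth t (fintype.lift ord0 ord0))%g *~ (m : int).

Fact char_D t : {morph b t : m m' / m + m'}.
Proof. by move=> m m'; rewrite /b mulrzDr. Qed.

Fact char_G g t m : b (diag_act g t) (gact g m) = b t m.
Proof. by rewrite /b thead_diag tnth_map invgM -mulgA mulKg. Qed.

Definition char_chain : {additive gchain Z 1 -> V} := gchain_lift char_D char_G.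

Lemma char_bar1 g : char_chain (bar1 g (1 : Z)) = chi g.
Proof. by rewrite [LHS]gchain_liftE /b theadE tnthS tnth0 invg1 mul1g. Qed.

Lemma char_bdry x : char_chain (cxd (gchain Z) 1 x) = 0.
Proof.
elim/gchain_ind: x => [x y xE yE|t m]; first by rewrite !raddfB xE yE subrr.
case/tupleP: t => x t; case/tupleP: t => y t; case/tupleP: t => z t; rewrite (tuple0 t).
rewrite gchain_dE std_d_cons std_d0 (raddfB (cone x 0)) !tensBl !coneE.
rewrite !(raddfB char_chain).
have E (u : 2.-tuple G) : char_chain (tens (<< u >> : std_res G 1) m) = b u m by exact: gchain_liftE.
rewrite !E /b !theadE !tnthS !tnth0.
have -> : tnth [tuple of behead [tuple of y :: [tuple of z :: [tuple]]]] ord0 = z by [].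
have -> : (x^-1 * z)%g = (x^-1 * y * (y^-1 * z))%g by rewrite -mulgA mulVKg.
by rewrite (chiM (x^-1 * y)%g) mulrzDl [X in _ - X]addrAC subrr add0r subrr.
Qed.

Lemma char_detect g : cohom (bar1 g (1 : Z)) 0 -> chi g = 0.
Proof. by move=> [e]; rewrite subr0 => /(congr1 char_chain); rewrite char_bdry char_bar1. Qed.
End Characters.

Section Retraction.
Variables (K K' : choiceType) (h : K -> K').

(** Basis elements outside the image of [h] go to 0. Besides proving injectivity, it is used to pull
    Y back from X_1 to the free group on the two pairs. *)
Definition fg_retract : {additive {freeg K'} -> {freeg K}} := fg_ext (fun k' =>
  if pselect (exists k, h k = k') is left e then << projT1 (cid e) >> else 0).

Hypothesis hI : injective h.

Lemma fg_mapK : cancel (fg_map h) fg_retract.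
Proof.
move=> x; have E : fg_retract \o fg_map h =1 idfun; last exact: E.
apply: fg_eq => k; change (fg_retract (fg_map h << k >>) = << k >>).
rewrite fg_mapE fg_extE; case: pselect => [e|[]]; last by exists k.
by rewrite (hI (projT2 (cid e))).
Qed.

Lemma fg_map_inj : injective (fg_map h).
Proof. exact: can_inj fg_mapK. Qed.
End Retraction.

Section Corestriction.
Variables (V W : zmodType) (Q : zmodClosed W) (f : {additive V -> W}).
Hypothesis fQ : forall x, f x \in Q.

Definition zcorestr_fun x : zsub Q := Sub (f x) (fQ x).

Fact zcorestr_zmod_morphism : zmod_morphism zcorestr_fun.
Proof. by move=> x y; apply: val_inj; exact: raddfB. Qed.

Definition zcorestr : {additive V -> zsub Q} :=
  HB.pack zcorestr_fun
    (GRing.isZmodMorphism.Build V (zsub Q) _ zcorestr_zmod_morphism).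
End Corestriction.

Section Augmentation.
Variables (G : groupType) (S : choiceType) (act : G -> S -> S).
Hypotheses (act1 : forall s, act 1%g s = s)
  (actM : forall g h s, act (g * h)%g s = act g (act h s)).
Local Notation ZS := (free_module act1 actM).

Definition aug : {additive ZS -> int} := fg_ext (fun=> 1).

Lemma augE s : aug << s >> = 1. Proof. exact: fg_extE. Qed.

Lemma aug_act g (m : ZS) : aug (gact g m) = aug m.
Proof.
have E : aug \o gact g =1 aug; last exact: E.
apply: fg_eq => s; change (aug (gact g (<< s >> : ZS)) = aug << s >>).
by rewrite gact_free !augE.
Qed.

Lemma aug_ker_act g m : m \in zker aug -> gact g m \in zker aug.
Proof. by rewrite !unfold_in /zker aug_act. Qed.

Definition aug_ideal : gmodule G := submodule aug_ker_act.
End Augmentation.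

(** * The action of SL_2(A) on lines and on transverse pairs *)

Section Concrete.
Variable A : comUnitRingType.
Local Notation G := (SL2 A).
Implicit Types (g h : G) (u v : 'cV[A]_2).

Lemma cv2P u : u = u 0 0 *: e1 A + u 1 0 *: e2 A.
Proof.
apply/matrixP => i j; rewrite (ord1 j) !mxE.
by case: i => -[|[|//]] lt_i; rewrite /= !(mulr0, mulr1, addr0, add0r); congr (u _ _); apply: val_inj.
Qed.

Lemma SL2_e1 g : val g *m e1 A = val g 0 0 *: e1 A + val g 1 0 *: e2 A.
Proof. by rewrite {1}(mx2P (val g)) mx2_e1. Qed.

Lemma SL2_e2 g : val g *m e2 A = val g 0 1 *: e1 A + val g 1 1 *: e2 A.
Proof. by rewrite {1}(mx2P (val g)) mx2_e2. Qed.

Lemma span1_id u : span1 u u. Proof. by exists 1; rewrite scale1r. Qed.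

Lemma SL2_det2 g : val g 0 0 * val g 1 1 - val g 0 1 * val g 1 0 = 1.
Proof. by have := SL2_det g; rewrite {1}(mx2P (val g)) det_mx2. Qed.

Lemma unitr_prod1 (a b : A) : a * b = 1 -> a \is a GRing.unit.
Proof. by move=> ab; apply/unitrPr; exists b. Qed.

Lemma line_act_infty g : line_act g (line_infty A) = line_infty A <-> val g 1 0 = 0.
Proof.
split=> [/(congr1 val) /= | g10].
  rewrite image_span1 => E; have := span1_id (val g *m e1 A).
  rewrite E => -[a]; rewrite SL2_e1 => /(congr1 (fun u : 'cV_2 => u 1 0)).
  by rewrite !mxE /= !(mulr0, mulr1, add0r).
apply: val_inj; rewrite /= image_span1 SL2_e1 g10 scale0r addr0 span1_unit //.
by apply: (@unitr_prod1 _ (val g 1 1)); have := SL2_det2 g; rewrite g10 mulr0 subr0.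
Qed.

Lemma line_act_zero g : line_act g (line_zero A) = line_zero A <-> val g 0 1 = 0.
Proof.
split=> [/(congr1 val) /= | g01].
  rewrite image_span1 => E; have := span1_id (val g *m e2 A).
  rewrite E => -[a]; rewrite SL2_e2 => /(congr1 (fun u : 'cV_2 => u 0 0)).
  by rewrite !mxE /= !(mulr0, mulr1, addr0).
apply: val_inj; rewrite /= image_span1 SL2_e2 g01 scale0r add0r span1_unit //.
apply: (@unitr_prod1 _ (val g 0 0)); have := SL2_det2 g.
by rewrite g01 mul0r subr0 mulrC.
Qed.

Lemma infty_neq_zero : line_infty A <> line_zero A.
Proof.
move=> /(congr1 val) /= E; have := span1_id (e1 A); rewrite E => -[a].
by move/(congr1 (fun u : 'cV_2 => u 0 0)) => /eqP; rewrite !mxE /= mulr0 oner_eq0.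
Qed.

(** Dividing [v] by the determinant of (u, v) brings the matrix into SL_2 without changing the line
    of [v]. Hence SL_2 is already transitive on transverse pairs. *)
Lemma SL2_row u v : (row_mx u v : 'M[A]_2) \in unitmx -> exists g,
  val (line_act g (line_infty A)) = span1 u /\ val (line_act g (line_zero A)) = span1 v.
Proof.
rewrite row_mx2 unitmxE det_mx2; set d := _ - _ => du.
have dE : \det (mx2 (u 0 0) (d^-1 * v 0 0) (u 1 0) (d^-1 * v 1 0)) == 1.
  rewrite det_mx2 mulrCA [d^-1 * v 0 0 * _]mulrAC -mulrA -mulrBr [u 1 0 * _]mulrC.
  by rewrite mulVr.
exists (exist (fun m => \det m == 1) _ dE : G); rewrite /= !image_span1 mx2_e1 mx2_e2 -cv2P.
split=> //.
by rewrite -!scalerA -scalerDr -cv2P span1_unit // unitrV.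
Qed.

Definition line_pt (L : line A) : frame A 0.
Proof.
exists [tuple L]; apply/asboolP => i j; by rewrite (ord1 i) (ord1 j) eqxx.
Defined.

Lemma line_ptE (t : frame A 0) : t = line_pt (tnth (val t) ord0).
Proof. by apply/val_inj/eq_from_tnth => i; rewrite (ord1 i) [RHS]tnth0. Qed.

Lemma line_pt_inj : injective line_pt.
Proof. by move=> K L /(congr1 (fun t : frame A 0 => tnth (val t) ord0)). Qed.

Lemma frame_act_pt g L : frame_act g (line_pt L) = line_pt (line_act g L).
Proof. by rewrite [LHS]line_ptE tnth_map. Qed.

Lemma frame1_eq (s t : frame A 1) : tnth (val s) ord0 = tnth (val t) ord0 ->
  tnth (val s) ord_max = tnth (val t) ord_max -> s = t.
Proof.
move=> E0 E1; apply/val_inj/eq_from_tnth => -[[|[|//]] lt_i].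
  by rewrite [Ordinal _](_ : _ = ord0) //; exact: val_inj.
by rewrite [Ordinal _](_ : _ = ord_max) //; exact: val_inj.
Qed.

Lemma infty_zeroE : (tnth (val (infty_zero A)) ord0 = line_infty A) *
  (tnth (val (infty_zero A)) ord_max = line_zero A).
Proof. by []. Qed.

Lemma zero_inftyE : (tnth (val (zero_infty A)) ord0 = line_zero A) *
  (tnth (val (zero_infty A)) ord_max = line_infty A).
Proof. by []. Qed.

Lemma frame_act1E g (t : frame A 1) i : tnth (val (frame_act g t)) i = line_act g (tnth (val t) i).
Proof. by rewrite tnth_map. Qed.

Lemma frame1_trans (t : frame A 1) : exists g, frame_act g (infty_zero A) = t.
Proof.
have /asboolP/(_ ord0 ord_max erefl) [u [v [_ _ uE vE uv]]] := valP t.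
have [g [gu gv]] := SL2_row uv; exists g; apply: frame1_eq; rewrite frame_act1E infty_zeroE.
  by apply: val_inj; rewrite gu.
by apply: val_inj; rewrite gv.
Qed.

Lemma line_trans (L : line A) : exists g, line_act g (line_infty A) = L.
Proof.
case: L => L Lp; have /asboolP[u [N uN ue] LE] := Lp.
have [|g [gu _]] := @SL2_row u (col 1 N).
  have -> // : row_mx u (col 1 N) = N :> 'M_2.
  by rewrite row_mx2 ue [RHS]mx2P !mxE.
by exists g; apply: val_inj; rewrite gu -LE.
Qed.

Lemma frame0_trans (t : frame A 0) : exists g, frame_act g (line_pt (line_infty A)) = t.
Proof.
rewrite [t]line_ptE; have [g gE] := line_trans (tnth (val t) ord0).
by exists g; rewrite frame_act_pt gE.
Qed.

Lemma X_d0E (t : frame A 1) : X_d A 0 << t >> =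
  << line_pt (tnth (val t) ord_max) >> - << line_pt (tnth (val t) ord0) >>.
Proof.
rewrite /X_d /alt_sum fg_extE big_ord_recl big_ord1 expr0 expr1 freegUN.
have -> : frame_face ord0 t = line_pt (tnth (val t) ord_max).
  rewrite [LHS]line_ptE tnth_mktuple; congr (line_pt (tnth _ _)); exact: val_inj.
have -> // : frame_face (fintype.lift ord0 ord0) t = line_pt (tnth (val t) ord0).
by rewrite [LHS]line_ptE tnth_mktuple; congr (line_pt (tnth _ _)); exact: val_inj.
Qed.

Local Notation aug0 := (aug (@frame_act1 A 0) (@frame_actM A 0)).

Lemma aug_X_d x : aug0 (X_d A 0 x) = 0.
Proof.
elim/freeg_ind: x => [|x y xE yE|t]; rewrite ?raddf0 //.
  by rewrite !raddfB xE yE.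
by rewrite X_d0E (raddfB aug0) !augE subrr.
Qed.

(** The [g] for which (g infty) - (infty) is a boundary form a subgroup, because the differential is
    equivariant. It contains the elementary matrices: the upper ones fix infty, and the lower ones
    fix 0, a line transverse to both infty and its image. *)
Lemma GE2_connected : GE2_ring A ->
  forall x : X A 0, exists y, X_d A 0 y = x - << line_pt (line_infty A) >> *~ aug0 x.
Proof.
move=> hGE; have loop g : exists y, X_d A 0 y =
    << line_pt (line_act g (line_infty A)) >> - << line_pt (line_infty A) >>.
  have XB y g' : X_d A 0 (gact g' y) = gact g' (X_d A 0 y) by exact: X_d_act.
  have gpt g' L : gact g' (<< line_pt L >> : X A 0) = << line_pt (line_act g' L) >>.
    by rewrite -frame_act_pt; exact: gact_free.
  have hg : gspan (@elementary A) g by rewrite hGE.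
  apply: (hg [set h | exists y, X_d A 0 y =
    << line_pt (line_act h (line_infty A)) >> - << line_pt (line_infty A) >>]).
  - by exists 0; rewrite raddf0 line_act1 subrr.
  - move=> h k [y yE] [z zE].
    (* Applying hk^-1 to the chain for [k] gives boundary (h infty) - (hk^-1 infty), to be
       subtracted from (h infty) - (infty). *)
    exists (y - gact (h / k)%g z); rewrite raddfB XB yE zE (raddfB (gact _)) !gpt.
    by rewrite -line_actM mulgVK opprB addrC subrKA.
  - move=> e [x [] eE].
      exists 0; rewrite raddf0; have -> : line_act e (line_infty A) = line_infty A.
        by apply/line_act_infty; rewrite eE mx2E.
      by rewrite subrr.
    pose f : X A 1 := << infty_zero A >>.
    have e0 : line_act e (line_zero A) = line_zero A.
      by apply/line_act_zero; rewrite eE mx2E.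
    (* The path from infty to 0, and from 0 back along the translate of the same edge to [e]
       infty. *)
    exists (f - gact e f); rewrite (raddfB (X_d A 0)) XB X_d0E (raddfB (gact e)) !gpt !infty_zeroE e0.
    by rewrite opprB addrC subrKA.
move=> x; elim/freeg_ind: x => [|x y [x' xE] [y' yE]|t].
- by exists 0; rewrite (raddf0 aug0) mulr0z subr0 raddf0.
- exists (x' - y'); rewrite raddfB xE yE (raddfB aug0) mulrzBr.
  by rewrite !opprD !opprK addrACA.
rewrite augE mulr1z [t]line_ptE; have [g <-] := line_trans (tnth (val t) ord0).
exact: loop.
Qed.
End Concrete.

(** * The monomial subgroup *)

Section Monomial.
Variable A : comUnitRingType.
Local Notation G := (SL2 A).
Local Notation M := (SM2_group A).
Local Notation T := (T2_group A).
Local Notation B := (B2_group A).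
Implicit Types (g h : M).

(** The upper right entry of an antidiagonal matrix of SM_2 is a unit, hence nonzero in the nonzero
    ring A; [flips] is therefore the homomorphism to Z/2 with kernel T. *)
Definition flips g : bool := val (val g) 0 1 != 0.

Lemma flipsP g : exists2 a : A, a \is a GRing.unit &
  val (val g) = (if flips g then mx2 0 a (- a^-1) 0 else mx2 a 0 0 a^-1).
Proof.
have /asboolP[a ua gE] := valP g; exists a => //; rewrite /flips.
case: gE => ->; rewrite mx2E ?eqxx //.
by case: eqP ua => // ->; rewrite unitr0.
Qed.

Lemma flipsM g h : flips (g * h)%g = flips g (+) flips h.
Proof.
have [a ua gE] := flipsP g; have [b ub hE] := flipsP h.
rewrite {1}/flips -[val (g * h)%g]/(val g * val h)%g SL2_mulE gE hE.
have nz c d : c \is a GRing.unit -> d \is a GRing.unit -> c * d != 0 :> A.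
  by move=> uc ud; apply/eqP => E; have := unitrM c d; rewrite E uc ud unitr0.
by case: (flips g); case: (flips h);
  rewrite mx2M mx2E !(mul0r, mulr0, addr0, add0r) ?eqxx // nz // unitrV.
Qed.

Lemma flips1 : flips 1%g = false.
Proof. by rewrite /flips mxE eqxx. Qed.

Definition flip_act g (b : bool) : bool := b (+) flips g.

Lemma flip_act1 b : flip_act 1%g b = b.
Proof. by rewrite /flip_act flips1 addbF. Qed.

Lemma flip_actM g h b : flip_act (g * h)%g b = flip_act g (flip_act h b).
Proof. by rewrite /flip_act flipsM addbCA addbC. Qed.

(* The subcomplex of X_*(A^2) on the two lines infty = true and 0 = false; in
   degree 1, true stands for (infty, 0) and false for (0, infty). *)
Local Notation Xhat := (free_module flip_act1 flip_actM).

Definition axis (b : bool) : line A := if b then line_infty A else line_zero A.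
Definition axis_pair (b : bool) : frame A 1 := if b then infty_zero A else zero_infty A.

Lemma axis_act g b : line_act (val g) (axis b) = axis (flip_act g b).
Proof.
have [a ua gE] := flipsP g; apply: val_inj.
rewrite /flip_act; case: (flips g) gE => gE; case: b;
  by rewrite /= gE image_span1 ?mx2_e1 ?mx2_e2 !scale0r ?add0r ?addr0 span1_unit ?unitrN ?unitrV.
Qed.

Lemma axis_pairE b :
  (tnth (val (axis_pair b)) ord0 = axis b) * (tnth (val (axis_pair b)) ord_max = axis (~~ b)).
Proof. by case: b. Qed.

Lemma axis_pair_act g b : frame_act (val g) (axis_pair b) = axis_pair (flip_act g b).
Proof.
apply: frame1_eq; rewrite frame_act1E !axis_pairE axis_act //.
by rewrite /flip_act addNb.
Qed.

Lemma axis_inj : injective axis.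
Proof. by case=> -[] //=; [move/infty_neq_zero | move/esym/infty_neq_zero]. Qed.

Lemma axis_pair_inj : injective axis_pair.
Proof. by move=> b c E; apply: axis_inj; rewrite -!axis_pairE E. Qed.

Definition xhat0 : {additive Xhat -> X A 0} := fg_map (fun b => line_pt (axis b)).
Definition xhat1 : {additive Xhat -> X A 1} := fg_map axis_pair.
Local Notation inc := (gsub_val (@SM2_closed A)).

Lemma xhat_equiv (K : choiceType) (act : G -> K -> K) (act1 : forall k, act 1%g k = k)
  (actM : forall (g h : G) k, act (g * h)%g k = act g (act h k)) (e : bool -> K) :
  (forall g b, act (val g) (e b) = e (flip_act g b)) ->
  forall g (m : Xhat), fg_map e (gact g m) = @gact G (free_module act1 actM) (inc g) (fg_map e m).
Proof.
move=> eE g m; elim/freeg_ind: m => [|x y xE yE|b].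
- by rewrite !raddf0.
- by rewrite (raddfB (gact g)) !(raddfB (fg_map e)) (raddfB (gact (inc g))) xE yE.
transitivity (fg_map e << flip_act g b >>).
  by congr (fg_map e _); exact: gact_free.
rewrite (fg_mapE e (flip_act g b)) (fg_mapE e b) -eE; apply/esym; exact: (gact_free act1 actM).
Qed.

Lemma xhat0E g (m : Xhat) : xhat0 (gact g m) = gact (inc g) (xhat0 m).
Proof. by apply: xhat_equiv => h b; rewrite frame_act_pt axis_act. Qed.

Lemma xhat1E g (m : Xhat) : xhat1 (gact g m) = gact (inc g) (xhat1 m).
Proof. by apply: xhat_equiv => h b; rewrite axis_pair_act. Qed.

Lemma xhat0_inj : injective xhat0.
Proof. by apply: fg_map_inj => b c /line_pt_inj/axis_inj. Qed.

Lemma xhat1_inj : injective xhat1.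
Proof. exact/fg_map_inj/axis_pair_inj. Qed.

Lemma gsub_val_inj (P : {pred G}) (cP : group_closed P) : injective (gsub_val cP).
Proof. exact: val_inj. Qed.

Lemma T2_sub_SM2 : {subset @T2 A <= @SM2 A}.
Proof.
move=> g; rewrite !unfold_in /T2 is_diag_mx2 => /andP[/eqP g01 /eqP g10].
have gE := SL2_det2 g; rewrite g01 mul0r subr0 in gE.
have ug := unitr_prod1 gE.
apply/asboolP; exists (val g 0 0) => //; left; rewrite [LHS]mx2P g01 g10.
by congr mx2; apply: (mulrI ug); rewrite gE mulrV.
Qed.

Local Notation T_M := (gsub_incl (@T2_closed A) (@SM2_closed A) T2_sub_SM2).
Local Notation T_G := (gsub_val (@T2_closed A)).
Local Notation B_G := (gsub_val (@B2_closed A)).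

Lemma gsub_incl_inj (P Q : {pred G}) (cP : group_closed P) (cQ : group_closed Q) PQ :
  injective (@gsub_incl _ P Q cP cQ PQ).
Proof. by move=> x y E; apply: val_inj; exact: (congr1 (gsub_val cQ) E). Qed.

Lemma T_offdiag (t : T) : val (val t) 0 1 = 0 /\ val (val t) 1 0 = 0.
Proof.
have : val t \in @T2 A := valP t; rewrite unfold_in /T2 is_diag_mx2.
by move=> /andP[/eqP t01 /eqP t10].
Qed.

Lemma T_M_fix t : flip_act (T_M t) true = true.
Proof.
by have [t01 _] := T_offdiag t; rewrite /flip_act /flips t01 eqxx.
Qed.

Definition hom_T_Xhat := point_hom flip_act1 flip_actM T_M_fix.

Lemma T_M_stab g : flip_act g true = true -> exists t, T_M t = g.
Proof.
rewrite /flip_act; have [a ua] := flipsP g; case: (flips g) => // gE _.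
have gT : val g \in @T2 A by rewrite unfold_in /T2 is_diag_mx2 gE !mx2E eqxx.
by exists (exist _ (val g) gT); apply: val_inj.
Qed.

Lemma weyl_proof : \det (mx2 0 1 (-1) 0 : 'M[A]_2) == 1.
Proof. by rewrite det_mx2 mul0r mul1r sub0r opprK. Qed.
Definition weyl : G := exist _ (mx2 0 1 (-1) 0) weyl_proof.
Lemma weyl_SM2 : weyl \in @SM2 A.
Proof. by apply/asboolP; exists 1; rewrite ?unitr1 // invr1; right. Qed.
Definition weylM : M := exist _ weyl weyl_SM2.

Lemma flips_weylM : flips weylM = true.
Proof. by rewrite /flips mx2E oner_eq0. Qed.

Lemma flip_trans b : exists g, flip_act g true = b.
Proof.
by case: b; [exists 1%g; rewrite flip_act1 | exists weylM; rewrite /flip_act flips_weylM].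
Qed.

Lemma T_G_fix t : frame_act (T_G t) (infty_zero A) = infty_zero A.
Proof.
have [t01 t10] := T_offdiag t.
by apply: frame1_eq; rewrite frame_act1E ?infty_zeroE; [exact/line_act_infty | exact/line_act_zero].
Qed.

Definition hom_T_X1 := point_hom (@frame_act1 A 1) (@frame_actM A 1) T_G_fix.

Lemma T_G_stab (g : G) : frame_act g (infty_zero A) = infty_zero A -> exists t, T_G t = g.
Proof.
move=> E; have g10 : val g 1 0 = 0.
  by apply/line_act_infty; have := frame_act1E g (infty_zero A) ord0; rewrite E infty_zeroE => <-.
have g01 : val g 0 1 = 0.
  by apply/line_act_zero; have := frame_act1E g (infty_zero A) ord_max; rewrite E infty_zeroE => <-.
have gT : g \in @T2 A by rewrite unfold_in /T2 is_diag_mx2 g01 g10 eqxx.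
by exists (exist _ g gT).
Qed.

Local Notation inf0 := (line_pt (line_infty A)).

Lemma B_G_fix (t : B) : frame_act (B_G t) inf0 = inf0.
Proof.
rewrite frame_act_pt; congr line_pt; apply/line_act_infty.
have : val t \in @B2 A := valP t; rewrite unfold_in /B2.
by move=> /eqP.
Qed.

Definition hom_B_X0 := point_hom (@frame_act1 A 0) (@frame_actM A 0) B_G_fix.

Lemma B_G_stab (g : G) : frame_act g inf0 = inf0 -> exists t, B_G t = g.
Proof.
rewrite frame_act_pt => /line_pt_inj/line_act_infty g10.
have gB : g \in @B2 A by rewrite unfold_in /B2 g10.
by exists (exist _ g gB).
Qed.

Lemma T_Xhat_surj n : homology_surj (gchain_map hom_T_Xhat) n.
Proof. apply: shapiro_surj; [exact: gsub_incl_inj | exact: T_M_stab | exact: flip_trans]. Qed.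

Lemma T_X1_inj n : homology_inj (gchain_map hom_T_X1) n.
Proof. apply: shapiro_inj; [exact: gsub_val_inj | exact: T_G_stab | exact: frame1_trans]. Qed.

Lemma T_X1_surj n : homology_surj (gchain_map hom_T_X1) n.
Proof. apply: shapiro_surj; [exact: gsub_val_inj | exact: T_G_stab | exact: frame1_trans]. Qed.

Lemma B_X0_inj n : homology_inj (gchain_map hom_B_X0) n.
Proof. apply: shapiro_inj; [exact: gsub_val_inj | exact: B_G_stab | exact: frame0_trans]. Qed.

Lemma B_X0_surj n : homology_surj (gchain_map hom_B_X0) n.
Proof. apply: shapiro_surj; [exact: gsub_val_inj | exact: B_G_stab | exact: frame0_trans]. Qed.

Definition hom_Xhat_X0 : pair_hom Xhat (X A 0) := @PairHom M G Xhat (X A 0) inc xhat0 xhat0E.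
Definition hom_Xhat_X1 : pair_hom Xhat (X A 1) := @PairHom M G Xhat (X A 1) inc xhat1 xhat1E.

(** T is the stabilizer of (infty, 0) both in SM_2 and in SL_2, so both homologies are that of T,
    and the map between them is an isomorphism by two out of three. *)
Lemma acyclic_X1 n : acyclic (coker_complex (gchain_map hom_Xhat_X1)) n.
Proof.
have comp : forall k x, gchain_map hom_Xhat_X1 k (gchain_map hom_T_Xhat k x) =
    gchain_map hom_T_X1 k x.
  apply: gchain_map_comp => // m.
  by rewrite [LHS](raddfMz xhat1) /xhat1 fg_mapE.
have surj k : homology_surj (gchain_map hom_Xhat_X1) k.
  exact: homology_surj_2of3 (comp k) (@T_X1_surj k).
case: n => [|n]; first exact: coker_acyclic0.
apply: coker_acyclicS => //.
  by move=> k; apply: gchain_map_inj; [exact: gsub_val_inj | exact: xhat1_inj].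
exact: homology_inj_2of3 (comp n) (@T_Xhat_surj n) (@T_X1_inj n).
Qed.

(** The map from T to X_0 factors through B, where the hypothesis and Shapiro's lemma apply, and
    also through the two axes, where T is the stabilizer in SM_2. Comparing the factorizations shows
    that the map from SM_2 to SL_2 is injective on H_n and surjective on H_(n+1). *)
Lemma acyclic_X0 n :
  (forall i : nat, (i <= 3)%N -> bijective (group_homology_map (T2_B2 A) i)) ->
  (n < 3)%N -> acyclic (coker_complex (gchain_map hom_Xhat_X0)) n.+1.
Proof.
move=> hTB n3.
have T_G_inf t : frame_act (T_G t) inf0 = inf0.
  by have := B_G_fix (gsub_incl (@T2_closed A) (@B2_closed A) (@T2_sub_B2 A) t).
pose hom_T_X0 := point_hom (@frame_act1 A 0) (@frame_actM A 0) T_G_inf.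
have compB : forall k x, gchain_map hom_B_X0 k (gchain_map (T2_B2 A) k x) =
    gchain_map hom_T_X0 k x by exact: gchain_map_comp.
have compM : forall k x, gchain_map hom_Xhat_X0 k (gchain_map hom_T_Xhat k x) =
    gchain_map hom_T_X0 k x.
  apply: gchain_map_comp => // m.
  by rewrite [LHS](raddfMz xhat0) /xhat0 fg_mapE.
have injT k : (k <= 3)%N -> homology_inj (gchain_map hom_T_X0) k.
  move=> /hTB /bij_inj /hmap_injP injTB.
  exact: homology_inj_comp (compB k) injTB (@B_X0_inj k).
have surjT k : (k <= 3)%N -> homology_surj (gchain_map hom_T_X0) k.
  move=> /hTB [f' _ f'K]; apply: homology_surj_comp (compB k) _ (@B_X0_surj k).
  by apply: hmap_surjP => y; exists (f' y); exact: f'K.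
apply: coker_acyclicS.
- by move=> k; apply: gchain_map_inj; [exact: gsub_val_inj | exact: xhat0_inj].
- by apply: homology_inj_2of3 (compM n) (@T_Xhat_surj n) (injT n _); exact: leq_trans (ltnW n3) _.
- exact: homology_surj_2of3 (compM n.+1) (surjT _ n3).
Qed.
End Monomial.

(** * The two dimension shifts *)

Section RelativeIso.
Variable A : comUnitRingType.
Local Notation G := (SL2 A).
Local Notation M := (SM2_group A).
Local Notation inc := (gsub_val (@SM2_closed A)).
Local Notation Xhat := (free_module (@flip_act1 A) (@flip_actM A)).
Local Notation aug0 := (aug (@frame_act1 A 0) (@frame_actM A 0)).
Local Notation aughat := (aug (@flip_act1 A) (@flip_actM A)).
Local Notation K0 := (aug_ideal (@frame_act1 A 0) (@frame_actM A 0)).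
Local Notation Khat := (aug_ideal (@flip_act1 A) (@flip_actM A)).

Lemma aug_xhat0 (m : Xhat) : aug0 (xhat0 A m) = aughat m.
Proof.
elim/freeg_ind: m => [|x y xE yE|b]; first by rewrite !raddf0.
  by rewrite (raddfB (xhat0 A)) (raddfB aug0) (raddfB aughat) xE yE.
by rewrite /xhat0 fg_mapE !augE.
Qed.

Lemma xhat0_aug_ker x : x \in zker aughat -> xhat0 A x \in zker aug0.
Proof. by rewrite !unfold_in /zker aug_xhat0. Qed.

Definition khat : {additive Khat -> K0} := zsub_map xhat0_aug_ker.

Lemma khatE g (m : Khat) : khat (gact g m) = gact (inc g) (khat m).
Proof. by apply: val_inj; exact: (@xhat0E A). Qed.

Lemma khat_inj : injective khat.
Proof. by move=> x y /(congr1 val) /(@xhat0_inj A) /val_inj. Qed.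

(** The intermediate module is the augmentation kernel, not the image of X_1; that the two agree is
    the GE_2 property, used in [rel_Z1_ziso] as surjectivity of [dK]. *)
Lemma rel_trivial_ziso n :
  acyclic (coker_complex (gchain_map (hom_Xhat_X0 A))) n.+1 ->
  acyclic (coker_complex (gchain_map (hom_Xhat_X0 A))) n ->
  ziso (relative_homology (SM2_SL2 A) n.+1) (relative_homology (PairHom khatE) n).
Proof.
apply: (@relative_connecting_ziso M G inc Khat Xhat (trivial_module M int)
  K0 (X A 0) (trivial_module G int) khat (xhat0 A) idfun khatE (@xhat0E A) (fun _ _ => erefl)
  val aughat val aug0) => //.
- by move=> g m; exact: aug_act.
- by move=> g m; exact: aug_act.
- by move=> m; rewrite aug_xhat0.
- exact: gsub_val_inj.
- exact: val_inj.
- by move=> z; exists (<< line_pt (line_infty A) >> *~ z); rewrite (raddfMz aug0) augE intz.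
- by move=> x; apply/eqP; exact: (valP x).
- move=> y y0; have yK : y \in zker aug0 by rewrite unfold_in /zker y0.
  by exists (Sub y yK).
- by move=> z; exists (<< true >> *~ z); rewrite (raddfMz aughat) augE intz.
- move=> y y0; have yK : y \in zker aughat by rewrite unfold_in /zker y0.
  by exists (Sub y yK).
Qed.

Lemma Zhat1_cyclic (z : Zhat1 A) : exists k : int, z = Yhat A *~ k.
Proof.
have /asboolP/(_ [set y | exists k : int, y = Y A *~ k]) [] := valP z.
- by exists 0; rewrite mulr0z.
- by move=> _ _ [k ->] [l ->]; exists (k - l); rewrite mulrzBr.
- by move=> _ ->; exists 1; rewrite mulr1z.
by move=> k zE; exists k; apply: val_inj; rewrite zE (raddfMz (val : Zhat1 A -> Z1 A)).
Qed.

Lemma freeg_bool (x : {freeg bool}) : exists a b : int, x = << true >> *~ a + << false >> *~ b.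
Proof.
elim/freeg_ind: x => [|x y [a [b ->]] [a' [b' ->]]|[]].
- by exists 0, 0; rewrite !mulr0z addr0.
- by exists (a - a'), (b - b'); rewrite !mulrzBr opprD addrACA.
- by exists 1, 0; rewrite mulr1z mulr0z addr0.
- by exists 0, 1; rewrite mulr1z mulr0z add0r.
Qed.

(** The differential from pairs to points on the two axes: [b] is read as the pair (axis b, axis
    ~~b) in the source and as a point in the target. *)
Definition dhat0 : {additive Xhat -> Xhat} := fg_ext (fun b => << ~~ b >> - << b >>).

Lemma dhat0_aug x : dhat0 x \in zker aughat.
Proof.
rewrite unfold_in /zker; apply/eqP; elim/freeg_ind: x => [|x y xE yE|b].
- by rewrite !raddf0.
- by rewrite (raddfB dhat0) (raddfB aughat) xE yE subrr.
by rewrite fg_extE (raddfB aughat) !augE subrr.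
Qed.

Definition dhat : {additive Xhat -> Khat} := zcorestr dhat0_aug.

Lemma X_d_aug_ker x : X_d A 0 x \in zker aug0.
Proof. by rewrite unfold_in /zker aug_X_d. Qed.

Definition dK : {additive X A 1 -> K0} := zcorestr X_d_aug_ker.

(** The module [Zhat1] is given inside X_1, so its embedding into the free group on the two pairs is
    obtained by retraction; [Y] corresponds to [<< true >> + << false >>]. *)
Definition zhat_incl : {additive Zhat1 A -> Xhat} :=
  fg_retract (@axis_pair A) \o ((val : {additive Z1 A -> X A 1}) \o (val : {additive Zhat1 A -> Z1 A})).

Lemma zhat_inclK z : xhat1 A (zhat_incl z) = val (val z).
Proof.
have [k ->] := Zhat1_cyclic z; rewrite !raddfMz; congr (_ *~ k).
have YE : val (val (Yhat A)) = xhat1 A (<< true >> + << false >>).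
  by rewrite (raddfD (xhat1 A)) /xhat1 !fg_mapE.
change (xhat1 A (fg_retract (@axis_pair A) (val (val (Yhat A)))) = val (val (Yhat A))).
by rewrite YE [X in xhat1 A X]fg_mapK //; exact: axis_pair_inj.
Qed.

Lemma zhat_inclE g (z : Zhat1 A) : zhat_incl (gact g z) = gact g (zhat_incl z).
Proof.
apply: (@xhat1_inj A); rewrite zhat_inclK xhat1E zhat_inclK.
exact: erefl.
Qed.

Lemma dhatE g (m : Xhat) : dhat (gact g m) = gact g (dhat m).
Proof.
apply: val_inj; change (dhat0 (gact g m) = gact g (dhat0 m)).
elim/freeg_ind: m => [|x y xE yE|b]; first by rewrite !raddf0.
  by rewrite !(raddfB (gact g)) !(raddfB dhat0) (raddfB (gact g)) xE yE.
have gE c : gact g (<< c >> : Xhat) = << flip_act g c >> by exact: gact_free.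
by rewrite gE /dhat0 !fg_extE (raddfB (gact g)) !gE /flip_act addNb.
Qed.

Lemma dKE g (m : X A 1) : dK (gact g m) = gact g (dK m).
Proof. by apply: val_inj; exact: X_d_act. Qed.

Lemma khat_dhat m : khat (dhat m) = dK (xhat1 A m).
Proof.
apply: val_inj; change (xhat0 A (dhat0 m) = X_d A 0 (xhat1 A m)).
elim/freeg_ind: m => [|x y xE yE|b]; first by rewrite !raddf0.
  rewrite (raddfB dhat0) (raddfB (xhat0 A)) (raddfB (xhat1 A)) xE yE.
  by rewrite (raddfB (X_d A 0)).
rewrite fg_extE (raddfB (xhat0 A)) /xhat0 /xhat1 !fg_mapE X_d0E.
by rewrite !axis_pairE.
Qed.

Lemma rel_Z1_ziso n : GE2_ring A ->
  ziso (relative_homology (PairHom khatE) n.+1) (relative_homology (SM2_SL2_Z1 A) n).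
Proof.
move=> hGE; apply: (@relative_connecting_ziso M G inc (Zhat1 A) Xhat Khat
  (Z1 A) (X A 1) K0 val (xhat1 A) khat (fun _ _ => erefl) (@xhat1E A) khatE
  zhat_incl dhat val dK).
- exact: zhat_inclE.
- exact: dhatE.
- by move=> g m; exact: erefl.
- exact: dKE.
- exact: zhat_inclK.
- exact: khat_dhat.
- exact: gsub_val_inj.
- exact: khat_inj.
- exact: val_inj.
- move=> z; have [y yE] := GE2_connected hGE (val z).
  exists y; apply: val_inj; change (X_d A 0 y = val z).
  by rewrite yE (eqP (valP z : aug0 (val z) == 0)) mulr0z subr0.
- by move=> x; apply: val_inj; apply/eqP; exact: (valP x).
- move=> y /(congr1 val) y0; have yK : y \in zker (X_d A 0) by apply/eqP.
  by exists (Sub y yK).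
- move=> z; have [a [b zE]] := freeg_bool (val z).
  have := eqP (valP z : aughat (val z) == 0).
  rewrite zE (raddfD aughat) !(raddfMz aughat) !augE !intz => /eqP.
  rewrite addr_eq0 => /eqP aE.
  (* Augmentation zero means [a = - b], and the boundary of (infty, 0) is
     [<< false >> - << true >>]. *)
  exists (<< true >> *~ b); apply: val_inj; rewrite zE.
  change (dhat0 (<< true >> *~ b) = << true >> *~ a + << false >> *~ b).
  by rewrite raddfMz fg_extE aE mulrzBl mulrNz addrC.
- move=> y; have [a [b ->]] := freeg_bool y => /(congr1 val) d0'.
  have {d0'} d0 : dhat0 (<< true >> *~ a + << false >> *~ b) = 0 := d0'.
  have ab : a = b.
    (* The coefficient of [true], which equals [b - a] on the boundary. *)
    pose th : {additive {freeg bool} -> int} := fg_ext (fun c : bool => (c : nat)%:Z).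
    have := congr1 th d0; rewrite (raddfD dhat0) !(raddfMz dhat0) /dhat0 !fg_extE (raddfD th).
    rewrite !(raddfMz th) !(raddfB th) /th !fg_extE (raddf0 (fg_ext _)) !intz.
    by rewrite /= sub0r mulNrz intz addrC => /eqP; rewrite subr_eq0 => /eqP ->.
  exists (Yhat A *~ a); apply: (@xhat1_inj A).
  transitivity (val (val (Yhat A *~ a))); last by rewrite zhat_inclK.
  by rewrite -ab -mulrzDl !raddfMz (raddfD (xhat1 A)) /xhat1 !fg_mapE.
- exact: acyclic_X1.
- exact: acyclic_X1.
Qed.

Lemma rel_ziso n :
  (forall i : nat, (i <= 3)%N -> bijective (group_homology_map (T2_B2 A) i)) ->
  GE2_ring A -> (n < 2)%N ->
  ziso (relative_homology (SM2_SL2 A) n.+2) (relative_homology (SM2_SL2_Z1 A) n).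
Proof.
move=> hTB hGE n2; apply: ziso_trans (rel_Z1_ziso n hGE).
by apply: rel_trivial_ziso; apply: acyclic_X0 => //; exact: ltnW.
Qed.

End RelativeIso.

(** * The exact sequence *)

Section CokerProjection.
Variables (C D : complex) (f : cmap C D).

Definition coker_proj : cmap D (coker_complex f) :=
  @CMap D (coker_complex f) (fun n => zproj (range (f n))) (fun n y => esym (coker_dE f y)).

Lemma coker_proj_cohom n (y : D n) :
  cohom (coker_proj n y) 0 <-> exists k, cohom y (f n k).
Proof.
split=> [[q]|[k [e de]]].
  have [e ->] := cokerP q; rewrite coker_dE subr0 => /coker_eq [k yk].
  by exists (- k), e; rewrite raddfN opprK.
exists (zproj (range (f n.+1)) e).
rewrite coker_dE de subr0 raddfB -[RHS]subr0; congr (_ - _).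
by apply/coker_eq0; exists k.
Qed.
End CokerProjection.

Lemma hclassMz (C : complex) n (x : C n) k (cx : x \in @cycle C n)
  (ckx : x *~ k \in @cycle C n) : hclass ckx = hclass cx *~ k.
Proof.
rewrite /hclass -(raddfMz (zproj (@boundary C n))); congr (zproj _ _); apply: val_inj.
by rewrite (raddfMz (val : zsub (@cycle C n) -> C n)).
Qed.

Section Objects.
Variable A : comUnitRingType.
Local Notation F := (gchain_map (SM2_SL2_Z1 A)).

Lemma gchain_map_bar1 (G1 G2 : groupType) (M1 : gmodule G1) (M2 : gmodule G2)
  (f : pair_hom M1 M2) g m : gchain_map f 1 (bar1 g m) = bar1 (pgrp f g) (pmod f m).
Proof.
rewrite [LHS]gchain_map_btens; congr btens; apply: val_inj => /=.
by rewrite multiplicative1.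
Qed.

Lemma chain0_Zhat (k : gchain (Zhat1 A) 0) :
  exists n : int, k = btens [tuple 1%g] (Yhat A) *~ n.
Proof.
elim/gchain_ind: k => [x y [a ->] [b ->]|t m]; first by exists (a - b); rewrite mulrzBr.
have [n mE] := Zhat1_cyclic (gact (thead t)^-1%g m); exists n.
rewrite -btens_norm mE btensMz; congr (btens _ _ *~ _).
by apply: eq_from_tnth => i; rewrite (ord1 i) tnth_map mulVg.
Qed.

Lemma F_chain0 n : F 0 (btens [tuple 1%g] (Yhat A) *~ n) = btens [tuple 1%g] (Y A) *~ n.
Proof.
rewrite raddfMz gchain_map_btens; congr (btens _ _ *~ _); exact: val_inj.
Qed.

(** Both groups are the 0-chains of Z_1 modulo boundaries and multiples of [1] (x) Y: by
    [chain0_Zhat] these multiples are all that SM_2 contributes in degree 0. *)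
Lemma rel0_W_ziso : ziso (relative_homology (SM2_SL2_Z1 A) 0) (W A).
Proof.
have hMz n : hclass (erefl : btens [tuple 1%g] (Y A) *~ n \in @cycle (gchain (Z1 A)) 0) = class0 (Y A) *~ n.
  exact: hclassMz.
apply: (@ziso_rel _ _ (fun x y => exists c : gchain (Z1 A) 0,
  x = @hclass (coker_complex F) 0 (coker_proj F 0 c) erefl /\
  y = zproj [set class0 (Y A)] (@hclass (gchain (Z1 A)) 0 c erefl))).
- move=> _ _ _ _ [c [-> ->]] [c' [-> ->]]; exists (c - c'); split.
    by rewrite -hclassB; apply/hclass_eq; rewrite raddfB; exact: cohomxx.
  by rewrite -raddfB; congr (zproj _ _); apply/esym; exact: hclassB.
- move=> x; have [q [cq ->]] := homologyP x; have [c qE] := cokerP q; subst q.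
  exists (zproj [set class0 (Y A)] (@hclass (gchain (Z1 A)) 0 c erefl)), c; split=> //.
  by apply/hclass_eq; exact: cohomxx.
- move=> y; rewrite -[y]zprojK; have [c [cc ->]] := homologyP (repr y).
  exists (@hclass (coker_complex F) 0 (coker_proj F 0 c) erefl), c; split=> //.
  by congr (zproj _ _); apply/hclass_eq; exact: cohomxx.
- move=> _ [c [-> /esym/eqP]]; rewrite zproj_eq0 => /asboolP.
  move/(_ [set y | exists n : int, y = class0 (Y A) *~ n]) => [].
  + by exists 0; rewrite mulr0z.
  + by move=> _ _ [a ->] [b ->]; exists (a - b); rewrite mulrzBr.
  + by move=> _ ->; exists 1; rewrite mulr1z.
  move=> n; rewrite -hMz => /hclass_eq cE; rewrite -F_chain0 in cE.
  apply/hclass_eq0; have [|e] := (coker_proj_cohom F c).2; first by eexists; exact: cE.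
  by rewrite subr0; exists e.
move=> _ [c [/esym/hclass_eq0 [e de] ->]].
have [|k] := (coker_proj_cohom F c).1; first by exists e; rewrite de subr0.
have [n ->] := chain0_Zhat k; rewrite F_chain0 => cE.
apply/eqP; rewrite zproj_eq0.
have -> : @hclass (gchain (Z1 A)) 0 c erefl = class0 (Y A) *~ n by rewrite -hMz; apply/hclass_eq.
apply: rpredMz; exact: mem_zspan.
Qed.

End Objects.

Section BarClasses.
Variables (G : groupType) (M : gmodule G).

Lemma hclass_bar1_div (g h : G) (m : M) (gm : gact g m = m) (hm : gact h m = m)
  (ghm : gact (g / h)%g m = m) :
  hclass (bar1_cycle ghm) = hclass (bar1_cycle gm) - hclass (bar1_cycle hm).
Proof.
have c := rpredB (bar1_cycle gm) (bar1_cycle hm).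
rewrite -(hclassB _ _ c); apply/hclass_eq.
apply: cohom_trans (bar1_mul_fix _ gm) _.
by apply: cohomD (cohomxx _) _; exact: bar1V.
Qed.

Lemma hclass_bar1_conj (k g : G) (m : M) (gm : gact g m = m)
  (kgm : gact (k * g * k^-1)%g m = m) : gact k m = m ->
  hclass (bar1_cycle kgm) = hclass (bar1_cycle gm).
Proof.
move=> km; apply/hclass_eq; have := bar1_conj k gm.
by rewrite km.
Qed.
End BarClasses.

(** * The map alpha and the values of bar classes in H_1(SL_2, X_1) *)

Section AlphaMap.
Variable A : comUnitRingType.
Local Notation G := (SL2 A).
Local Notation M := (SM2_group A).
Local Notation F := (gchain_map (SM2_SL2_Z1 A)).
Local Notation J := (gchain_map (Z1_X1 A)).
Local Notation iz := (<< infty_zero A >> : X A 1).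
Local Notation weyl := (weyl A).
Local Notation weylM := (weylM A).
Local Notation minus1 := (weyl * weyl)%g.

Lemma gact_X n (g : G) (t : frame A n) : gact g (<< t >> : X A n) = << frame_act g t >>.
Proof. exact: gact_free. Qed.

Lemma diag_SM2E (a : units A) : val (val (diag_SM2 a)) = mx2 (val a) 0 0 (val a)^-1.
Proof. by []. Qed.

Lemma diag_SM2B (a b : units A) : diag_SM2 (a - b) = (diag_SM2 a / diag_SM2 b)%g.
Proof.
apply: val_inj; apply: val_inj.
rewrite -[RHS]/(val (val (diag_SM2 a)) *m val (val (diag_SM2 b))^-1%g).
rewrite (SL2_invE (diag_SM2E b)) !diag_SM2E mx2M !(mul0r, mulr0, oppr0, addr0, add0r).
rewrite /= invrM ?unitrV ?(valP a) ?(valP b) // invrK.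
by congr mx2; exact: mulrC.
Qed.

Lemma diag_SM2N (a : units A) : diag_SM2 (- a) = (diag_SM2 a)^-1%g.
Proof. by rewrite -sub0r diag_SM2B -(subrr 0) diag_SM2B mulgV mul1g. Qed.

Lemma weyl_diag (a : units A) : (weylM * diag_SM2 a * weylM^-1)%g = diag_SM2 (- a).
Proof.
apply: val_inj; apply: val_inj.
rewrite -[LHS]/(val weyl *m val (val (diag_SM2 a)) *m val weyl^-1%g).
have wE : val weyl = mx2 0 1 (-1) 0 by [].
rewrite (SL2_invE wE) wE !diag_SM2E !mx2M.
rewrite !(mul0r, mulr0, mul1r, mulr1, oppr0, addr0, add0r, mulrN1, mulN1r, opprK).
by rewrite /= invrK.
Qed.

Lemma weyl_diagV (a : units A) :
  (weyl * (val (diag_SM2 a))^-1 * weyl^-1)%g = val (diag_SM2 a).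
Proof.
have E := congr1 val (weyl_diag (- a)); rewrite opprK diag_SM2N in E; exact: E.
Qed.

Lemma SL2_diag (g : G) : val g 0 1 = 0 -> val g 1 0 = 0 ->
  exists2 a : units A, g = val (diag_SM2 a) & val a = val g 0 0.
Proof.
move=> g01 g10; have gE := SL2_det2 g; rewrite g01 mul0r subr0 in gE.
have ug := unitr_prod1 gE; exists (exist _ (val g 0 0) ug) => //.
apply: val_inj; rewrite diag_SM2E [LHS]mx2P g01 g10 /=.
by congr mx2; apply: (mulrI ug); rewrite gE mulrV.
Qed.

Lemma weyl_infty_zero : frame_act weyl (infty_zero A) = zero_infty A.
Proof.
have E := axis_pair_act weylM true; rewrite /flip_act flips_weylM in E; exact: E.
Qed.

Lemma diag_fix (a : units A) b : frame_act (val (diag_SM2 a)) (axis_pair A b) = axis_pair A b.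
Proof.
by rewrite axis_pair_act /flip_act /flips diag_SM2E mx2E eqxx addbF.
Qed.

Lemma J_bar1_Y (g : M) :
  J 1 (bar1 (val g) (Y A)) = bar1 (val g) iz + bar1 (val g) (<< zero_infty A >> : X A 1).
Proof. by rewrite gchain_map_bar1 -bar1D. Qed.

(** Conjugation by [weyl] exchanges the two pairs and inverts D, so [D] (x) (0, infty) is homologous
    to [D^-1] (x) (infty, 0) and cancels [D] (x) (infty, 0). *)
Lemma J_diag (a : units A) : cohom (J 1 (bar1 (val (diag_SM2 a)) (Y A))) 0.
Proof.
rewrite J_bar1_Y; set D := val (diag_SM2 a).
have Diz : gact D iz = iz by rewrite gact_X (diag_fix a true).
have DViz : gact D^-1%g iz = iz by rewrite -{1}Diz -gactM mulVg gact1.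
have := bar1_conj weyl DViz; rewrite gact_X weyl_infty_zero.
rewrite weyl_diagV.
move=> E; rewrite -(subrr (bar1 D iz)); apply: cohomD (cohomxx _) _.
exact: cohom_trans E (bar1V Diz).
Qed.

(** The two terms of the image are the expansion of [w w] (x) (0, infty) by [bar1_mul], as w^-1 (0,
    infty) = (infty, 0). Since w w commutes with w, conjugation then replaces (0, infty) by (infty,
    0). *)
Lemma J_weyl : cohom (J 1 (bar1 weyl (Y A))) (bar1 minus1 iz).
Proof.
rewrite (J_bar1_Y weylM); have := bar1_mul weyl weyl (<< zero_infty A >> : X A 1).
rewrite -{2}weyl_infty_zero -gact_X -gactM mulVg gact1 => /cohom_sym E.
apply: cohom_trans E _.
have m1 : gact minus1 iz = iz.
  by rewrite gactM !gact_X weyl_infty_zero -[zero_infty A]/(axis_pair A false)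
    (axis_pair_act weylM) /flip_act flips_weylM.
have := bar1_conj weyl m1; rewrite gact_X weyl_infty_zero mulgA mulgK.
exact.
Qed.

Lemma minus1E : val minus1 = mx2 (-1) 0 0 (-1).
Proof.
by rewrite SL2_mulE mx2M !(mul0r, mulr0, mul1r, mulr1, addr0, add0r).
Qed.

Definition barY (g : M) : group_homology 1 (Zhat1 A) :=
  hclass (bar1_cycle (Zhat1_trivial g (Yhat A))).

Lemma barY_div g h : barY (g / h)%g = barY g - barY h.
Proof.
exact: hclass_bar1_div.
Qed.

Lemma barY_conj k g : barY (k * g * k^-1)%g = barY g.
Proof.
exact/hclass_bar1_conj/Zhat1_trivial.
Qed.

Lemma alpha_classE (a : units A) :
  alpha_class a = group_homology_map (SM2_SL2_Z1 A) 1 (barY (diag_SM2 a)).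
Proof. by []. Qed.

Lemma alpha_classB (a b : units A) : alpha_class (a - b) = alpha_class a - alpha_class b.
Proof. by rewrite !alpha_classE diag_SM2B barY_div raddfB. Qed.

Lemma alpha_class_hclass (a : units A)
  (c : bar1 (val (diag_SM2 a)) (Y A) \in @cycle (gchain (Z1 A)) 1) :
  alpha_class a = hclass c.
Proof.
have E : F 1 (bar1 (diag_SM2 a) (Yhat A)) = bar1 (val (diag_SM2 a)) (Y A) by exact: gchain_map_bar1.
have c' : F 1 (bar1 (diag_SM2 a) (Yhat A)) \in @cycle (gchain (Z1 A)) 1 by rewrite E.
rewrite /alpha_class [LHS](hmapE _ c'); apply/hclass_eq; rewrite E; exact: cohomxx.
Qed.

Lemma Y_fix (g : M) : gact (val g) (Y A) = Y A.
Proof. exact/SM2_Y/(valP g). Qed.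

Lemma J_zker y (cy : y \in @cycle (gchain (Z1 A)) 1) :
  (hclass cy \in zker (group_homology_map (Z1_X1 A) 1)) <-> cohom (J 1 y) 0.
Proof.
have cJ := @cmap_cycle _ _ J 1 _ cy.
rewrite unfold_in /zker (_ : group_homology_map (Z1_X1 A) 1 (hclass cy) = hclass cJ); last exact: hmapE.
split=> [/eqP/hclass_eq0 [e de]|[e de]]; first by exists e; rewrite subr0.
by apply/eqP/hclass_eq0; exists e; rewrite de subr0.
Qed.

Lemma alpha_class_ker (a : units A) : alpha_class a \in zker (group_homology_map (Z1_X1 A) 1).
Proof.
rewrite (alpha_class_hclass (bar1_cycle (Y_fix (diag_SM2 a)))).
by apply/J_zker; exact: J_diag.
Qed.

Definition alpha_units_fun (a : units A) : E221 A := Sub (alpha_class a) (alpha_class_ker a).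

Fact alpha_units_zmod_morphism : zmod_morphism alpha_units_fun.
Proof. by move=> a b; apply: val_inj; exact: alpha_classB. Qed.

Definition alpha_units : {additive units A -> E221 A} :=
  HB.pack alpha_units_fun
   (GRing.isZmodMorphism.Build (units A) (E221 A) _ alpha_units_zmod_morphism).

(** A square is the quotient of b by b^-1, and the diagonal matrices of these two units are
    conjugate in SM_2. The relation thus holds already in H_1(SM_2, Zhat_1). *)
Lemma alpha_squares (a : units A) : squares a -> alpha_units a = 0.
Proof.
move=> [b ab]; apply: val_inj; change (alpha_class a = 0).
have -> : a = b - (- b) by apply: val_inj; rewrite opprK ab expr2.
by rewrite alpha_classB !alpha_classE -weyl_diag barY_conj subrr.
Qed.

Definition alpha : {additive sqclasses A -> E221 A} := zlift alpha_squares.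

Lemma alphaE (a : units A) : alpha (sqclass a) = alpha_units a.
Proof. exact: zliftE. Qed.

End AlphaMap.

(** * Kernel and image of the map from E^2_{2,1} to relative homology *)

Section Exactness.
Variable A : comUnitRingType.
Local Notation G := (SL2 A).
Local Notation T := (T2_group A).
Local Notation B := (B2_group A).
Local Notation F := (gchain_map (SM2_SL2_Z1 A)).
Local Notation J := (gchain_map (Z1_X1 A)).
Local Notation iz := (<< infty_zero A >> : X A 1).
Local Notation inf0 := (line_pt (line_infty A)).
Local Notation i0 := (<< inf0 >> : X A 0).
Local Notation weyl := (weyl A).
Local Notation weylM := (weylM A).
Local Notation minus1 := (weyl * weyl)%g.
Local Notation augX1 := (aug (@frame_act1 A 1) (@frame_actM A 1)).

Fact chain_aug_D (t : 1.-tuple G) : {morph (fun m : Z1 A => augX1 (val m)) : m m' / m + m'}.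
Proof. by move=> m m'; rewrite !raddfD. Qed.

Fact chain_aug_G (g : G) (t : 1.-tuple G) (m : Z1 A) : augX1 (val (gact g m)) = augX1 (val m).
Proof. exact: aug_act. Qed.

(** The action permutes the basis of X_1, so the sum of the coefficients is invariant and vanishes
    on boundaries; its value on Y is 2. *)
Definition chain_aug : {additive gchain (Z1 A) 0 -> int} :=
  @gchain_lift G (Z1 A) 0 int (fun _ m => augX1 (val m)) chain_aug_D chain_aug_G.

Lemma chain_aug_bdry y : chain_aug (cxd (gchain (Z1 A)) 0 y) = 0.
Proof.
elim/gchain_ind: y => [x y xE yE|t m]; first by rewrite !raddfB xE yE subrr.
rewrite gchain_dE std_d0 tensBl (raddfB chain_aug).
have E (u : 1.-tuple G) : chain_aug (tens (<< u >> : std_res G 0) m) = augX1 (val m) by exact: gchain_liftE.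
by rewrite !E subrr.
Qed.

(** A lift of a relative cycle has boundary n [1] (x) Y; [chain_aug] gives 2n = 0, so every lift is
    already an absolute cycle. *)
Lemma cycle_of_rel (y : gchain (Z1 A) 1) :
  coker_proj F 1 y \in @cycle (coker_complex F) 1 -> y \in @cycle (gchain (Z1 A)) 1.
Proof.
rewrite !cycleS coker_dE => /eqP/coker_eq0 [k dy].
have [n kE] := chain0_Zhat k; move: dy; rewrite kE F_chain0 => dy.
have := chain_aug_bdry y; rewrite dy (raddfMz chain_aug) [X in X *~ _]gchain_liftE.
rewrite (raddfD augX1) !augE => n2.
have n0 : n = 0.
  by move: n2 => /eqP; rewrite mulrz_eq0 => /orP[/eqP|//].
by rewrite n0 mulr0z.
Qed.

Lemma B_offdiag (b : B) : val (val b) 1 0 = 0.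
Proof. by have : val b \in @B2 A := valP b; rewrite unfold_in /B2 => /eqP. Qed.

Fact B_char_unit (b : B) : val (val b) 0 0 \is a GRing.unit.
Proof.
apply: (@unitr_prod1 _ _ (val (val b) 1 1)).
by have := SL2_det2 (val b); rewrite B_offdiag mulr0 subr0.
Qed.

Definition B_char (b : B) : units A := exist _ (val (val b) 0 0) (B_char_unit b).

Lemma B_charM b c : B_char (b * c)%g = B_char b + B_char c.
Proof.
apply: val_inj.
change ((val (val b) *m val (val c)) 0 0 = val (val b) 0 0 * val (val c) 0 0).
by rewrite {1}(mx2P (val (val b))) {1}(mx2P (val (val c))) mx2M mx2E B_offdiag mulr0 addr0.
Qed.

(** Shapiro's lemma brings the class back to H_1(B), where the upper left entry is a homomorphism to
    the units. *)
Lemma detect_B (b : B) :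
  cohom (bar1 (val b) i0) 0 -> val (val b) 0 0 = 1.
Proof.
move=> b0; have E : gchain_map (hom_B_X0 A) 1 (bar1 b (1 : trivial_module B int)) = bar1 (val b) i0.
  by rewrite gchain_map_bar1 /= mulr1z.
have c : bar1 b (1 : trivial_module B int) \in @cycle (gchain (trivial_module B int)) 1 by exact: bar1_cycle.
have := @B_X0_inj A 1 _ c; rewrite E => /(_ b0) /(char_detect B_charM).
by move/(congr1 val).
Qed.

Definition T_B (t : T) : B := gsub_incl (@T2_closed A) (@B2_closed A) (@T2_sub_B2 A) t.

Lemma detect_T (t : T) : cohom (bar1 (val t) iz) 0 -> val (val t) 0 0 = 1.
Proof.
move=> t0; have E : gchain_map (hom_T_X1 A) 1 (bar1 t (1 : trivial_module T int)) = bar1 (val t) iz.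
  by rewrite gchain_map_bar1 /= mulr1z.
have c : bar1 t (1 : trivial_module T int) \in @cycle (gchain (trivial_module T int)) 1 by exact: bar1_cycle.
have := @T_X1_inj A 1 _ c; rewrite E => /(_ t0) /(cmap_cohom (gchain_map (T2_B2 A))).
rewrite raddf0 gchain_map_bar1 => /(char_detect B_charM).
by move/(congr1 val).
Qed.

Definition dX : pair_hom (X A 1) (X A 0) := coef_hom (fun g m => X_d_act g m).

Lemma dX_J y : gchain_map dX 1 (J 1 y) = 0.
Proof.
elim/gchain_ind: y => [x y xE yE|t m]; first by rewrite !raddfB xE yE subrr.
rewrite !gchain_map_btens.
have -> : pmod dX (pmod (Z1_X1 A) m) = 0 by exact: eqP (valP m).
exact: tens0r.
Qed.

(** The image of J in H_1(SL_2, X_1) dies in H_1(SL_2, X_0), because Z_1 is the kernel of the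
    differential. For the class of D the image there is -2 [D] (x) infty, and the character of B
    turns its vanishing into D^2 = 1. *)
Lemma J_cycle_cases (y : gchain (Z1 A) 1) : mu2 A = [set 1; -1] ->
  y \in @cycle (gchain (Z1 A)) 1 ->
  cohom (J 1 y) 0 \/ cohom (J 1 (y - bar1 weyl (Y A))) 0.
Proof.
move=> hmu cy; have cJ := @cmap_cycle _ _ J 1 _ cy.
have [x cx yx] := T_X1_surj cJ.
have [t xt] : exists t, cohom x (bar1 t (1 : trivial_module T int)).
  by apply: chain1_cyclic => // m; exists m; rewrite intz.
have [t01 t10] := T_offdiag t; have [a Da aE] := SL2_diag t01 t10.
set D := val t in t01 t10 Da aE; have {yx xt x cx} yD : cohom (J 1 y) (bar1 D iz).
  apply: cohom_trans yx _; have := cmap_cohom (gchain_map (hom_T_X1 A)) xt.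
  by rewrite gchain_map_bar1 /= mulr1z.
have Di0 : gact D i0 = i0.
  by rewrite gact_X frame_act_pt (line_act_infty D).2.
have DVi0 : gact D^-1%g i0 = i0 by rewrite -{1}Di0 -gactM mulVg gact1.
have dD : gchain_map dX 1 (bar1 D iz) = bar1 D (<< line_pt (line_zero A) >> : X A 0) - bar1 D i0.
  rewrite gchain_map_bar1; change (bar1 D (X_d A 0 iz) =
    bar1 D (<< line_pt (line_zero A) >> : X A 0) - bar1 D i0).
  by rewrite X_d0E; exact: tensBr.
have z0 : cohom (bar1 D (<< line_pt (line_zero A) >> : X A 0)) (- bar1 D i0).
  have := bar1_conj weyl DVi0; rewrite {1}Da weyl_diagV -Da gact_X frame_act_pt.
  rewrite (axis_act weylM true) /flip_act flips_weylM => E.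
  exact: cohom_trans E (bar1V Di0).
have D2 : cohom (bar1 (D * D)%g i0) 0.
  have := cmap_cohom (gchain_map dX) yD; rewrite dX_J dD => E.
  have := cohom_sym (cohom_trans E (cohomB z0 (cohomxx _))).
  rewrite -opprD => /cohomN; rewrite opprK oppr0.
  exact/cohom_trans/bar1_mul_fix.
have d2 : val a ^+ 2 = 1.
  have E : val (D * D)%g 0 0 = 1 := @detect_B (T_B t * T_B t)%g D2.
  move: E; rewrite SL2_mulE Da diag_SM2E mx2M mx2E mulr0 addr0.
  by rewrite expr2.
have : mu2 A (val a) by split=> //; exact: (valP a).
rewrite hmu => -[a1'|a1'].
  have a1 : val a = 1 := a1'.
  left; apply: cohom_trans yD _.
  have -> : D = 1%g by apply: val_inj; rewrite Da diag_SM2E /= a1 invr1 mx2_1.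
  exact: bar1_1.
have D1 : D = minus1.
  have a1 : val a = -1 := a1'.
  by apply: val_inj; rewrite minus1E Da diag_SM2E /= a1 invrN1.
right; rewrite raddfB -(subrr (bar1 D iz)); apply: cohomB => //.
by rewrite D1; exact: J_weyl.
Qed.

(** Here w is an involution fixing the line L spanned by e_1 + e_2. The cycle [z] = (0, infty) - (L,
    infty) + (L, 0) is the boundary of the triangle (L, 0, infty); w exchanges its two edges through
    L, whence w z + z = Y. Then [w] (x) Y is homologous to [w w] (x) z = [1] (x) z, which bounds. *)
Lemma bar1_weyl_char2 : -1 = 1 :> A -> cohom (bar1 weyl (Y A)) 0.
Proof.
move=> N1; have w2 : minus1 = 1%g by apply: val_inj; rewrite minus1E N1 mx2_1.
have N2 : 1 + 1 = 0 :> A by rewrite -{1}N1 addNr.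
have gdet : \det (mx2 1 0 1 1 : 'M[A]_2) == 1 by rewrite det_mx2 mul0r subr0 mulr1.
pose g : G := exist _ (mx2 1 0 1 1) gdet.
have gE : val g = mx2 1 0 1 1 by [].
have wE : val weyl = mx2 0 1 (-1) 0 by [].
pose L := line_act g (line_infty A).
have g0 : line_act g (line_zero A) = line_zero A by apply/line_act_zero; rewrite gE mx2E.
have w0 : line_act weyl (line_zero A) = line_infty A.
  by have := axis_act weylM false; rewrite /flip_act flips_weylM.
have wL : line_act weyl L = L.
  have : line_act (g^-1 * (weyl * g))%g (line_infty A) = line_infty A.
    apply/line_act_infty; rewrite !SL2_mulE (SL2_invE gE) wE gE !mx2M mx2E.
    by rewrite !(mul0r, mulr0, mul1r, mulr1, addr0, add0r, oppr0, N1, N2).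
  by move/(congr1 (line_act g)); rewrite -!line_actM mulVKg line_actM.
pose f1 : X A 1 := << frame_act g (infty_zero A) >>.
pose f2 : X A 1 := << frame_act (weyl * g)%g (infty_zero A) >>.
pose f0 : X A 1 := << zero_infty A >>.
have zK : f0 - f2 + f1 \in zker (X_d A 0).
  rewrite unfold_in /zker (raddfD (X_d A 0)) (raddfB (X_d A 0)) !X_d0E.
  rewrite !frame_act1E !infty_zeroE !zero_inftyE !line_actM g0 w0 -/L wL; apply/eqP.
  by rewrite opprB [X in X + _]addrC !subrKA subrr.
pose z : Z1 A := Sub (f0 - f2 + f1) zK.
have zY : gact weyl z + z = Y A.
  apply: val_inj; change (gact weyl (f0 - f2 + f1) + (f0 - f2 + f1) = iz + f0).
  rewrite (raddfD (gact weyl)) (raddfB (gact weyl)) !gact_X -!frame_actM mulgA w2 mul1g.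
  have -> : frame_act weyl (zero_infty A) = infty_zero A.
    by have E := axis_pair_act weylM false; rewrite /flip_act flips_weylM in E; exact: E.
  by rewrite [X in _ + X]addrAC addrACA subrr addr0 addrACA addNr addr0.
have := bar1_mul weyl weyl z; rewrite w2.
have -> : (weyl^-1)%g = weyl by apply: (@mulgI _ weyl); rewrite mulgV w2.
rewrite -bar1D zY => /cohom_sym E; exact: cohom_trans E (bar1_1 _).
Qed.

(** Modulo boundaries [k] is a single [g] (x) Y. If [g] is antidiagonal, write g = w d with d
    diagonal: J kills the part of d, so it must kill that of w as well, and the latter is the class
    of -1 in H_1(T). *)
Lemma Zhat_cycle_ker (k : gchain (Zhat1 A) 1) : cohom (J 1 (F 1 k)) 0 ->
  exists a : units A, cohom (F 1 k) (bar1 (val (diag_SM2 a)) (Y A)).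
Proof.
have [g kg] := @chain1_cyclic _ _ (Yhat A) k (fun g => Zhat1_trivial g _) (@Zhat1_cyclic A).
have {kg} kg : cohom (F 1 k) (bar1 (val g) (Y A)).
  by have := cmap_cohom F kg; rewrite gchain_map_bar1.
move=> /(cohom_trans (cohom_sym (cmap_cohom J kg))) Jg.
case fg : (flips g); last first.
  have [a ua gE] := flipsP g; rewrite fg in gE.
  have [|| b gb _] := @SL2_diag A (val g); rewrite ?gE ?mx2E //.
  by exists b; rewrite -gb.
pose d := (weylM^-1 * g)%g; have gd : g = (weylM * d)%g by rewrite mulVKg.
have fd : flips d = false.
  by have := flipsM weylM d; rewrite -gd fg flips_weylM; case: (flips d).
have [a ua dE] := flipsP d; rewrite fd in dE.
have [|| b db _] := @SL2_diag A (val d); rewrite ?dE ?mx2E //.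
have gY : cohom (bar1 (val g) (Y A)) (bar1 weyl (Y A) + bar1 (val d) (Y A)).
  by rewrite gd; apply: bar1_mul_fix; exact: (Y_fix weylM).
have m1 : cohom (bar1 minus1 iz) 0.
  apply: cohom_trans Jg; apply: cohom_trans (cohom_sym (J_weyl A)) _.
  have := cmap_cohom J gY; rewrite (raddfD (J 1)) db => E.
  have E2 := cohomB (cohom_sym E) (J_diag b).
  by rewrite addrK subr0 in E2.
(* The class of -1 in H_1(T) vanishes, so its diagonal entry is 1. *)
have N1 : -1 = 1 :> A.
  have mT : minus1 \in @T2 A by rewrite unfold_in /T2 is_diag_mx2 minus1E !mx2E eqxx.
  have E : val minus1 0 0 = 1 := @detect_T (exist _ minus1 mT) m1.
  by rewrite minus1E mx2E in E.
exists b; apply: cohom_trans kg _; apply: cohom_trans gY _.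
rewrite db -[X in cohom _ X]add0r; apply: cohomD (cohomxx _).
exact: bar1_weyl_char2.
Qed.

Local Notation j := (homology_map (coker_proj F) 1).

Lemma E221_ker (x : E221 A) : j (val x) = 0 <-> exists c, alpha A c = x.
Proof.
split=> [|[c <-]].
  have [y [cy yE]] := homologyP (val x); have xk := valP x; rewrite yE in xk *.
  rewrite (hmapE cy (@cmap_cycle _ _ (coker_proj F) 1 _ cy)) => /hclass_eq0 [e de].
  have [|k yk] := (coker_proj_cohom F y).1; first by exists e; rewrite subr0.
  have Jy := (J_zker cy).1 xk.
  have [a ka] := Zhat_cycle_ker (cohom_trans (cohom_sym (cmap_cohom J yk)) Jy).
  exists (sqclass a); rewrite alphaE; apply: val_inj; rewrite yE.
  have ca := bar1_cycle (Y_fix (diag_SM2 a)).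
  rewrite [LHS](alpha_class_hclass ca); apply/hclass_eq/cohom_sym.
  exact: cohom_trans yk ka.
have -> : c = sqclass (repr c) by rewrite /sqclass zprojK.
rewrite alphaE; set a := repr c.
have ca := bar1_cycle (Y_fix (diag_SM2 a)).
rewrite [X in j X](alpha_class_hclass ca).
rewrite (hmapE ca (@cmap_cycle _ _ (coker_proj F) 1 _ ca)); apply/hclass_eq0.
have [|e] := (coker_proj_cohom F (bar1 (val (diag_SM2 a)) (Y A))).2.
  by exists (bar1 (diag_SM2 a) (Yhat A)); rewrite gchain_map_bar1; exact: cohomxx.
by rewrite subr0; exists e.
Qed.

Lemma E221_surj : mu2 A = [set 1; -1] ->
  forall q : relative_homology (SM2_SL2_Z1 A) 1, exists x : E221 A, j (val x) = q.
Proof.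
move=> hmu q; have [q' [cq ->]] := homologyP q; have [y yE] := cokerP q'.
have {}yE : q' = coker_proj F 1 y by [].
have cy : y \in @cycle (gchain (Z1 A)) 1 by apply: cycle_of_rel; rewrite -yE.
suff [y' cy' [Jy' yy']] : exists2 y', y' \in @cycle (gchain (Z1 A)) 1 &
    cohom (J 1 y') 0 /\ cohom (coker_proj F 1 y') (coker_proj F 1 y).
  exists (Sub (hclass cy') ((J_zker cy').2 Jy')).
  rewrite [LHS](hmapE cy' (@cmap_cycle _ _ (coker_proj F) 1 _ cy')).
  by apply/hclass_eq; rewrite yE.
have [Jy|Jy] := J_cycle_cases hmu cy; first by exists y => //; split=> //; exact: cohomxx.
(* The subtracted chain comes from SM_2, so the relative class is unchanged. *)
exists (y - bar1 weyl (Y A)).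
  exact: rpredB cy (bar1_cycle (Y_fix weylM)).
split=> //; rewrite raddfB -[X in cohom _ X]subr0; apply: cohomB (cohomxx _) _.
apply/coker_proj_cohom; exists (bar1 weylM (Yhat A)).
rewrite gchain_map_bar1; exact: cohomxx.
Qed.
End Exactness.

Theorem proposition8p1 (A : comUnitRingType)
  (hGE2 : GE2_ring A)
  (hmu2 : mu2 A = [set 1; -1])
  (hTB : forall i : nat, (i <= 3)%N -> bijective (group_homology_map (T2_B2 A) i)) :
  ziso (relative_homology (SM2_SL2 A) 2) (W A) /\
  (ziso (relative_homology (SM2_SL2 A) 3) (relative_homology (SM2_SL2_Z1 A) 1) /\
   exists (alpha : {additive sqclasses A -> E221 A})
          (beta : {additive E221 A -> relative_homology (SM2_SL2 A) 3}),
     [/\ forall a : units A, val (alpha (sqclass a)) = alpha_class a,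
         forall x : E221 A, beta x = 0 <-> exists c : sqclasses A, alpha c = x
       & forall y : relative_homology (SM2_SL2 A) 3, exists x : E221 A, beta x = y]).
Proof.
have iso3 : ziso (relative_homology (SM2_SL2 A) 3) (relative_homology (SM2_SL2_Z1 A) 1).
  exact: rel_ziso.
split; first by apply: ziso_trans (rel0_W_ziso A); exact: rel_ziso.
split=> //; have [f [g fK gK]] := ziso_sym iso3.
pose F := gchain_map (SM2_SL2_Z1 A).
(* Here [f] is the inverse of the isomorphism in degree 3; being bijective, it carries over the
   kernel and the surjectivity found for the projection to relative homology with coefficients in
   Z_1. *)
pose beta : {additive E221 A -> relative_homology (SM2_SL2 A) 3} :=
  f \o (homology_map (coker_proj F) 1 \o (val : {additive E221 A -> group_homology 1 (Z1 A)})).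
exists (alpha A), beta; split.
- by move=> a; rewrite alphaE.
- move=> x; rewrite -E221_ker; split=> [|x0]; last first.
    by rewrite -(raddf0 f); exact: (congr1 f x0).
  by move=> bx; apply: (can_inj fK); rewrite (raddf0 f); exact: bx.
- move=> y; have [x xE] := E221_surj hmu2 (g y).
  by exists x; rewrite -[y]gK; exact: (congr1 f xE).
Qed.
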